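(* Let $n\ge 1$ be an integer and let $\Phi$ be the $n$-dimensional Matérn cluster process with parent intensity $\lambda_{\mathrm p}>0$, daughter intensity $\lambda_{\mathrm d}>0$ and cluster radius $r_{\mathrm d}>0$; let $m=\lambda_{\mathrm d}v_n r_{\mathrm d}^n$ and $\beta(r)=\min\{r,r_{\mathrm d}\}$. Let $F_{R_{\mathrm N}}(r)=1-\mathbb P^{!}_{\mathrm o}\big(\Phi(\mathcal B(\mathrm o,r))=0\big)$ be the CDF of the nearest-neighbor distance. Define \[ \overline{F_{R_{\mathrm C}}}(r)=1-\exp\Big[-v_n\lambda_{\mathrm p}\Big((r+r_{\mathrm d})^n-|r-r_{\mathrm d}|^n e^{-\lambda_{\mathrm d}v_n\beta(r)^n}-n!\sum_{k=0}^{n-1}\frac{(-1)^{n-k-1}}{k!}\big(\lambda_{\mathrm d}2^{n-1}\beta(r)^{n-1}\big)^{k-n}\Big((r+r_{\mathrm d})^k-|r-r_{\mathrm d}|^k e^{-2^n\lambda_{\mathrm d}\beta(r)^n}\Big)\Big)\Big], \] \[ \underline{F_{R_{\mathrm C}}}(r)=1-\exp\Big[-v_n\lambda_{\mathrm p}\Big((r+r_{\mathrm d})^n-|r-r_{\mathrm d}|^n e^{-\lambda_{\mathrm d}v_n\beta(r)^n}-(r+r_{\mathrm d})^n\sum_{i=0}^{n-1}\binom{n-1}{i}(-1)^i2^{i+1}\big(\lambda_{\mathrm d}v_n(r+r_{\mathrm d})^n\big)^{-(i+1)/n}\gamma\Big(\tfrac{i+1}{n},\lambda_{\mathrm d}v_n\beta(r)^n\Big)\Big)\Big].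 \] Then $\underline{F_{R_{\mathrm N}}}(r)\le F_{R_{\mathrm N}}(r)\le\overline{F_{R_{\mathrm N}}}(r)$ for all $r>0$, where: for $r\le 2r_{\mathrm d}$, \[ \overline{F_{R_{\mathrm N}}}(r)=1-\big(1-\overline{F_{R_{\mathrm C}}}(r)\big)r_{\mathrm d}^{-n}\Big[e^{-\lambda_{\mathrm d}v_n\beta(r)^n}|r-r_{\mathrm d}|^n+\sum_{k=0}^{n-1}(-1)^{n-1-k}\frac{n!}{k!}\big(\lambda_{\mathrm d}2^{n-1}\beta(r)^{n-1}\big)^{k-n}\Big(e^{-\lambda_{\mathrm d}2^{n-1}\beta(r)^{n-1}r}\,r_{\mathrm d}^k-e^{-\lambda_{\mathrm d}2^n\beta(r)^n}|r-r_{\mathrm d}|^k\Big)\Big], \] \[ \underline{F_{R_{\mathrm N}}}(r)=1-\big(1-\underline{F_{R_{\mathrm C}}}(r)\big)r_{\mathrm d}^{-n}\Big[e^{-\lambda_{\mathrm d}v_n\beta(r)^n}|r-r_{\mathrm d}|^n+\sum_{i=0}^{n-1}\binom{n-1}{i}(-1)^i(r+r_{\mathrm d})^{n-1-i}\big((\lambda_{\mathrm d}v_n)^{-1}2^n\big)^{\frac{i+1}{n}}\Big(\gamma\big(\tfrac{i+1}{n},\lambda_{\mathrm d}v_n\beta(r)^n\big)-\gamma\big(\tfrac{i+1}{n},\lambda_{\mathrm d}v_n2^{-n}r^n\big)\Big)\Big]; \] and for $r>2r_{\mathrm d}$, \[ \overline{F_{R_{\mathrm N}}}(r)=1-\big(1-\overline{F_{R_{\mathrm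 C}}}(r)\big)e^{-m},\qquad \underline{F_{R_{\mathrm N}}}(r)=1-\big(1-\underline{F_{R_{\mathrm C}}}(r)\big)e^{-m}. \]
   Context: The $n$-dimensional Matérn cluster process: $\Phi_{\mathrm p}=\{\mathbf x_i\}$ is a homogeneous Poisson point process in $\mathbb R^n$ of intensity $\lambda_{\mathrm p}$; each parent $\mathbf x_i$ receives an independent daughter process $\Phi_{\mathrm d}^{(i)}$, a homogeneous Poisson point process of intensity $\lambda_{\mathrm d}$ restricted to the ball $\mathcal B(\mathrm o,r_{\mathrm d})$ centered at the origin, independent of $\Phi_{\mathrm p}$; $\Phi=\bigcup_i(\mathbf x_i+\Phi_{\mathrm d}^{(i)})$. $\mathbb P^{!}_{\mathrm o}$ is the reduced Palm distribution at the origin; $v_n$ is the volume of the unit ball in $\mathbb R^n$; $\gamma(s,x)=\int_0^x t^{s-1}e^{-t}\,\mathrm dt$ is the lower incomplete gamma function. *)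

(* Defs.v *)
From HB Require Import structures.
From mathcomp Require Import all_boot all_order all_algebra.
From mathcomp Require Import all_classical all_reals all_analysis.

Set Implicit Arguments.
Unset Strict Implicit.
Unset Printing Implicit Defensive.

Import Order.TTheory GRing.Theory Num.Def Num.Theory.
Import numFieldNormedType.Exports.

Local Open Scope classical_set_scope.
Local Open Scope ring_scope.

Section Space.
Variable R : realType.

(* R^n is modelled as n.-tuple R, with its canonical product Borel
   sigma-algebra from mathcomp-analysis (measurable_structure.v). *)
Definition vadd n (x y : n.-tuple R) : n.-tuple R :=
  [tuple tnth x i + tnth y i | i < n].
Definition vsub n (x y : n.-tuple R) : n.-tuple R :=
  [tuple tnth x i - tnth y i | i < n].
Definition vzero n : n.-tuple R := [tuple (0 : R) | i < n].

Definition enorm n (x : n.-tuple R) : R :=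
  Num.sqrt (\sum_(i < n) tnth x i ^+ 2).

Definition cball n (c : n.-tuple R) (r : R) : set (n.-tuple R) :=
  [set y | enorm (vsub y c) <= r].

(* n-dimensional Lebesgue measure, as iterated Lebesgue integrals of the
   indicator function (Tonelli) *)
Fixpoint vol (n : nat) : set (n.-tuple R) -> \bar R :=
  match n return set (n.-tuple R) -> \bar R with
  | 0 => fun A => (\1_A [tuple] : R)%:E
  | m.+1 => fun A =>
      (\int[@lebesgue_measure R]_(x in [set: R])
          vol [set t : m.-tuple R | A [tuple of x :: t]])%E
  end.

Definition vball (n : nat) : R := fine (vol (cball (vzero n) 1)).

Definition cnt n (S B : set (n.-tuple R)) : \bar R :=
  esum (S `&` B) (fun _ => 1%E).

(* Poisson probability mass function (valid also for rate 0) *)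
Definition ppmf (rate : R) (k : nat) : R := rate ^+ k / k`!%:R * expR (- rate).

Definition lgamma (s x : R) : R :=
  let I : set R := `[0, x]%classic in
  fine (\int[@lebesgue_measure R]_(t in I)
          (powR t (s - 1) * expR (- t))%:E)%E.

Definition bounded_set n (B : set (n.-tuple R)) : Prop :=
  exists M : R, B `<=` cball (vzero n) M.

(* S is (the support of) a homogeneous Poisson point process on R^n with
   intensity lam, restricted to the set W: counts in disjoint bounded Borel
   sets are independent Poisson variables with means lam * |B /\ W|, and
   there are no points outside W. *)
Definition poisson_pp_on d (Omega : measurableType d) (P : probability Omega R)
    n (S : Omega -> set (n.-tuple R)) (lam : R) (W : set (n.-tuple R)) : Prop :=
  (forall w, S w `<=` W) /\
  (forall (B : set (n.-tuple R)) (k : nat), measurable B ->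
     measurable [set w | cnt (S w) B = (k%:R)%:E]) /\
  (forall (k : nat) (B : 'I_k -> set (n.-tuple R)) (m : 'I_k -> nat),
     (forall i, measurable (B i)) -> (forall i, bounded_set (B i)) ->
     (forall i j, i != j -> B i `&` B j = set0) ->
     P [set w | forall i, cnt (S w) (B i) = ((m i)%:R)%:E] =
       (\prod_(i < k) ppmf (lam * fine (vol (B i `&` W))) (m i))%:E).

Definition is_matern_cluster d (Omega : measurableType d)
    (P : probability Omega R) n
    (par : Omega -> nat -> n.-tuple R) (dau : nat -> Omega -> set (n.-tuple R))
    (lp ld rd : R) : Prop :=
  [/\ (forall w, injective (par w)),
      (forall i, measurable_fun setT (fun w => par w i)),
      poisson_pp_on P (fun w => range (par w)) lp setT,
      (forall j, poisson_pp_on P (dau j) ld (cball (vzero n) rd)) &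
      (forall (k : nat) (j : 'I_k -> nat), injective j ->
         forall (E0 : set Omega) (E : 'I_k -> set Omega),
         <<s [set (fun w => par w i) @^-1` B |
                i in [set: nat] & B in [set B | measurable B]] >> E0 ->
         (forall i, <<s [set [set w | cnt (dau (j i) w) B = (l%:R)%:E] |
                B in [set B | measurable B] & l in [set: nat]] >> (E i)) ->
         P (E0 `&` \bigcap_(i in [set: 'I_k]) E i) =
           (fine (P E0) * \prod_(i < k) fine (P (E i)))%:E)].

Definition matern n (par : nat -> n.-tuple R) (dau : nat -> set (n.-tuple R)) :
    set (n.-tuple R) :=
  \bigcup_(i in [set: nat]) [set vadd (par i) y | y in dau i].

(* CDF of the nearest-neighbour distance under the reduced Palm distribution
   at the origin:  F(r) = 1 - P^!_o(Phi(B(o,r)) = 0), where P^!_o is defined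
   (Campbell / stationary Palm definition) by
     P^!_o(Y) = E[ sum_{x in Phi /\ A} 1{(Phi - x) \ {o} in Y} ] / E[Phi(A)]
   with the reference window A = B(o,1). *)
Definition nn_cdf d (Omega : measurableType d) (P : probability Omega R) n
    (Phi : Omega -> set (n.-tuple R)) (r : R) : R :=
  let A := cball (vzero n) 1 in
  let num := (\int[P]_w
        cnt [set x | Phi w x /\ Phi w `&` cball x r `<=` [set x]] A)%E in
  let den := (\int[P]_w cnt (Phi w) A)%E in
  1 - fine num / fine den.

Section Bounds.
Variables (n : nat) (lp ld rd : R).
Let vn := vball n.
Let beta (r : R) := Num.min r rd.
Let m := ld * vn * rd ^+ n.

Definition FRC_up (r : R) : R :=
  1 - expR (- (vn * lp * ((r + rd) ^+ n
     - `|r - rd| ^+ n * expR (- (ld * vn * beta r ^+ n))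
     - n`!%:R * \sum_(k < n) ((-1) ^+ (n - k - 1) / k`!%:R
          * (ld * 2 ^+ (n - 1) * beta r ^+ (n - 1)) ^- (n - k)
          * ((r + rd) ^+ k - `|r - rd| ^+ k * expR (- (2 ^+ n * ld * beta r ^+ n))))))).

Definition FRC_lo (r : R) : R :=
  1 - expR (- (vn * lp * ((r + rd) ^+ n
     - `|r - rd| ^+ n * expR (- (ld * vn * beta r ^+ n))
     - (r + rd) ^+ n * \sum_(i < n) ('C(n - 1, i)%:R * (-1) ^+ i * 2 ^+ i.+1
          * powR (ld * vn * (r + rd) ^+ n) (- (i.+1%:R / n%:R))
          * lgamma (i.+1%:R / n%:R) (ld * vn * beta r ^+ n))))).

Definition FRN_up (r : R) : R :=
  if r <= 2 * rd then
    1 - (1 - FRC_up r) * rd ^- n *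
      (expR (- (ld * vn * beta r ^+ n)) * `|r - rd| ^+ n
       + \sum_(k < n) ((-1) ^+ (n - 1 - k) * (n`!%:R / k`!%:R)
          * (ld * 2 ^+ (n - 1) * beta r ^+ (n - 1)) ^- (n - k)
          * (expR (- (ld * 2 ^+ (n - 1) * beta r ^+ (n - 1) * r)) * rd ^+ k
             - expR (- (ld * 2 ^+ n * beta r ^+ n)) * `|r - rd| ^+ k)))
  else 1 - (1 - FRC_up r) * expR (- m).

Definition FRN_lo (r : R) : R :=
  if r <= 2 * rd then
    1 - (1 - FRC_lo r) * rd ^- n *
      (expR (- (ld * vn * beta r ^+ n)) * `|r - rd| ^+ n
       + \sum_(i < n) ('C(n - 1, i)%:R * (-1) ^+ i * (r + rd) ^+ (n - 1 - i)
          * powR ((ld * vn)^-1 * 2 ^+ n) (i.+1%:R / n%:R)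
          * (lgamma (i.+1%:R / n%:R) (ld * vn * beta r ^+ n)
             - lgamma (i.+1%:R / n%:R) (ld * vn * (2 ^+ n)^-1 * r ^+ n))))
  else 1 - (1 - FRC_lo r) * expR (- m).

End Bounds.
End Space.

(* Main.v *)
Require Import Defs.
From HB Require Import structures.
From mathcomp Require Import all_boot all_order all_algebra.
From mathcomp Require Import all_classical all_reals all_analysis.
From mathcomp Require Import finmap ring lra measurable_realfun.

Set Implicit Arguments.
Unset Strict Implicit.
Unset Printing Implicit Defensive.

Import Order.TTheory GRing.Theory Num.Def Num.Theory.
Import numFieldNormedType.Exports.

Local Open Scope classical_set_scope.
Local Open Scope ring_scope.

(* Only void probabilities of the cluster process [Phi] are used.  Sorting the
   parents by the rectangles they hit and passing to monotone limits gives
   P(Phi avoids U) = exp (- lp * int (1 - exp (- ld |(U - x) /\ B(o,rd)|)) dx).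
   The Campbell sum defining the reduced Palm distribution then follows from a
   device of Renyi: cut the unit ball into small cells q with corners c and mesh
   diameter e, and count the cells such that Phi avoids B(c, r + 2e) \ q but not
   B(c, r + 2e).  For small e this is the number of points without neighbours
   within r, and each summand is a difference of two void events.  Fatou's lemma
   at r = 0 provides a dominating function, and dominated convergence yields
     1 - F(r) = exp (- lp * int (1 - exp (- ld V(x))) dx)
                * (vn rd^n)^-1 * int_B(o,rd) exp (- ld V(x)) dx,
   where V(x) = |B(x,r) /\ B(o,rd)|.  With s = |x|, the volume V is vn beta^n for
   s <= |r - rd| and 0 for s > r + rd; in between the lens contains a ball of
   diameter r + rd - s and lies in a box, so that
     vn ((r + rd - s) / 2)^n <= V <= (2 beta)^(n-1) (r + rd - s).
   Radial integration of the two exponentials gives the two closed forms. *)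

(** The hypotheses speak of the parents only through counts: the law of a single [par w i] is
    unknown, and the labelling may depend on the whole configuration. This does no harm because,
    given the parents, the probability that all daughters avoid a set is a product over parents, and
    a product sees only how many parents there are of each kind. The void event of a bounded open
    set is a countable intersection of void events for finite unions of rectangles, hence measurable
    outright. A ball minus a half-open cell is not open; its void event is reached through
    decreasing open sets, which requires [Phi] to be locally finite. This holds only almost surely,
    hence the event [locfin] in the Palm computation. To first order, a cell is lonely with
    probability [lp] times a void probability times the drop of the exponent when the cell is
    removed. That drop is [ld] times the volume of the cell times an integral over the displacements
    of a point from its parent: so the average over the daughter ball emerges from void
    probabilities alone. *)

Lemma measure_mono d (T : measurableType d) (R : realType) (mu : {measure set T -> \bar R})
    (A B : set T) : measurable A -> measurable B -> A `<=` B -> (mu A <= mu B)%E.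
Proof. by move=> mA mB AB; apply: le_measure => //; apply/mem_set. Qed.

(** * Lebesgue measure on tuples *)

Section SigmaFiniteCopy.
Context d (T : measurableType d) (R : realType) (nu : {measure set T -> \bar R}).
Hypothesis nu_sigma_finite : sigma_finite [set: T] nu.

(* An alias of [nu] on which a canonical sigma-finite structure can be declared. *)
Definition sigma_finite_copy of sigma_finite [set: T] nu : set T -> \bar R := nu.

Let m := sigma_finite_copy nu_sigma_finite.
HB.instance Definition _ := Measure.on m.
HB.instance Definition _ := Measure_isSigmaFinite.Build _ _ _ m nu_sigma_finite.
HB.instance Definition _ := SigmaFiniteMeasure.copy (sigma_finite_copy nu_sigma_finite) m.
End SigmaFiniteCopy.

Section BoxVolume.
Variable R : realType.
Local Notation leb := (@lebesgue_measure R).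

Definition box n (I : 'I_n -> set R) : set (n.-tuple R) :=
  [set x | forall i, I i (tnth x i)].

Definition vcons m (p : R * m.-tuple R) : m.+1.-tuple R := [tuple of p.1 :: p.2].

Lemma measurable_tnthR n (i : 'I_n) :
  measurable_fun [set: n.-tuple R] (fun x => tnth x i).
Proof. exact: measurable_tnth. Qed.

Lemma measurable_vcons m : measurable_fun setT (@vcons m).
Proof. by apply: measurable_cons. Qed.

Lemma measurable_box n (I : 'I_n -> set R) :
  (forall i, measurable (I i)) -> measurable (box I).
Proof.
move=> mI; rewrite (_ : box I = \bigcap_(i in setT) ((fun x => tnth x i) @^-1` I i)).
  apply: fin_bigcap_measurable => // i _.
  by rewrite -[X in measurable X]setTI; exact: measurable_tnthR.
by apply/seteqP; split=> x /= h; [move=> i _; exact: h|move=> i; exact: h].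
Qed.

Lemma vol_set0 n : vol (set0 : set (n.-tuple R)) = 0%E.
Proof.
elim: n => [|n IH] /=; first by rewrite indic0.
by apply: integral0_eq => x _; exact: IH.
Qed.

Lemma vol_ge0 n (A : set (n.-tuple R)) : (0 <= vol A)%E.
Proof.
elim: n A => [|n IH] A /=; first by rewrite lee_fin.
by apply: integral_ge0.
Qed.

Lemma vol_box n (I : 'I_n -> set R) : (forall i, measurable (I i)) ->
  vol (box I) = (\prod_(i < n) leb (I i))%E.
Proof.
elim: n I => [|n IH] I mI /=.
  by rewrite big_ord0 indicE mem_set // => -[].
rewrite big_ord_recl -IH; last by move=> i; exact: mI.
pose B := box (fun i => I (lift ord0 i)).
transitivity (\int[leb]_(x in I ord0) (cst (vol B) x))%E.
  rewrite [RHS]integral_mkcond; apply: eq_integral => x _.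
  rewrite patchE; case: ifPn => xI.
    congr vol; apply/seteqP; split=> t /= h.
      by move=> i; have := h (lift ord0 i); rewrite tnthS.
    move=> i; have [->|[j ->]] : i = ord0 \/ exists j, i = lift ord0 j.
      by case: (unliftP ord0 i) => [j ->|->]; [right; exists j|left].
      by rewrite tnth0; exact: set_mem.
    by rewrite tnthS; exact: h.
  rewrite -[RHS](vol_set0 n); congr vol; apply/seteqP; split=> t //= /(_ ord0).
  by rewrite tnth0 => /mem_set xI'; rewrite xI' in xI.
rewrite muleC.
by apply: integral_cst; exact: mI.
Qed.

Lemma sigma_finite_vol n : sigma_finite [set: n.-tuple R] (@vol R n).
Proof.
exists (fun k => box (fun _ : 'I_n => `[- k%:R, k%:R]%classic)).
  apply/seteqP; split=> // x _.
  pose k := (\max_(i < n) Num.Def.truncn `|tnth x i|).+1.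
  exists k => // i /=; rewrite in_itv /= -ler_norml.
  rewrite (le_trans (ltW (truncnS_gt _))) // ler_nat ltnS.
  exact: (@leq_bigmax _ (fun j => Num.Def.truncn `|tnth x j|)).
move=> k; split; first by apply: measurable_box.
rewrite vol_box //.
suff : (\prod_(i < n) leb `[(- k%:R)%R, k%:R%R]%classic)%E \is a fin_num by move/fin_numPlt => /andP[].
apply: (big_ind (fun x : \bar R => x \is a fin_num)) => //; first exact: fin_numM.
by move=> i _; rewrite lebesgue_measure_itv; case: ifP.
Qed.

(** In dimension [n + 1], [vol] is the image under [vcons] of the product of [lebesgue_measure] with
    the n-dimensional measure. That product needs a sigma-finite second factor, so the induction
    carries sigma-finiteness along; only afterwards is [vol] itself declared a measure. *)
Lemma vol_sigma_finite_measure n :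
  exists mu : {sigma_finite_measure set (n.-tuple R) -> \bar R}, forall A, mu A = vol A.
Proof.
elim: n => [|n [mu IH]].
  by exists (\d_([tuple] : 0.-tuple R)) => A.
have sf : sigma_finite [set: n.+1.-tuple R] (pushforward (leb \x mu)%E (@vcons n)).
  rewrite (_ : pushforward _ _ = @vol R n.+1); first exact: sigma_finite_vol.
  apply/funext => A; rewrite /pushforward /product_measure1 /=.
  by apply: eq_integral => x _; rewrite IH; congr vol; rewrite xsectionE.
have [nu nuE] : exists nu : {measure set (n.+1.-tuple R) -> \bar R},
    (nu : set _ -> _) = pushforward (leb \x mu)%E (@vcons n).
  by unshelve eexists (pushforward (leb \x mu)%E (@vcons n)) => //; exact: measurable_vcons.
have sf' : sigma_finite setT nu by rewrite nuE.
exists (sigma_finite_copy sf') => A.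
rewrite /sigma_finite_copy /=; rewrite nuE /pushforward /product_measure1 /=.
by apply: eq_integral => x _; rewrite IH; congr vol; rewrite xsectionE.
Qed.

Let vol_semi_sigma_additive n : semi_sigma_additive (@vol R n).
Proof.
have [mu h] := @vol_sigma_finite_measure n.
have -> : @vol R n = mu :> (set _ -> _) by apply/funext => A; rewrite h.
exact: measure_semi_sigma_additive.
Qed.

HB.instance Definition _ n := isMeasure.Build _ _ _ (@vol R n)
  (@vol_set0 n) (@vol_ge0 n) (@vol_semi_sigma_additive n).
HB.instance Definition _ n := Measure_isSigmaFinite.Build _ _ _ (@vol R n)
  (@sigma_finite_vol n).

End BoxVolume.

(** * Translation invariance of Lebesgue measure *)

Section Translation.
Variable R : realType.
Local Notation leb := (@lebesgue_measure R).

Lemma lebesgue_measure_translate (a : R) (A : set R) : measurable A ->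
  leb [set x | A (x + a)] = leb A.
Proof.
move=> mA; have mf : measurable_fun [set: measurableTypeR R]
    ((fun x => x + a) : _ -> measurableTypeR R).
  exact: measurable_funD.
have -> : leb A = pushforward leb ((fun x => x + a) : _ -> measurableTypeR R) A.
  apply: lebesgue_measure_unique => //= _ [[c b]] _ <-.
  rewrite /pushforward (_ : _ @^-1` _ = `](c - a), (b - a)]%classic).
    by rewrite !lebesgue_measure_itv/= !lte_fin ltrD2r; case: ifP => // _; rewrite -!EFinB; congr EFin; ring.
  by apply/seteqP; split=> x /=; rewrite !in_itv /= ltrBlDr lerBrDr.
by [].
Qed.

Lemma integral_translate (a : R) (f : R -> \bar R) : measurable_fun setT f ->
  (forall x, 0 <= f x)%E ->
  (\int[leb]_x f (x + a)%R = \int[leb]_x f x)%E.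
Proof.
move=> mf f0.
have mt : measurable_fun [set: measurableTypeR R]
    ((fun x => x + a) : _ -> measurableTypeR R).
  exact: measurable_funD.
transitivity (\int[pushforward leb ((fun x => (x + a)%R) : _ -> measurableTypeR R)]_x f x)%E.
  by rewrite ge0_integral_pushforward.
apply: eq_measure_integral => A mA _; exact: lebesgue_measure_translate.
Qed.

Lemma vext n (x y : n.-tuple R) : (forall i, tnth x i = tnth y i) -> x = y.
Proof. exact: eq_from_tnth. Qed.

Lemma tnth_vadd n (x y : n.-tuple R) i : tnth (vadd x y) i = tnth x i + tnth y i.
Proof. by rewrite tnth_mktuple. Qed.
Lemma tnth_vsub n (x y : n.-tuple R) i : tnth (vsub x y) i = tnth x i - tnth y i.
Proof. by rewrite tnth_mktuple. Qed.
Lemma tnth_vzero n i : tnth (vzero R n) i = 0.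
Proof. by rewrite tnth_mktuple. Qed.

Definition vaddsubE := (tnth_vadd, tnth_vsub, tnth_vzero).

Lemma measurable_vfun d (T : measurableType d) n (f : T -> n.-tuple R) :
  (forall i, measurable_fun setT (fun x => tnth (f x) i)) -> measurable_fun setT f.
Proof. by move=> h; apply/measurable_fun_tnthP. Qed.

Lemma measurable_tnth_comp d (T : measurableType d) n (f : T -> n.-tuple R) i :
  measurable_fun setT f -> measurable_fun setT (fun x => tnth (f x) i).
Proof. by move=> /measurable_fun_tnthP; exact. Qed.

Lemma measurable_vadd d (T : measurableType d) n (f g : T -> n.-tuple R) :
  measurable_fun setT f -> measurable_fun setT g ->
  measurable_fun setT (fun x => vadd (f x) (g x)).
Proof.
move=> mf mg; apply: measurable_vfun => i.
under eq_fun do rewrite vaddsubE.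
by apply: measurable_funD; exact: measurable_tnth_comp.
Qed.

Lemma measurable_vsub d (T : measurableType d) n (f g : T -> n.-tuple R) :
  measurable_fun setT f -> measurable_fun setT g ->
  measurable_fun setT (fun x => vsub (f x) (g x)).
Proof.
move=> mf mg; apply: measurable_vfun => i.
under eq_fun do rewrite vaddsubE.
by apply: measurable_funB; exact: measurable_tnth_comp.
Qed.

Lemma measurable_comp_set d d' (T : measurableType d) (U : measurableType d')
    (f : T -> U) (A : set U) :
  measurable_fun setT f -> measurable A -> measurable [set x | A (f x)].
Proof. by move=> mf mA; rewrite -[X in measurable X]setTI; exact: mf. Qed.

Lemma tonelli_set d1 d2 (T1 : measurableType d1) (T2 : measurableType d2)
    (m1 : {sigma_finite_measure set T1 -> \bar R})
    (m2 : {sigma_finite_measure set T2 -> \bar R}) (S : set (T1 * T2)) :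
  measurable S ->
  (\int[m1]_x m2 [set y | S (x, y)] = \int[m2]_y m1 [set x | S (x, y)])%E.
Proof.
move=> mS; have := @indic_fubini_tonelli _ _ T1 T2 R m1 m2 S mS.
rewrite indic_fubini_tonelli_FE // indic_fubini_tonelli_GE // => h.
transitivity (\int[m1]_x (m2 \o xsection S) x)%E.
  by apply: eq_integral => x _; rewrite /= xsectionE.
by rewrite h; apply: eq_integral => x _; rewrite /= ysectionE.
Qed.

Lemma measurable_section d1 d2 (T1 : measurableType d1) (T2 : measurableType d2)
    (m2 : {sigma_finite_measure set T2 -> \bar R}) (S : set (T1 * T2)) :
  measurable S -> measurable_fun setT (fun x => m2 [set y | S (x, y)]).
Proof.
move=> mS; have := @measurable_fun_xsection _ _ T1 T2 R m2 S mS.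
by congr measurable_fun; apply/funext => x /=; rewrite xsectionE.
Qed.

Lemma vol_translate n (c : n.-tuple R) (A : set (n.-tuple R)) : measurable A ->
  vol [set x | A (vadd x c)] = vol A.
Proof.
elim: n c A => [|n IH] c A mA /=.
  suff -> : [set x | A (vadd x c)] = A by [].
  by apply/funext => x /=; rewrite (tuple0 (vadd x c)) (tuple0 x).
pose g x := vol [set t : n.-tuple R | A [tuple of x :: t]].
have mS : measurable [set p : R * n.-tuple R | A (vcons p)].
  by apply: measurable_comp_set => //; exact: measurable_vcons.
transitivity (\int[leb]_x g (x + tnth c ord0)%R)%E.
  apply: eq_integral => x _; rewrite /g.
    rewrite -(IH [tuple tnth c (lift ord0 i) | i < n] [set t | A (vcons ((x + tnth c ord0)%R, t))]).
    congr vol; apply/funext => t /=; congr A.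
    apply: vext => i; rewrite vaddsubE.
    by case: (unliftP ord0 i) => [j ->|->]; rewrite ?tnth0 // !tnthS !tnth_mktuple.
  by have := measurable_xsection ((x : R) + tnth c ord0) mS; rewrite xsectionE.
apply: integral_translate => //.
exact: (measurable_section (@vol R n) mS).
Qed.

End Translation.

(** * Euclidean norm, isometries, dilations and the volume of balls *)

Section Geometry.
Variable R : realType.

Definition vscale n (t : R) (x : n.-tuple R) : n.-tuple R := [tuple t * tnth x i | i < n].
Definition dot n (x y : n.-tuple R) : R := \sum_(i < n) tnth x i * tnth y i.

Lemma tnth_vscale n t (x : n.-tuple R) i : tnth (vscale t x) i = t * tnth x i.
Proof. by rewrite tnth_mktuple. Qed.
Definition vE := (tnth_vscale, vaddsubE).

Lemma dotC n (x y : n.-tuple R) : dot x y = dot y x.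
Proof. by apply: eq_bigr => i _; rewrite mulrC. Qed.
Lemma dotDl n (x y z : n.-tuple R) : dot (vadd x y) z = dot x z + dot y z.
Proof. by rewrite -big_split; apply: eq_bigr => i _; rewrite vE mulrDl. Qed.
Lemma dotBl n (x y z : n.-tuple R) : dot (vsub x y) z = dot x z - dot y z.
Proof. by rewrite -sumrB; apply: eq_bigr => i _; rewrite vE mulrBl. Qed.
Lemma dotZl n t (x z : n.-tuple R) : dot (vscale t x) z = t * dot x z.
Proof. by rewrite mulr_sumr; apply: eq_bigr => i _; rewrite vE mulrA. Qed.
Lemma dotDr n (x y z : n.-tuple R) : dot z (vadd x y) = dot z x + dot z y.
Proof. by rewrite dotC dotDl !(dotC z). Qed.
Lemma dotBr n (x y z : n.-tuple R) : dot z (vsub x y) = dot z x - dot z y.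
Proof. by rewrite dotC dotBl !(dotC z). Qed.
Lemma dotZr n t (x z : n.-tuple R) : dot z (vscale t x) = t * dot z x.
Proof. by rewrite dotC dotZl dotC. Qed.
Definition dotE := (dotDl, dotBl, dotZl, dotDr, dotBr, dotZr).

Lemma dot_ge0 n (x : n.-tuple R) : 0 <= dot x x.
Proof. by apply: sumr_ge0 => i _; rewrite -expr2 sqr_ge0. Qed.

Lemma enormE n (x : n.-tuple R) : enorm x = Num.sqrt (dot x x).
Proof. by congr Num.sqrt; apply: eq_bigr => i _; rewrite expr2. Qed.

Lemma enorm_ge0 n (x : n.-tuple R) : 0 <= enorm x.
Proof. exact: sqrtr_ge0. Qed.

Lemma sqr_enorm n (x : n.-tuple R) : enorm x ^+ 2 = dot x x.
Proof. by rewrite enormE sqr_sqrtr // dot_ge0. Qed.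

Lemma dot_eq0 n (x : n.-tuple R) : (dot x x == 0) = (x == vzero R n).
Proof.
apply/eqP/eqP => [|->]; last by apply: big1 => i _; rewrite vE mulr0.
move/eqP; rewrite psumr_eq0; last by move=> i _; rewrite -expr2 sqr_ge0.
move=> /allP h; apply: vext => i; rewrite vE.
by have := h i (mem_index_enum i); rewrite /= mulf_eq0 orbb => /eqP.
Qed.

Lemma dot_le n (x y : n.-tuple R) : dot x y <= enorm x * enorm y.
Proof.
have [y0|y0] := eqVneq (dot y y) 0.
  have -> : dot x y = 0.
    by move/eqP: y0; rewrite dot_eq0 => /eqP ->; apply: big1 => i _; rewrite vE mulr0.
  by rewrite mulr_ge0 // enorm_ge0.
have yp : 0 < dot y y by rewrite lt0r y0 dot_ge0.
have h : dot x y ^+ 2 <= dot x x * dot y y.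
  (* The squared norm of [|y|^2 x - (x.y) y] is [|y|^2 (|x|^2 |y|^2 - (x.y)^2)]. *)
  have := dot_ge0 (vsub (vscale (dot y y) x) (vscale (dot x y) y)).
  rewrite !dotE (dotC y x) => h.
  rewrite -subr_ge0 -(pmulr_rge0 _ yp).
  by apply: le_trans h _; rewrite le_eqVlt; apply/orP; left; apply/eqP; ring.
rewrite (le_trans (ler_norm _)) // -sqrtr_sqr !enormE -sqrtrM ?dot_ge0 //.
exact: ler_wsqrtr.
Qed.

Lemma enormD n (x y : n.-tuple R) : enorm (vadd x y) <= enorm x + enorm y.
Proof.
rewrite -(@ler_pXn2r _ 2) ?nnegrE ?addr_ge0 ?enorm_ge0 //.
rewrite sqrrD !sqr_enorm !dotE (dotC y x).
have := dot_le x y; lra.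
Qed.

Lemma enormZ n t (x : n.-tuple R) : enorm (vscale t x) = `|t| * enorm x.
Proof. by rewrite !enormE !dotE mulrA sqrtrM ?sqr_ge0 // -expr2 sqrtr_sqr. Qed.

Lemma enorm_vsubC n (x y : n.-tuple R) : enorm (vsub x y) = enorm (vsub y x).
Proof.
have -> : vsub x y = vscale (-1) (vsub y x) by apply: vext => i; rewrite !vE; ring.
by rewrite enormZ normrN1 mul1r.
Qed.

Lemma enorm_triangle n (x y z : n.-tuple R) :
  enorm (vsub x z) <= enorm (vsub x y) + enorm (vsub y z).
Proof.
have -> : vsub x z = vadd (vsub x y) (vsub y z) by apply: vext => i; rewrite !vE; ring.
exact: enormD.
Qed.

Lemma vsubx0 n (x : n.-tuple R) : vsub x (vzero R n) = x.
Proof. by apply: vext => i; rewrite !vE subr0. Qed.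

Lemma tnth_le_enorm n (x : n.-tuple R) i : `|tnth x i| <= enorm x.
Proof.
rewrite -sqrtr_sqr; apply: ler_wsqrtr.
by rewrite (bigD1 i) //= lerDl sumr_ge0 // => j _; exact: sqr_ge0.
Qed.

Lemma enorm_le_sum n (x : n.-tuple R) (e : R) : 0 <= e ->
  (forall i, `|tnth x i| <= e) -> enorm x <= n%:R * e.
Proof.
move=> e0 h; rewrite -(@ler_pXn2r _ 2) ?nnegrE ?mulr_ge0 ?enorm_ge0 ?ler0n //.
rewrite sqr_enorm (@le_trans _ _ (\sum_(i < n) e ^+ 2)) //.
  by apply: ler_sum => i _; rewrite -expr2 -real_normK ?num_real // lerXn2r ?nnegrE.
rewrite sumr_const card_ord -[leLHS]mulr_natl exprMn ler_wpM2r ?sqr_ge0 // -natrX ler_nat.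
by case: n {x h} => // n; rewrite expnS expn1 leq_pmulr.
Qed.

Lemma measurable_enorm n : measurable_fun setT (@enorm R n).
Proof.
rewrite (_ : @enorm R n = fun x => Num.sqrt (\sum_(i < n) tnth x i ^+ 2)) //.
apply: (@measurableT_comp _ _ _ _ _ _ (Num.sqrt : R -> R)).
  apply: continuous_measurable_fun; exact: sqrt_continuous.
by apply: measurable_sum => i; apply: measurable_funX; exact: measurable_tnth.
Qed.

Lemma measurable_cball n (c : n.-tuple R) r : measurable (cball c r).
Proof.
have -> : cball c r = [set x | (fun y => [set z | z <= r] y) (enorm (vsub x c))] by [].
apply: (@measurable_comp_set _ _ _ _ (fun x => enorm (vsub x c)) [set z | z <= r]).
  apply: (measurableT_comp (@measurable_enorm n)); exact: measurable_vsub.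
rewrite (_ : [set z | z <= r] = `]-oo, r]%classic); first exact: measurable_itv.
by apply/seteqP; split=> z /=; rewrite in_itv.
Qed.

(* Both products equal the integral of [1_A x * 1_B (x + y)] with respect to
   [mu dx, nu dy]: this is Tonelli's theorem together with the invariance. *)
Lemma invariant_measure_unique n (mu nu : {sigma_finite_measure set (n.-tuple R) -> \bar R})
    (A B : set (n.-tuple R)) :
  (forall c C, measurable C -> mu [set x | C (vadd x c)] = mu C) ->
  (forall c C, measurable C -> nu [set x | C (vadd x c)] = nu C) ->
  measurable A -> measurable B -> (forall x, A x -> A (vscale (-1) x)) ->
  (mu A * nu B = mu B * nu A)%E.
Proof.
move=> muT nuT mA mB symA.
pose S := [set p : n.-tuple R * n.-tuple R | A p.1 /\ B (vadd p.1 p.2)].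
pose T := [set p : n.-tuple R * n.-tuple R | B p.1 /\ A (vsub p.1 p.2)].
have mS : measurable S.
  by apply: measurableI; apply: measurable_comp_set => //; exact: measurable_vadd.
have mT : measurable T.
  by apply: measurableI; apply: measurable_comp_set => //; exact: measurable_vsub.
have key (m1 m2 : {sigma_finite_measure set (n.-tuple R) -> \bar R}) (C D : set (n.-tuple R)) U s :
    measurable C ->
    (forall x, [set y | U (x, y)] = if x \in C then [set y | D (vadd y (s x))] else set0) ->
    (forall x, m2 [set y | D (vadd y (s x))] = m2 D) ->
    (\int[m1]_x m2 [set y | U (x, y)] = m1 C * m2 D)%E.
  move=> mC hU hD.
  transitivity (\int[m1]_(x in C) (cst (m2 D) x))%E.
    rewrite [RHS]integral_mkcond; apply: eq_integral => x _.
    by rewrite patchE hU; case: ifP => _; rewrite ?hD // measure0.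
  by rewrite integral_cst // muleC.
rewrite -(key mu nu A B S id) //; last 2 first.
- move=> x; case: ifPn => [/set_mem|/negP] xA; apply/seteqP; split=> y //=.
  + by rewrite (_ : vadd y x = vadd x y) => [[]//|]; apply: vext => i; rewrite !vE addrC.
  + by rewrite (_ : vadd y x = vadd x y) // ; apply: vext => i; rewrite !vE addrC.
  + by case => /mem_set.
- by move=> x; exact: nuT.
rewrite tonelli_set //.
transitivity (\int[nu]_y mu [set x | T (x, y)])%E.
  apply: eq_integral => y _; rewrite -(muT (vscale (-1) y) [set x | S (x, y)]); last first.
    by have := measurable_ysection y mS; rewrite ysectionE.
  congr (mu _); apply/funext => x /=; rewrite propeqE /S /T /=.
  have -> : vadd (vadd x (vscale (-1) y)) y = x by apply: vext => i; rewrite !vE; ring.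
  have -> : vadd x (vscale (-1) y) = vsub x y by apply: vext => i; rewrite !vE; ring.
  by split=> -[].
rewrite -(tonelli_set mu nu mT) (key mu nu B A T (vscale (-1))) //; last by move=> x; exact: nuT.
have sA x y : A (vsub x y) -> A (vadd y (vscale (-1) x)).
  move=> /symA; congr A; apply: vext => i; rewrite !vE; ring.
have sA' x y : A (vadd y (vscale (-1) x)) -> A (vsub x y).
  move=> /symA; congr A; apply: vext => i; rewrite !vE; ring.
move=> x; case: ifPn => [/set_mem|/negP] xB; apply/seteqP; split=> y //=.
- by case=> _ /sA.
- by move=> /sA'.
- by case => /mem_set.
Qed.

Section Bijection.
Variables (n : nat) (f g : n.-tuple R -> n.-tuple R).
Hypotheses (mf : measurable_fun setT f) (mg : measurable_fun setT g).
Hypotheses (fK : cancel f g) (gK : cancel g f).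
Hypothesis fD : forall x c, f (vadd x c) = vadd (f x) (f c).

(** The image of [vol] under an additive bijection is again translation invariant, hence
    proportional to [vol]. Cross-multiplying with a symmetric reference set [A] leaves the factor
    implicit; isometries will use a ball for [A], dilations a cube. *)
Lemma vol_image_unique (A B : set (n.-tuple R)) :
  measurable A -> measurable B -> (forall x, A x -> A (vscale (-1) x)) ->
  (vol [set x | A (f x)] * vol B = vol [set x | B (f x)] * vol A)%E.
Proof.
move=> mA mB symA.
have [nu nuE] : exists nu : {measure set (n.-tuple R) -> \bar R},
    (nu : set _ -> _) = pushforward (@vol R n) f.
  by unshelve eexists (pushforward (@vol R n) f).
have sf : sigma_finite setT nu.
  have [F FT Foo] := @sigma_finite_vol R n.
  exists (fun k => [set y | F k (g y)]).
    apply/seteqP; split=> // y _.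
    have [k _ Fk] : (\bigcup_k F k) (g y) by rewrite -FT.
    by exists k.
  move=> k; have [mFk Fkoo] := Foo k; split; first exact: measurable_comp_set.
  rewrite nuE /pushforward (_ : f @^-1` _ = F k) //.
  by apply/seteqP; split=> x /=; rewrite fK.
have := @invariant_measure_unique n (sigma_finite_copy sf) (@vol R n) A B.
rewrite /sigma_finite_copy /= nuE /pushforward /=; apply => //.
  move=> c C mC.
  rewrite -[RHS](vol_translate (g c)); last exact: measurable_comp_set.
  by congr vol; apply/seteqP; split=> x /=; rewrite fD gK.
by move=> c C mC; exact: vol_translate.
Qed.

End Bijection.

Lemma measurable_vscale n t : measurable_fun setT (@vscale n t).
Proof.
apply: measurable_vfun => i; under eq_fun do rewrite vE.
by apply: measurable_funM => //; exact: measurable_tnth.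
Qed.

Lemma cball_tnth n r : cball (vzero R n) r `<=` box (fun _ => `[(- r), r]%classic).
Proof.
move=> x; rewrite /cball /= vsubx0 => xr i /=.
by rewrite in_itv /= -ler_norml (le_trans (tnth_le_enorm x i)).
Qed.

Lemma vol_cube n (r : R) : 0 <= r ->
  vol (box (fun _ : 'I_n => `[(- r), r]%classic)) = ((2 * r) ^+ n)%:E.
Proof.
move=> r0; rewrite vol_box //.
transitivity (\prod_(i < n) (2 * r)%:E)%E.
  apply: eq_bigr => i _; rewrite lebesgue_measure_itv /= lte_fin.
  case: ltP => h; first by rewrite -EFinB; congr EFin; ring.
  by congr EFin; lra.
by rewrite prodEFin prodr_const card_ord.
Qed.

Lemma vol_cball_lty n (r : R) : (vol (cball (vzero R n) r) < +oo)%E.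
Proof.
have [r0|r0] := leP 0 r; last first.
  rewrite (_ : cball _ _ = set0) ?vol_set0 ?ltry//.
  apply/seteqP; split=> x //=; rewrite /cball /= => h.
  by have := le_lt_trans h r0; rewrite ltNge enorm_ge0.
apply: le_lt_trans (ltry ((2 * r) ^+ n)).
rewrite -vol_cube //; apply: measure_mono; last exact: cball_tnth.
  exact: measurable_cball.
by apply: measurable_box.
Qed.

Lemma vol_cball_gt0 n (r : R) : 0 < r -> (0 < vol (cball (vzero R n) r))%E.
Proof.
move=> r0; pose e := r / n.+1%:R.
have e0 : 0 < e by rewrite divr_gt0.
apply: (@lt_le_trans _ _ ((2 * e) ^+ n)%:E).
  by rewrite lte_fin exprn_gt0 // mulr_gt0.
rewrite -vol_cube; last exact: ltW.
apply: measure_mono.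
- by apply: measurable_box.
- exact: measurable_cball.
move=> x xe; rewrite /cball /= vsubx0.
apply: le_trans (enorm_le_sum (ltW e0) _) _.
  by move=> i; rewrite ler_norml; have := xe i; rewrite /= in_itv.
by rewrite /e mulrCA ler_piMr ?ltW // ltr_pdivrMr // mul1r ltr_nat.
Qed.

Lemma mule_pinj (c x y : \bar R) : c \is a fin_num -> (0 < c)%E ->
  (c * x = c * y)%E -> x = y.
Proof.
move=> cf c0 e; apply/eqP.
by rewrite eq_le -(lee_pmul2l cf c0 x y) -(lee_pmul2l cf c0 y x) e lexx.
Qed.

(** The unit ball is its own preimage and has positive finite volume, so it cancels from the
    cross-multiplied identity. *)
Lemma vol_isometry n (f g : n.-tuple R -> n.-tuple R) (B : set (n.-tuple R)) :
  measurable_fun setT f -> measurable_fun setT g -> cancel f g -> cancel g f ->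
  (forall x c, f (vadd x c) = vadd (f x) (f c)) ->
  (forall x, enorm (f x) = enorm x) -> measurable B ->
  vol [set x | B (f x)] = vol B.
Proof.
move=> mf mg fK gK fD fN mB.
have := @vol_image_unique n f g mf mg fK gK fD (cball (vzero R n) 1) B.
move=> /(_ (measurable_cball _ _) mB).
rewrite (_ : [set x | cball _ 1 (f x)] = cball (vzero R n) 1); last first.
  by apply/seteqP; split=> x; rewrite /cball /= !vsubx0 fN.
set c := vol _ => h.
have c0 : (0 < c)%E by exact: vol_cball_gt0.
have cf : c \is a fin_num by rewrite ge0_fin_numE ?vol_cball_lty // ltW.
apply: (mule_pinj cf c0); rewrite h; first exact: muleC.
by move=> x; rewrite /cball /= !vsubx0 enormZ normrN1 mul1r.
Qed.

(** The reference set is a cube because its volume and that of its preimage are known explicitly;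
    the scaling of balls is a consequence. *)
Lemma vol_scale n (t : R) (B : set (n.-tuple R)) : 0 < t -> measurable B ->
  ((t ^+ n)%:E * vol [set x | B (vscale t x)] = vol B)%E.
Proof.
move=> t0 mB; have tn0 := gt_eqF t0.
have K u : u != 0 -> cancel (@vscale n u) (@vscale n u^-1).
  by move=> u0 x; apply: vext => i; rewrite !vE mulKf.
pose C : set (n.-tuple R) := box (fun _ => `[(- 1), 1]%classic).
have mC : measurable C by apply: measurable_box.
have := @vol_image_unique n (vscale t) (vscale t^-1) (@measurable_vscale _ _)
  (@measurable_vscale _ _) (K _ (lt0r_neq0 t0)) _ _ C B mC mB.
have -> : [set x | C (vscale t x)] = box (fun _ => `[(- t^-1), t^-1]%classic).
  apply/seteqP; split=> x /= h i; have := h i; rewrite !vE /= !in_itv /= -!ler_norml;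
  by rewrite normrM gtr0_norm // mulrC -ler_pdivlMr // div1r.
rewrite !vol_cube // ?invr_ge0 ?ltW // => h.
have {}h : (((2 * t^-1) ^+ n)%:E * vol B = vol [set x | B (vscale t x)] * ((2 * 1) ^+ n)%:E)%E.
  apply: h; first by move=> x; apply: vext => i; rewrite !vE mulVKf // ?gt_eqF.
    by move=> x c; apply: vext => i; rewrite !vE mulrDr.
  move=> x h i; have := h i; rewrite !vE /= !in_itv /= -!ler_norml.
  by rewrite normrM normrN1 mul1r.
have p2 : (0 < ((2 / t) ^+ n)%:E)%E by rewrite lte_fin exprn_gt0 // divr_gt0.
apply: (mule_pinj _ p2) => //; rewrite h muleA -EFinM -exprMn mulr1.
by rewrite divfK ?lt0r_neq0 // muleC.
Qed.

Lemma cball_shift n (c : n.-tuple R) r : cball c r = [set x | cball (vzero R n) r (vadd x (vscale (-1) c))].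
Proof.
apply/funext => x; rewrite /cball /= vsubx0; congr (enorm _ <= r : Prop).
by apply: vext => i; rewrite !vE; ring.
Qed.

Lemma vol_cball_shift n (c : n.-tuple R) r : vol (cball c r) = vol (cball (vzero R n) r).
Proof. by rewrite cball_shift vol_translate //; exact: measurable_cball. Qed.

Lemma vball_gt0 n : 0 < vball R n.
Proof. by rewrite /vball fine_gt0 // vol_cball_gt0 // vol_cball_lty. Qed.

Lemma vol_cball n (c : n.-tuple R) r : (0 < n)%N -> 0 <= r ->
  vol (cball c r) = (vball R n * r ^+ n)%:E.
Proof.
move=> n0; rewrite le_eqVlt vol_cball_shift => /predU1P[<-|r0].
  have -> : vball R n * 0 ^+ n = (2 * 0) ^+ n by rewrite mulr0 !expr0n gtn_eqF // mulr0.
  apply/eqP; rewrite eq_le -vol_cube //; apply/andP; split.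
    apply: measure_mono; last exact: cball_tnth.
      exact: measurable_cball.
    by apply: measurable_box.
  by rewrite vol_cube // mulr0 expr0n gtn_eqF // vol_ge0.
rewrite EFinM /vball fineK; last first.
  by rewrite ge0_fin_numE ?vol_ge0 // vol_cball_lty.
rewrite -(vol_scale r0 (@measurable_cball _ _ r)) muleC; congr (_ * _)%E.
congr vol; apply/seteqP; split=> x; rewrite /cball /= !vsubx0 enormZ gtr0_norm //.
  by rewrite mulrC -ler_pdivlMr // divff // lt0r_neq0.
by move=> h; rewrite mulrC -ler_pdivlMr // divff // lt0r_neq0.
Qed.

(* Householder reflection exchanging [x] and [|x| e_i]; when they coincide the
   vector below is null and division by zero makes the map the identity. *)
Lemma householder n (i : 'I_n) (x : n.-tuple R) :
  exists f : n.-tuple R -> n.-tuple R,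
    [/\ measurable_fun setT f, involutive f,
        (forall y c, f (vadd y c) = vadd (f y) (f c)),
        (forall y, enorm (f y) = enorm y) &
        f x = [tuple (if j == i then enorm x else 0) | j < n]].
Proof.
pose e := [tuple (if j == i then enorm x else 0) | j < n].
have [v def_v] : exists v, v = vsub x e by eexists.
pose f y := vsub y (vscale (2 * dot v y / dot v v) v).
have fD y c : f (vadd y c) = vadd (f y) (f c).
  by apply: vext => j; rewrite !vE !dotE; ring.
have dv0 y : dot v v = 0 -> dot v y = 0.
  by move/eqP; rewrite dot_eq0 => /eqP ->; apply: big1 => j _; rewrite vE mul0r.
have dvf y : dot v (f y) = - dot v y.
  rewrite /f !dotE; have [v0|v0] := eqVneq (dot v v) 0; last by field.
  by rewrite v0 dv0 //; ring.
exists f; split=> //.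
- apply: measurable_vfun => j; under eq_fun do rewrite !vE.
  apply: measurable_funB; first exact: measurable_tnth.
  apply: measurable_funM => //; apply: measurable_funM => //.
  apply: measurable_funM => //; apply: measurable_sum => k.
  by apply: measurable_funM => //; exact: measurable_tnth.
- by move=> y; rewrite {1}/f dvf; apply: vext => j; rewrite !vE; ring.
- move=> y; rewrite !enormE; congr Num.sqrt.
  rewrite /f !dotE (dotC y v); have [v0|v0] := eqVneq (dot v v) 0; last by field.
  by rewrite v0 dv0 //; ring.
- apply: vext => j; rewrite /f !vE.
  have tE k : tnth e k = if k == i then enorm x else 0 by rewrite tnth_mktuple.
  have ee : dot e e = dot x x.
    rewrite -[RHS]sqr_enorm /dot (bigD1 i) //= big1 ?addr0.
      by rewrite tE eqxx expr2.
    by move=> k /negbTE ki; rewrite tE ki mulr0.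
  have vv : dot v v = 2 * dot v x by rewrite def_v !dotE ee (dotC x e); ring.
  rewrite -vv; have [v0|v0] := eqVneq (dot v v) 0.
    move/eqP: (v0); rewrite dot_eq0 => /eqP vz.
    have := congr1 (fun u => tnth u j) vz; rewrite {1}def_v !vE => /eqP; rewrite subr_eq0 => /eqP ->.
    by rewrite v0 mul0r mul0r subr0.
  by rewrite divff // mul1r def_v vE; ring.
Qed.

Lemma ge0_integral_preserved n (f : n.-tuple R -> n.-tuple R) (h : n.-tuple R -> \bar R) :
  measurable_fun setT f ->
  (forall B, measurable B -> vol [set x | B (f x)] = vol B) ->
  measurable_fun setT h -> (forall x, 0 <= h x)%E ->
  (\int[@vol R n]_x h (f x) = \int[@vol R n]_x h x)%E.
Proof.
move=> mf fvol mh h0.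
transitivity (\int[pushforward (@vol R n) f]_x h x)%E.
  by rewrite ge0_integral_pushforward.
by apply: eq_measure_integral => A mA _; exact: fvol.
Qed.

End Geometry.

(** * Void probabilities *)

Section Counting.
Variable R : realType.

Lemma measure_finType_bigcup d (T : measurableType d) (mu : {measure set T -> \bar R})
    (I : finType) (F : I -> set T) :
  (forall i, measurable (F i)) -> trivIset setT F ->
  mu (\bigcup_i F i) = (\sum_i mu (F i))%E.
Proof.
move=> mF tF; rewrite measure_fin_bigcup //; last exact: finite_finset.
rewrite (@fsbigE _ _ _ _ _ (index_enum I)) ?index_enum_uniq //.
- by apply: eq_bigl => i; rewrite in_setT.
- by move=> i _; rewrite mem_index_enum.
Qed.

Variable n : nat.
Implicit Types S B : set (n.-tuple R).

Lemma cnt_ge0 S B : (0 <= cnt S B)%E.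
Proof. exact: esum_ge0. Qed.

Lemma cnt_fin S B : finite_set (S `&` B) ->
  cnt S B = (#|` fset_set (S `&` B)|%:R)%:E.
Proof.
move=> fSB; rewrite /cnt esum_fset // fsbig_finite //=.
have sum1 (s : seq (n.-tuple R)) : (\sum_(x <- s) (1 : \bar R) = ((size s)%:R)%:E)%E.
  by elim: s => [|a s IH]; rewrite ?big_nil // big_cons IH /= -EFinD -natr1 addrC.
exact: sum1.
Qed.

Lemma le_cnt S B S' B' : S `&` B `<=` S' `&` B' -> (cnt S B <= cnt S' B')%E.
Proof.
move=> h; rewrite /cnt (esum_mkcond (S `&` B)) (esum_mkcond (S' `&` B')).
apply: le_esum => x _; case: ifPn => [/set_mem/h/mem_set -> //|_]; by case: ifP.
Qed.

Lemma cnt_fset_ge S B (A : {fset n.-tuple R}) : [set` A] `<=` S `&` B ->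
  ((#|` A|%:R)%:E <= cnt S B)%E.
Proof.
move=> h; apply: le_trans (_ : cnt [set` A] setT <= _)%E; last by apply: le_cnt; rewrite setIT.
by rewrite cnt_fin setIT // set_fsetK.
Qed.

Lemma cnt_infinite S B : infinite_set (S `&` B) -> cnt S B = +oo%E.
Proof.
move=> h; apply/eqyP => t _; have [A AS cA] := infinite_set_fset (Num.Def.truncn `|t|).+1 h.
apply: le_trans (cnt_fset_ge AS); rewrite lee_fin (le_trans (ler_norm _)) //.
by rewrite (le_trans (ltW (truncnS_gt _))) // ler_nat.
Qed.

Lemma cnt_natP S B k : cnt S B = (k%:R)%:E -> finite_set (S `&` B).
Proof. by move=> h; apply: contrapT => /cnt_infinite; rewrite h. Qed.

Lemma cnt_eq0 S B : cnt S B = 0%E <-> S `&` B = set0.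
Proof.
split=> [h|h]; last by rewrite /cnt h esum_set0.
have f : finite_set (S `&` B) by apply: (@cnt_natP _ _ 0); rewrite h.
move: h; rewrite cnt_fin // => -[/eqP]; rewrite pnatr_eq0 cardfs_eq0 => /eqP h.
by rewrite -(fset_setK f) h set_fset0.
Qed.

Lemma cnt_partition (I : finType) (F : I -> set (n.-tuple R)) S :
  trivIset setT F -> cnt S (\bigcup_i F i) = (\sum_i cnt S (F i))%E.
Proof.
move=> tF; rewrite /cnt esum_mkcondr.
transitivity (\esum_(x in S) \sum_(i : I) (if x \in F i then 1 else 0 : \bar R))%E.
  apply: eq_esum => x _; case: ifPn => [/set_mem[i _ Fix]|/negP xF].
    rewrite (bigD1 i) //= mem_set // big1 ?adde0 // => j ji; case: ifPn => // /set_mem Fjx.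
    by case/negP: ji; apply/eqP; apply: tF => //; exists x.
  by rewrite big1 // => i _; case: ifPn => // /set_mem Fix; case: xF; apply/mem_set; exists i.
rewrite esum_sum; last by move=> x i _ _; case: ifP.
by apply: eq_bigr => i _; rewrite [RHS]esum_mkcondr.
Qed.

(** Injectivity lets a count of parents be read as a series over labels, the form in which it can be
    compared with products over the first labels. *)
Lemma cnt_injective_range (x : nat -> n.-tuple R) B : injective x ->
  cnt (range x) B = (\sum_(0 <= i <oo) (\1_B (x i))%:E)%E.
Proof.
move=> xI; rewrite /cnt.
have -> : range x `&` B = x @` [set i | i \in x @^-1` B].
  apply/seteqP; split=> [_ [[i _ <-] Bx]|_ [i /= /set_mem Bi <-]].
    by exists i => //=; exact/mem_set.
  by split=> //; exists i.
rewrite esum_pred_image //; last by move=> ? ? _ _; exact: xI.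
rewrite eseries_mkcond; apply: eq_eseriesr => i _; rewrite indicE.
have -> : (i \in x @^-1` B) = (x i \in B) by apply/idP/idP => /set_mem ?; exact/mem_set.
by case: (x i \in B).
Qed.

End Counting.

Section PoissonVoid.
Context (R : realType) d (Omega : measurableType d) (P : probability Omega R).
Variables (n : nat) (S : Omega -> set (n.-tuple R)) (lam : R) (W : set (n.-tuple R)).
Hypothesis hS : poisson_pp_on P S lam W.

Lemma measurable_cnt_eq (B : set (n.-tuple R)) (k : nat) : measurable B ->
  measurable [set w | cnt (S w) B = (k%:R)%:E].
Proof. by case: hS => _ [h _]; exact: h. Qed.

Lemma poisson_cnt_eq (B : set (n.-tuple R)) k : measurable B -> Defs.bounded_set B ->
  P [set w | cnt (S w) B = (k%:R)%:E] = (ppmf (lam * fine (vol (B `&` W))) k)%:E.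
Proof.
move=> mB bB; case: hS => _ [_ h].
have := h 1%N (fun=> B) (fun=> k) (fun=> mB) (fun=> bB).
rewrite big_ord1 => <-; last by move=> i j; rewrite !ord1 eqxx.
by congr (P _); apply/seteqP; split=> w //= /(_ ord0).
Qed.

Lemma poisson_void (B : set (n.-tuple R)) : measurable B -> Defs.bounded_set B ->
  P [set w | cnt (S w) B = 0%E] = (expR (- (lam * fine (vol (B `&` W)))))%:E.
Proof.
move=> mB bB; rewrite (poisson_cnt_eq 0 mB bB) /ppmf.
by rewrite expr0 fact0 divr1 mul1r.
Qed.

End PoissonVoid.

Section Limits.
Variable R : realType.

Lemma eventually_nat_eq (u : nat -> nat) (m : nat) :
  (((u k)%:R : R)%:E @[k --> \oo] --> ((m%:R : R)%:E)) -> \forall k \near \oo, u k = m.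
Proof.
move=> /fine_cvgP[_ /cvgrPdist_lt /(_ 1 ltr01)]; apply: filterS => k /=.
have [km|mk] := leqP (u k) m.
  rewrite -natrB // normr_nat -[1]/(1%:R) ltr_nat ltnS leqn0 subn_eq0 => h.
  by apply/eqP; rewrite eqn_leq km h.
rewrite distrC -natrB ?(ltnW mk) // normr_nat -[1]/(1%:R) ltr_nat ltnS leqn0 subn_eq0.
by rewrite leqNgt mk.
Qed.

Lemma cvg_bigprod (I : Type) (r : seq I) (f : I -> nat -> R) (l : I -> R) :
  (forall i, f i k @[k --> \oo] --> l i) ->
  \prod_(i <- r) f i k @[k --> \oo] --> \prod_(i <- r) l i.
Proof.
move=> h; elim: r => [|i r IH].
  under eq_fun do rewrite big_nil.
  by rewrite big_nil; exact: cvg_cst.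
under eq_fun do rewrite big_cons.
by rewrite big_cons; apply: cvgM.
Qed.

(** The generating function at [h] of a Poisson variable of mean [rho]; at [h = 1] it is the total
    mass. *)
Lemma cvg_ppmf_gen (h rho : R) :
  (\sum_(j < T) h ^+ j * ppmf rho j) @[T --> \oo] --> expR (- (rho * (1 - h))).
Proof.
have -> : expR (- (rho * (1 - h))) = expR (- rho) * expR (h * rho).
  by rewrite -expRD; congr expR; ring.
have -> : (fun T => \sum_(j < T) h ^+ j * ppmf rho j) =
    (fun T => expR (- rho) * series (exp_coeff (h * rho)) T).
  apply/funext => T; rewrite /series /= big_mkord mulr_sumr; apply: eq_bigr => j _.
  by rewrite /ppmf /exp_coeff /= exprMn; ring.
by apply: cvgMr; exact: is_cvg_series_exp_coeff.
Qed.

End Limits.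

(** * Void probability for a finite union of rectangles of parents and displacements *)

Section VoidRect.
Context (R : realType) d (Omega : measurableType d) (P : probability Omega R) (n : nat).
Variables (par : Omega -> nat -> n.-tuple R) (dau : nat -> Omega -> set (n.-tuple R)).
Variables (lp ld rd : R).
Hypothesis mcp : is_matern_cluster P par dau lp ld rd.
Hypotheses (lp0 : 0 < lp) (ld0 : 0 < ld).
Let W := cball (vzero R n) rd.

Let par_inj w : injective (par w). Proof. by case: mcp => h _ _ _ _; exact: h. Qed.
Let mpar i : measurable_fun setT (fun w => par w i).
Proof. by case: mcp => _ h _ _ _; exact: h. Qed.
Let par_poisson : poisson_pp_on P (fun w => range (par w)) lp setT.
Proof. by case: mcp. Qed.
Let dau_poisson j : poisson_pp_on P (dau j) ld W.
Proof. by case: mcp => _ _ _ h _; exact: h. Qed.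

Variables (L : nat) (b1 b2 : 'I_L -> set (n.-tuple R)).
Hypotheses (mb1 : forall l, measurable (b1 l)) (mb2 : forall l, measurable (b2 l)).
Hypotheses (bb1 : forall l, Defs.bounded_set (b1 l)) (bb2 : forall l, Defs.bounded_set (b2 l)).

(* [pat x] tells which of the sets [b1 l] contain the parent [x], so that its
   daughters have to avoid [hole (pat x)].  The parents of a given nonempty
   pattern [s] are Poisson in number, and each of them contributes an
   independent factor [esc s]. *)
Let pat (x : n.-tuple R) : {set 'I_L} := [set l | x \in b1 l]%SET.
Let cell (s : {set 'I_L}) : set (n.-tuple R) := [set x | pat x = s].
Let hole (s : {set 'I_L}) : set (n.-tuple R) := \bigcup_(l in [set l | l \in s]) b2 l.
Let esc (s : {set 'I_L}) : R := expR (- (ld * fine (vol (hole s `&` W)))).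

Let esc_ge0 s : 0 <= esc s. Proof. exact: expR_ge0. Qed.
Let esc_le1 s : esc s <= 1.
Proof.
by rewrite expR_le1 oppr_le0 mulr_ge0 ?(ltW ld0) // fine_ge0 // vol_ge0.
Qed.

Let measurable_cell s : measurable (cell s).
Proof.
have -> : cell s = \bigcap_(l in [set: 'I_L]) (if l \in s then b1 l else ~` b1 l).
  apply/seteqP; split=> x /=.
    move=> <- l _; rewrite /pat inE; case: ifPn => [/set_mem //|/negP xl bl].
    exact/xl/mem_set.
  move=> h; apply/setP => l; rewrite inE; move: (h l Logic.I).
  by case: (l \in s) => hl; [exact/mem_set|apply/negbTE/negP => /set_mem].
apply: fin_bigcap_measurable; first exact: finite_finset.
by move=> l _; case: ifP => // _; exact: measurableC.
Qed.

Let measurable_pat_fun (f : {set 'I_L} -> R) : measurable_fun setT (fun x => f (pat x)).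
Proof.
move=> _ Y _; rewrite setTI.
have -> : (fun x => f (pat x)) @^-1` Y = \bigcup_(s in [set s | Y (f s)]) cell s.
  apply/seteqP; split=> x /=; first by move=> Yx; exists (pat x).
  by move=> [s /= Ys]; rewrite /cell /= => ->.
apply: fin_bigcup_measurable => //; exact: finite_finset.
Qed.

Let measurable_hole s : measurable (hole s).
Proof. apply: fin_bigcup_measurable => //; exact: finite_finset. Qed.

Lemma bounded_bigcup_fin (I : finType) (D : set I) (F : I -> set (n.-tuple R)) :
  (forall i, Defs.bounded_set (F i)) -> Defs.bounded_set (\bigcup_(i in D) F i).
Proof.
move=> /choice[M hM]; exists (\sum_i `|M i|) => x [i _ Fi]; have := hM i x Fi.
rewrite /cball /= => h; rewrite (le_trans h) // (le_trans (ler_norm _)) //.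
by rewrite (bigD1 i) //= lerDl sumr_ge0.
Qed.

Let bounded_hole s : Defs.bounded_set (hole s).
Proof. exact: bounded_bigcup_fin. Qed.

Let bounded_cell s : s != finset.set0 -> Defs.bounded_set (cell s).
Proof.
move=> /set0Pn[l ls]; have [M hM] := bb1 l; exists M => x xs; apply: hM.
by move: ls; rewrite -xs inE => /set_mem.
Qed.

Let esc_set0 : esc finset.set0 = 1.
Proof.
rewrite /esc (_ : hole _ = set0) ?set0I ?vol_set0 ?mulr0 ?oppr0 ?expR0 //.
by apply/seteqP; split=> x // -[l]; rewrite /= inE.
Qed.

(** [voidn M] involves only the first [M] parents, and [psi M] is its conditional probability given
    the parents: once [F] fixes the patterns, the daughter events intersected in [V] are independent
    of the parents and of each other. *)
Let voidn M := [set w | forall i, (i < M)%N -> dau i w `&` hole (pat (par w i)) = set0].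
Let psi M w := \prod_(i < M) esc (pat (par w i)).

Let F M (s : {ffun 'I_M -> {set 'I_L}}) :=
  \bigcap_(i in [set: 'I_M]) ((fun w => par w i) @^-1` cell (s i)).
Let V M (s : {ffun 'I_M -> {set 'I_L}}) :=
  \bigcap_(i in [set: 'I_M]) [set w | cnt (dau i w) (hole (s i)) = (0%:R)%:E].

Let measurable_F M s : measurable (@F M s).
Proof.
apply: fin_bigcap_measurable; first exact: finite_finset.
by move=> i _; rewrite -[X in measurable X]setTI; exact: mpar.
Qed.

Let measurable_V M s : measurable (@V M s).
Proof.
apply: fin_bigcap_measurable; first exact: finite_finset.
by move=> i _; exact: (measurable_cnt_eq (dau_poisson i)).
Qed.

Let voidnE M : voidn M = \bigcup_(s in [set: {ffun 'I_M -> {set 'I_L}}]) (F s `&` V s).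
Proof.
apply/seteqP; split=> w.
  move=> h; exists [ffun i : 'I_M => pat (par w i)] => //; split=> i _.
    by rewrite /= /cell /= ffunE.
  by rewrite /= ffunE; apply/cnt_eq0; exact: h.
move=> [s _ [Fs Vs]] i iM; have := Fs (Ordinal iM) Logic.I; rewrite /cell /= => ->.
by apply/cnt_eq0; exact: (Vs (Ordinal iM) Logic.I).
Qed.

Let F_triv M : trivIset setT (@F M).
Proof.
move=> s t _ _ [w [Fs Ft]]; apply/ffunP => i.
by rewrite -(Fs i Logic.I) -(Ft i Logic.I).
Qed.

Let FV_prob M s : P (@F M s `&` V s) = ((\prod_(i < M) esc (s i))%:E * P (F s))%E.
Proof.
case: mcp => _ _ _ _ /(_ M (fun i => nat_of_ord i) (@ord_inj M) (F s)
  (fun i => [set w | cnt (dau i w) (hole (s i)) = (0%:R)%:E])) ->.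
- rewrite EFinM fineK ?fin_num_measure // muleC; congr (_%:E * _)%E.
  by apply: eq_bigr => i _; rewrite (poisson_void (dau_poisson i)).
- pose G := [set (fun w => par w i) @^-1` B | i in [set: nat] & B in [set B | measurable B]].
  rewrite -[<<s _ >>]/(@measurable _ (g_sigma_algebraType G)).
  apply: (@fin_bigcap_measurable _ (g_sigma_algebraType G)); first exact: finite_finset.
  move=> i _; apply: sub_sigma_algebra.
  by exists (nat_of_ord i) => //; exists (cell (s i)) => //; exact: measurable_cell.
- move=> i; apply: sub_sigma_algebra; exists (hole (s i)); first exact: measurable_hole.
  by exists 0%N.
Qed.

Let measurable_psi M : measurable_fun setT (psi M).
Proof.
rewrite /psi; apply: measurable_prod => i _.
exact: (measurableT_comp (measurable_pat_fun esc) (mpar i)).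
Qed.

Let measurable_voidn M : measurable (voidn M).
Proof.
rewrite voidnE; apply: fin_bigcup_measurable; first exact: finite_finset.
by move=> s _; exact: measurableI.
Qed.

Let psi_ge0 M w : 0 <= psi M w. Proof. exact: prodr_ge0. Qed.
Let psi_le1 M w : psi M w <= 1.
Proof. by apply: prodr_ile1 => i _; rewrite esc_ge0 esc_le1. Qed.

Let voidn_prob M : P (voidn M) = (\int[P]_w (psi M w)%:E)%E.
Proof.
rewrite voidnE measure_finType_bigcup; last 2 first.
- by move=> s; exact: measurableI.
- by move=> s t _ _ [w [[Fs _] [Ft _]]]; apply: F_triv => //; exists w.
have -> : [set: Omega] = \big[setU/set0]_(s <- index_enum {ffun 'I_M -> {set 'I_L}}) F s.
  rewrite -bigcup_seq; apply/seteqP; split=> // w _.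
  exists [ffun i : 'I_M => pat (par w i)]; first by rewrite /= mem_index_enum.
  by move=> i _; rewrite /= /cell /= ffunE.
rewrite ge0_integral_bigsetU //; last 4 first.
- exact: index_enum_uniq.
- by move=> s t _ _ h; exact: F_triv.
- by apply/measurable_EFinP; exact: measurable_funS (measurable_psi M).
- by move=> w _; rewrite lee_fin.
apply: eq_bigr => s _; apply: etrans (FV_prob s) _.
rewrite -(integral_cst _ (measurable_F s)); apply: eq_integral => w /set_mem Fw.
by congr EFin; apply: eq_bigr => i _; rewrite -(Fw i Logic.I).
Qed.

Let void := [set w | forall i, dau i w `&` hole (pat (par w i)) = set0].

Let voidE : void = \bigcap_M voidn M.
Proof.
apply/seteqP; split=> w h; first by move=> M _ i _; exact: h.
by move=> i; exact: (h i.+1 Logic.I i (ltnSn i)).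
Qed.

Let measurable_void : measurable void.
Proof. by rewrite voidE; exact: bigcapT_measurable. Qed.

Let psi_nonincreasing w : nonincreasing_seq (psi ^~ w).
Proof.
apply/nonincreasing_seqP => M; rewrite /psi big_ord_recr /= ler_piMr //; exact: prodr_ge0.
Qed.

Let psil w := limn (psi ^~ w).

Let psi_cvg w : psi ^~ w @ \oo --> psil w.
Proof.
apply: nonincreasing_is_cvgn => //.
by exists 0 => _ [M _ <-].
Qed.

Let psil_ge0 w : 0 <= psil w.
Proof. by apply: limr_ge; [exact: psi_cvg|exact: nearW]. Qed.
Let psil_le1 w : psil w <= 1.
Proof. by apply: limr_le; [exact: psi_cvg|exact: nearW]. Qed.

Let measurable_psil : measurable_fun setT psil.
Proof.
by apply: (@measurable_fun_cvg _ _ _ _ psi) => // w _; exact: psi_cvg.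
Qed.

Let void_prob : P void = (\int[P]_w (psil w)%:E)%E.
Proof.
have h1 : (P \o voidn) M @[M --> \oo] --> P void.
  rewrite voidE; apply: nonincreasing_cvg_mu => //.
  - by rewrite (le_lt_trans (probability_le1 _ _)) // ltry.
  - by rewrite -voidE.
  - move=> M N MN; apply/subsetPset => w h i iM; apply: h; exact: leq_trans MN.
have h2 : (\int[P]_w (psi M w)%:E)%E @[M --> \oo] --> (\int[P]_w (psil w)%:E)%E.
  have [] // := @dominated_convergence _ _ _ P setT measurableT
     (fun M w => (psi M w)%:E) (fun w => (psil w)%:E) (cst 1%:E).
  - by move=> M; exact/measurable_EFinP.
  - exact/measurable_EFinP.
  - by apply: aeW => w _; apply/cvg_EFin; [exact: nearW|exact: psi_cvg].
  - exact: finite_measure_integrable_cst.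
  - by apply: aeW => w M _; rewrite lee_fin ger0_norm.
move: h1; rewrite (_ : P \o voidn = fun M => (\int[P]_w (psi M w)%:E)%E); last first.
  by apply/funext => M; exact: voidn_prob.
by move=> h1; exact: (cvg_unique _ h1 h2).
Qed.

(** Poisson counts are given for bounded sets, and the cell of the empty pattern need not be
    bounded. It is replaced by the empty set, at no cost since [esc] of the empty pattern is 1. *)
Let bcell s := if s == finset.set0 then set0 else cell s.
Let rho s := lp * fine (vol (bcell s `&` setT)).

Let measurable_bcell s : measurable (bcell s).
Proof. by rewrite /bcell; case: ifP. Qed.
Let bounded_bcell s : Defs.bounded_set (bcell s).
Proof. by rewrite /bcell; case: ifPn => [_|/bounded_cell //]; exists 0. Qed.
Let bcell_triv s t : s != t -> bcell s `&` bcell t = set0.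
Proof.
move=> st; rewrite /bcell; case: ifP => _; first by rewrite set0I.
case: ifP => _; first by rewrite setI0.
apply/seteqP; split=> // x [/= xs xt]; case/negP: st; apply/eqP.
by rewrite -xs -xt.
Qed.

Let B (m : {set 'I_L} -> nat) :=
  [set w | forall s, cnt (range (par w)) (bcell s) = ((m s)%:R)%:E].

Let measurable_B m : measurable (B m).
Proof.
rewrite (_ : B m = \bigcap_(s in [set: {set 'I_L}])
  [set w | cnt (range (par w)) (bcell s) = ((m s)%:R)%:E]).
  apply: fin_bigcap_measurable; first exact: finite_finset.
  by move=> s _; exact: (measurable_cnt_eq par_poisson).
by apply/seteqP; split=> w h s; [move=> _; exact: h|exact: (h s Logic.I)].
Qed.

Let B_prob m : P (B m) = (\prod_s ppmf (rho s) (m s))%:E.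
Proof.
case: (par_poisson) => _ [_ h].
have := h #|{set 'I_L}| (fun i => bcell (enum_val i)) (fun i => m (enum_val i)).
move=> /(_ (fun i => measurable_bcell _) (fun i => bounded_bcell _)).
rewrite (_ : [set w | _] = B m).
  move=> ->; last first.
    by move=> i j ij; apply: bcell_triv; apply: contra ij => /eqP/enum_val_inj ->.
  by congr EFin; rewrite [RHS]big_enum_val.
apply/seteqP; split=> w /= hw; last by move=> i; exact: hw.
by move=> s; have := hw (enum_rank s); rewrite enum_rankK.
Qed.

(** Here the labelling disappears: the infinite product over labels depends only on the pattern
    counts. The number of labels below [M] with a given nonempty pattern is an integer sequence
    converging to the count, hence eventually equal to it; labels with the empty pattern contribute
    factors 1. *)
Let psil_B m w : B m w -> psil w = \prod_s esc s ^+ m s.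
Proof.
move=> Bw; apply: cvg_lim => //.
pose N s M := (\sum_(i < M) (pat (par w i) == s))%N.
have psiE M : psi M w = \prod_s esc s ^+ N s M.
  rewrite /psi (partition_big (fun i : 'I_M => pat (par w i)) predT) //=.
  apply: eq_bigr => s _; rewrite (eq_bigr (fun=> esc s)); last by move=> i /eqP ->.
  by rewrite prodr_const /N -sum1_card big_mkcond.
under eq_fun do rewrite psiE.
apply: cvg_bigprod => s.
have [->|s0] := eqVneq s finset.set0.
  by under eq_fun do rewrite esc_set0 expr1n; rewrite esc_set0 expr1n; exact: cvg_cst.
apply: cvg_near_cst; have : \forall M \near \oo, N s M = m s.
  apply: (@eventually_nat_eq R).
  rewrite -(Bw s) cnt_injective_range //.
  rewrite (_ : (fun M => _) = (fun M => \sum_(0 <= i < M) (\1_(bcell s) (par w i))%:E)%E).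
    by apply: is_cvg_nneseries => i _ _; rewrite lee_fin.
  apply/funext => M; rewrite big_mkord sumEFin /N natr_sum; congr EFin.
  apply: eq_bigr => i _; rewrite indicE /bcell (negbTE s0); congr (_%:R).
  by congr nat_of_bool; apply/eqP/idP => [h|/set_mem //]; apply/mem_set.
by apply: filterS => M ->.
Qed.

(** With [A T] the event that all counts are below [T], [Q T] is its probability and [S T] the
    integral of [psil] over it. As [psil] is at most 1, what happens outside [A T] costs at most
    [1 - Q T], which tends to 0. *)
Let S T := \prod_s \sum_(j < T) esc s ^+ j * ppmf (rho s) j.
Let Q T := \prod_s \sum_(j < T) 1 ^+ j * ppmf (rho s) j.

Let A T := \bigcup_(m in [set: {ffun {set 'I_L} -> 'I_T}]) B (fun s => m s).

Let A_triv T : trivIset setT (fun m : {ffun {set 'I_L} -> 'I_T} => B (fun s => m s)).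
Proof.
move=> m m' _ _ [w [h h']]; apply/ffunP => s; apply/val_inj.
by have := h s; rewrite h' => -[] /eqP; rewrite eqr_nat => /eqP.
Qed.

Let measurable_A T : measurable (A T).
Proof. by apply: fin_bigcup_measurable => //; exact: finite_finset. Qed.

Let A_prob T : P (A T) = (Q T)%:E.
Proof.
rewrite measure_finType_bigcup //; last exact: A_triv.
rewrite /Q bigA_distr_bigA -sumEFin; apply: eq_bigr => m _.
apply: etrans (B_prob _) _; congr EFin; apply: eq_bigr => s _.
by rewrite expr1n mul1r.
Qed.

Let integral_A T : (\int[P]_(w in A T) (psil w)%:E = (S T)%:E)%E.
Proof.
have -> : A T = \big[setU/set0]_(m <- index_enum {ffun {set 'I_L} -> 'I_T}) B (fun s => m s).
  rewrite -bigcup_seq; apply/seteqP; split=> w [m _ Bm]; exists m => //.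
  by rewrite /= mem_index_enum.
rewrite ge0_integral_bigsetU //; last 4 first.
- exact: index_enum_uniq.
- by move=> s t _ _ h; exact: A_triv.
- by apply/measurable_EFinP; exact: measurable_funS measurable_psil.
- by move=> w _; rewrite lee_fin.
rewrite /S bigA_distr_bigA -sumEFin; apply: eq_bigr => m _.
transitivity (\int[P]_(w in B (fun s => m s)) (cst (\prod_s esc s ^+ m s)%:E w))%E.
  by apply: eq_integral => w /set_mem Bw; rewrite /= (psil_B Bw).
transitivity ((\prod_s esc s ^+ m s)%:E * (\prod_s ppmf (rho s) (m s))%:E)%E.
  by rewrite integral_cst //; congr (_ * _)%E; exact: B_prob.
by rewrite -EFinM -big_split.
Qed.

Let void_bounds T : S T <= fine (P void) <= S T + (1 - Q T).
Proof.
have pf : P void \is a fin_num by exact: fin_num_measure.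
rewrite -!lee_fin fineK // void_prob; apply/andP; split.
  rewrite -integral_A; apply: ge0_subset_integral => //.
  - exact/measurable_EFinP.
  - by move=> w _; rewrite lee_fin.
rewrite -[setT](setUv (A T)) ge0_integral_setU //; last 4 first.
- exact: measurableC.
- by rewrite setUv; exact/measurable_EFinP.
- by move=> w _; rewrite lee_fin.
- by rewrite disj_set2E setICr.
rewrite integral_A EFinD leeD2l // EFinB -A_prob -probability_setC //.
rewrite -[leRHS]mul1e -integral_cst //; last exact: measurableC.
apply: ge0_le_integral => //.
- exact: measurableC.
- by move=> w _; rewrite lee_fin.
- by apply/measurable_EFinP; exact: measurable_funS measurable_psil.
- by move=> w _; rewrite lee_fin.
Qed.

Let S_cvg : S T @[T --> \oo] --> \prod_s expR (- (rho s * (1 - esc s))).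
Proof. by apply: cvg_bigprod => s; exact: cvg_ppmf_gen. Qed.

Let Q_cvg : Q T @[T --> \oo] --> (1 : R).
Proof.
rewrite [X in _ --> X](_ : _ = \prod_(s : {set 'I_L}) expR (- (rho s * (1 - 1)))).
  by apply: cvg_bigprod => s; exact: cvg_ppmf_gen.
by rewrite big1 // => s _; rewrite subrr mulr0 oppr0 expR0.
Qed.

Let void_prob_prod : P void = (\prod_s expR (- (rho s * (1 - esc s))))%:E.
Proof.
rewrite -[LHS]fineK ?fin_num_measure //; congr EFin.
apply: (@cvg_unique _ _ (fine (P void) @[_ --> \oo])) => //; first exact: cvg_cst.
apply: (@squeeze_cvgr _ _ _ _ S (fun T => S T + (1 - Q T))); last 2 first.
- exact: S_cvg.
- rewrite -[X in _ --> X]addr0; apply: cvgD; first exact: S_cvg.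
  by rewrite -(subrr 1); apply: cvgB; [exact: cvg_cst|exact: Q_cvg].
by apply: nearW => T; exact: void_bounds.
Qed.

Let hit x := [set y | exists l, b1 l x /\ b2 l y].

Let hitE x : hit x = hole (pat x).
Proof.
apply/seteqP; split=> y [l].
  by move=> [h1 h2]; exists l => //=; rewrite inE; exact/mem_set.
by rewrite /= inE => /set_mem h1 h2; exists l.
Qed.

Let integral_cells : (\int[@vol R n]_x (1 - esc (pat x))%:E =
  \sum_s ((1 - esc s) * fine (vol (bcell s)))%:E)%E.
Proof.
have -> : [set: n.-tuple R] = \big[setU/set0]_(s <- index_enum {set 'I_L}) cell s.
  rewrite -bigcup_seq; apply/seteqP; split=> // x _.
  by exists (pat x) => //=; rewrite mem_index_enum.
rewrite ge0_integral_bigsetU //; last 4 first.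
- exact: index_enum_uniq.
- by move=> s t _ _ [x [<- <-]].
- apply/measurable_EFinP; apply: measurable_funS (measurable_pat_fun (fun s => 1 - esc s)) => //.
- by move=> x _; rewrite lee_fin subr_ge0.
apply: eq_bigr => s _.
transitivity (\int[@vol R n]_(x in cell s) (cst (1 - esc s)%:E x))%E.
  by apply: eq_integral => x /set_mem <-.
(* The cell of the empty pattern may have infinite volume, but the integrand is 0 there, so
   replacing it by the empty set keeps the sum. *)
rewrite integral_cst // /bcell; case: ifPn => [/eqP ->|s0].
  by rewrite esc_set0 subrr mul0r mul0e.
rewrite EFinM fineK // ge0_fin_numE ?vol_ge0 //.
have [M hM] := bounded_cell s0.
apply: le_lt_trans (vol_cball_lty n M); apply: measure_mono => //; exact: measurable_cball.
Qed.

Lemma void_rect :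
  measurable [set w | forall i, dau i w `&` hit (par w i) = set0] /\
  P [set w | forall i, dau i w `&` hit (par w i) = set0] =
  (expR (- (lp * fine (\int[@vol R n]_x
     (1 - expR (- (ld * fine (vol (hit x `&` W)))))%:E)%E)))%:E.
Proof.
have -> : [set w | forall i, dau i w `&` hit (par w i) = set0] = void.
  by apply/seteqP; split=> w h i; have := h i; rewrite hitE.
split=> //; rewrite void_prob_prod; congr EFin; rewrite -expR_sum.
congr expR; rewrite sumrN; congr (- _).
have -> : (\int[@vol R n]_x (1 - expR (- (ld * fine (vol (hit x `&` W)))))%:E =
    \int[@vol R n]_x (1 - esc (pat x))%:E)%E.
  by apply: eq_integral => x _; rewrite hitE.
rewrite integral_cells sumEFin /= mulr_sumr; apply: eq_bigr => s _.
by rewrite /rho setIT; ring.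
Qed.

End VoidRect.

Lemma cvg_expR (R : realType) (u : nat -> R) (l : R) :
  u k @[k --> \oo] --> l -> expR (u k) @[k --> \oo] --> expR l.
Proof. by move=> h; apply: (cvg_comp u expR h); exact: continuous_expR. Qed.

(** * The exponent of the void probability and its continuity *)

Section Capacity.
Variables (R : realType) (n : nat) (ld rd : R).
Hypothesis ld0 : 0 < ld.
Let W := cball (vzero R n) rd.
Implicit Types (S : set (n.-tuple R * n.-tuple R)) (U : set (n.-tuple R)).

(* A pair [(x, y)] in [S] is a parent [x] with a daughter displaced by [y]; such
   pairs are absent from the cluster process with probability
   [exp (- lp * relcap S)]. *)
Definition secvol S (x : n.-tuple R) : R := fine (vol ([set y | S (x, y)] `&` W)).
Definition relcap S : R :=
  fine (\int[@vol R n]_x (1 - expR (- (ld * secvol S x)))%:E)%E.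

Lemma vol_sub_lty (A : set (n.-tuple R)) M : measurable A -> A `<=` cball (vzero R n) M ->
  (vol A < +oo)%E.
Proof.
move=> mA h; apply: le_lt_trans (vol_cball_lty n M); apply: measure_mono => //.
exact: measurable_cball.
Qed.

Lemma vol_fin_sub (A : set (n.-tuple R)) M : measurable A -> A `<=` cball (vzero R n) M ->
  vol A \is a fin_num.
Proof. by move=> mA h; rewrite ge0_fin_numE ?vol_ge0 // (vol_sub_lty mA h). Qed.

Lemma measurable_sec S x : measurable S -> measurable ([set y | S (x, y)] `&` W).
Proof.
move=> mS; apply: measurableI; last exact: measurable_cball.
by have := measurable_xsection x mS; rewrite xsectionE.
Qed.

Lemma secvol_ge0 S x : 0 <= secvol S x.
Proof. by rewrite fine_ge0 // vol_ge0. Qed.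

Lemma secvolE S x : measurable S -> (secvol S x)%:E = vol ([set y | S (x, y)] `&` W).
Proof.
by move=> mS; rewrite fineK // (@vol_fin_sub _ rd) //; exact: measurable_sec.
Qed.

Lemma measurable_secvol S : measurable S -> measurable_fun setT (secvol S).
Proof.
move=> mS; apply/measurable_EFinP.
have -> : EFin \o secvol S = fun x => vol [set y | (S `&` setT `*` W) (x, y)].
  apply/funext => x /=; rewrite secvolE //; congr vol.
  by apply/seteqP; split=> y /=; tauto.
apply: (measurable_section (@vol R n)); apply: measurableI => //.
by apply: measurableX => //; exact: measurable_cball.
Qed.

Lemma relint_ge0 S x : 0 <= 1 - expR (- (ld * secvol S x)).
Proof. by rewrite subr_ge0 expR_le1 oppr_le0 mulr_ge0 ?secvol_ge0 // ltW. Qed.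

Lemma relint_le1 S x : 1 - expR (- (ld * secvol S x)) <= 1.
Proof. by rewrite lerBlDr lerDl expR_ge0. Qed.

Lemma measurable_relint S : measurable S ->
  measurable_fun setT (fun x => 1 - expR (- (ld * secvol S x))).
Proof.
move=> mS; apply: measurable_funB => //.
apply: (measurableT_comp (@measurable_expR R)).
apply: measurableT_comp => //; apply: measurable_funM => //; exact: measurable_secvol.
Qed.

Definition near_diag M : set (n.-tuple R * n.-tuple R) :=
  [set p | enorm (vadd p.1 p.2) <= M].

(** A daughter is within [rd] of its parent, so daughters in the ball of radius [M] come from
    parents within [M + rd]. The indicator is the dominating function for all limits of [relcap]. *)
Lemma relint_le_indic S M x : S `<=` near_diag M ->
  1 - expR (- (ld * secvol S x)) <= \1_(cball (vzero R n) (M + rd)) x.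
Proof.
move=> SM; rewrite indicE; case: (boolP (x \in _)) => [_|/negP xM]; first exact: relint_le1.
rewrite /secvol (_ : _ `&` _ = set0) ?vol_set0 ?mulr0 ?oppr0 ?expR0 ?subrr //.
apply/seteqP; split=> // y [/= /SM]; rewrite /near_diag /W /cball /= => xyM.
rewrite vsubx0 => yr; apply: xM; apply/mem_set; rewrite /cball /= vsubx0.
have -> : x = vsub (vadd x y) (vsub y (vzero R n)) by apply: vext => i; rewrite !vE; ring.
have -> : vsub (vadd x y) (vsub y (vzero R n)) = vadd (vadd x y) (vscale (-1) y).
  by apply: vext => i; rewrite !vE; ring.
by rewrite (le_trans (enormD _ _)) // lerD // enormZ normrN1 mul1r.
Qed.

Lemma integral_relint S M : measurable S -> S `<=` near_diag M ->
  (relcap S)%:E = (\int[@vol R n]_x (1 - expR (- (ld * secvol S x)))%:E)%E.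
Proof.
move=> mS SM; rewrite fineK // ge0_fin_numE; last first.
  by apply: integral_ge0 => x _; rewrite lee_fin relint_ge0.
apply: le_lt_trans (vol_cball_lty n (M + rd)).
rewrite -[X in (_ <= vol X)%E]setIT -integral_indic //; last exact: measurable_cball.
apply: ge0_le_integral => //.
- by move=> x _; rewrite lee_fin relint_ge0.
- by apply/measurable_EFinP; exact: measurable_relint.
- by apply/measurable_EFinP; apply: measurable_indic; exact: measurable_cball.
- by move=> x _; rewrite lee_fin relint_le_indic.
Qed.

Lemma integrable_ball M : (@vol R n).-integrable setT (fun x => (\1_(cball (vzero R n) M) x)%:E).
Proof.
have mB := @measurable_cball R n (vzero R n) M.
apply/integrableP; split; first by apply/measurable_EFinP; exact: measurable_indic.
rewrite (eq_integral (fun x => (\1_(cball (vzero R n) M) x)%:E)).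
  by rewrite integral_indic // setIT vol_cball_lty.
by move=> x _; rewrite gee0_abs // lee_fin.
Qed.

Lemma relcap_cvg (Sk : nat -> set (n.-tuple R * n.-tuple R)) S M :
  (forall k, measurable (Sk k)) -> measurable S ->
  (forall k, Sk k `<=` near_diag M) -> S `<=` near_diag M ->
  (forall x, vol ([set y | Sk k (x, y)] `&` W) @[k --> \oo] -->
             vol ([set y | S (x, y)] `&` W)) ->
  relcap (Sk k) @[k --> \oo] --> relcap S.
Proof.
move=> mSk mS SkM SM h.
have hx x : secvol (Sk k) x @[k --> \oo] --> secvol S x.
  have := h x; rewrite -secvolE // => /fine_cvgP[_]; exact.
suff : (relcap (Sk k))%:E @[k --> \oo] --> (relcap S)%:E by case/fine_cvgP.
rewrite [X in _ --> X](integral_relint mS SM).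
have [] // := @dominated_convergence _ _ _ (@vol R n) setT measurableT
  (fun k x => (1 - expR (- (ld * secvol (Sk k) x)))%:E)
  (fun x => (1 - expR (- (ld * secvol S x)))%:E)
  (fun x => (\1_(cball (vzero R n) (M + rd)) x)%:E).
- by move=> k; apply/measurable_EFinP; exact: measurable_relint.
- by apply/measurable_EFinP; exact: measurable_relint.
- apply: aeW => x _; apply/cvg_EFin; first exact: nearW.
  apply: cvgB; first exact: cvg_cst.
  apply: cvg_expR.
  apply: (@cvgN _ R^o); apply: cvgM; [exact: cvg_cst|exact: hx].
- exact: integrable_ball.
- apply: aeW => x k _; rewrite lee_fin ger0_norm ?relint_ge0 //.
  exact: relint_le_indic.
- move=> _ _; apply: cvg_trans; apply: near_eq_cvg; apply: nearW => k /=.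
  by rewrite (integral_relint (mSk k) (SkM k)).
Qed.

Definition addpre U : set (n.-tuple R * n.-tuple R) := [set p | U (vadd p.1 p.2)].
(** The void probability of [U] will be [exp (- lp * capa U)]: this is the capacity functional of
    the process on a logarithmic scale. *)
Definition capa U := relcap (addpre U).

Lemma measurable_addpre U : measurable U -> measurable (addpre U).
Proof. by move=> mU; apply: measurable_comp_set => //; exact: measurable_vadd. Qed.

Lemma addpre_near U M : U `<=` cball (vzero R n) M -> addpre U `<=` near_diag M.
Proof. by move=> h p /h; rewrite /cball /= vsubx0. Qed.

Lemma capa_nonincreasing_cvg (Uk : nat -> set (n.-tuple R)) M :
  (forall k, measurable (Uk k)) -> (forall k, Uk k `<=` cball (vzero R n) M) ->
  (forall k l, (k <= l)%N -> Uk l `<=` Uk k) ->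
  capa (Uk k) @[k --> \oo] --> capa (\bigcap_k Uk k).
Proof.
move=> mU UM ndU.
have mI : measurable (\bigcap_k Uk k) by exact: bigcapT_measurable.
apply: (@relcap_cvg _ _ M) => //.
- by move=> k; exact: measurable_addpre.
- exact: measurable_addpre.
- by move=> k; exact: addpre_near.
- by apply: addpre_near => x /(_ 0%N Logic.I) /UM.
move=> x.
have -> : [set y | addpre (\bigcap_k Uk k) (x, y)] `&` W =
    \bigcap_k ([set y | addpre (Uk k) (x, y)] `&` W).
  apply/seteqP; split=> y; first by move=> [h1 h2] k _; split=> //; exact: h1.
  by move=> h; split=> [k _|]; [have [] := h k Logic.I|have [] := h 0%N Logic.I].
apply: nonincreasing_cvg_mu.
- apply: (@vol_sub_lty _ rd) => //.
  by apply: measurable_sec; exact: measurable_addpre.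
- by move=> k; apply: measurable_sec; exact: measurable_addpre.
- by apply: bigcapT_measurable => k; apply: measurable_sec; exact: measurable_addpre.
- by move=> k l kl; apply/subsetPset => y [h1 h2]; split=> //; exact: ndU h1.
Qed.

End Capacity.

(** * Void probability of bounded open sets *)

Section VoidOpen.
Context (R : realType) d (Omega : measurableType d) (P : probability Omega R) (n : nat).
Variables (par : Omega -> nat -> n.-tuple R) (dau : nat -> Omega -> set (n.-tuple R)).
Variables (lp ld rd : R).
Hypothesis mcp : is_matern_cluster P par dau lp ld rd.
Hypotheses (lp0 : 0 < lp) (ld0 : 0 < ld).
Let W := cball (vzero R n) rd.
Let Phi w := matern (par w) (fun i => dau i w).

(** Openness is tested coordinatewise, the form that suits both rational cubes and boxes. *)
Definition vopen (U : set (n.-tuple R)) := forall z, U z -> exists2 e : R, 0 < e &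
  forall z', (forall i, `|tnth z' i - tnth z i| < e) -> U z'.

Let cube (q : n.-tuple rat) (m : nat) : set (n.-tuple R) :=
  box (fun i => `](ratr (tnth q i) - m.+1%:R^-1), (ratr (tnth q i) + m.+1%:R^-1)[%classic).

Lemma ratcube_cube (x : n.-tuple R) (m : nat) : exists q, cube q m x.
Proof.
have /choice[q hq] : forall i, exists q : rat,
    tnth x i - m.+1%:R^-1 < ratr q < tnth x i + m.+1%:R^-1.
  move=> i; have [|q] := @rat_in_itvoo R (tnth x i - m.+1%:R^-1) (tnth x i + m.+1%:R^-1).
    by rewrite ltrBlDr -addrA ltrDl addr_gt0.
  by rewrite in_itv /= => h; exists q.
exists [tuple q i | i < n] => i /=; rewrite tnth_mktuple in_itv /=.
by have /andP[h1 h2] := hq i; rewrite ltrBlDr h2 -ltrBlDr h1.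
Qed.

Let measurable_cube q m : measurable (cube q m).
Proof. by apply: measurable_box. Qed.

Let bounded_cube q m : Defs.bounded_set (cube q m).
Proof.
exists (n%:R * (\sum_i `|ratr (tnth q i)| + m.+1%:R^-1)) => x xc; rewrite /cball /= vsubx0.
apply: enorm_le_sum; first by rewrite addr_ge0 // sumr_ge0.
move=> i; have := xc i; rewrite /= in_itv /= => /andP[h1 h2].
rewrite (@le_trans _ _ (`|ratr (tnth q i)| + m.+1%:R^-1)) //; last first.
  by rewrite lerD2r (bigD1 i) //= lerDl sumr_ge0.
rewrite -[tnth x i](subrK (ratr (tnth q i))) addrC (le_trans (ler_normD _ _)) // lerD2l.
by rewrite ler_norml; apply/andP; split; [rewrite lerBrDl ltW|rewrite lerBlDl ltW].
Qed.

Variable U : set (n.-tuple R).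
Hypotheses (oU : vopen U) (mU : measurable U) (M : R) (UM : U `<=` cball (vzero R n) M).

(* The open set of pairs with [x + y] in [U] is the union of the countably many
   products of rational cubes that it contains. *)
Let good (q1 q2 : n.-tuple rat) m :=
  forall x y, cube q1 m x -> cube q2 m y -> U (vadd x y).
Let b1 (l : nat) : set (n.-tuple R) :=
  if choice.unpickle l is Some (q1, q2, m) then
    if `[< good q1 q2 m >] then cube q1 m else set0 else set0.
Let b2 (l : nat) : set (n.-tuple R) :=
  if choice.unpickle l is Some (q1, q2, m) then
    if `[< good q1 q2 m >] then cube q2 m else set0 else set0.

Let bounded_set0 : Defs.bounded_set (set0 : set (n.-tuple R)).
Proof. by exists 0. Qed.

Let b1P l : measurable (b1 l) /\ Defs.bounded_set (b1 l).
Proof. by rewrite /b1; case: (choice.unpickle l) => [[[q1 q2] m]|] //; case: ifP. Qed.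
Let b2P l : measurable (b2 l) /\ Defs.bounded_set (b2 l).
Proof. by rewrite /b2; case: (choice.unpickle l) => [[[q1 q2] m]|] //; case: ifP. Qed.

Let b12U x y : U (vadd x y) <-> exists l, b1 l x /\ b2 l y.
Proof.
split=> [Uxy|[l]]; last first.
  rewrite /b1 /b2; case: (choice.unpickle l) => [[[q1 q2] m]|] [] //.
  by case: ifPn => [/asboolP h|//]; exact: h.
have K (p q x1 y1 x2 y2 c e : R) : c < e / 4 -> q - c < y2 -> y2 < q + c ->
    p - c < x2 -> x2 < p + c -> q - c < y1 -> y1 < q + c -> p - c < x1 -> x1 < p + c ->
    `|x2 + y2 - (x1 + y1)| < e.
  by move=> *; rewrite ltr_norml; apply/andP; split; lra.
have [e e0 he] := oU Uxy.
(* Two points of a cube of half-side h differ by less than 2h in each coordinate, and two sums of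
   such points by less than 4h; hence the choice of h below [e / 4]. *)
pose m := Num.Def.truncn (4 / e).
have me : m.+1%:R^-1 < e / 4.
  rewrite -[ltRHS]invrK ltf_pV2 ?posrE ?invr_gt0 ?divr_gt0 // invf_div.
  exact: truncnS_gt.
have [q1 h1] := ratcube_cube x m.
have [q2 h2] := ratcube_cube y m.
exists (choice.pickle (q1, q2, m)); rewrite /b1 /b2 choice.pickleK asboolT // => x' y' h1' h2'.
apply: he => i; rewrite !vE.
have := h1 i; have := h2 i; have := h1' i; have := h2' i.
rewrite /= !in_itv /= => /andP[? ?] /andP[? ?] /andP[? ?] /andP[? ?].
apply: (K (ratr (tnth q1 i)) (ratr (tnth q2 i)) _ _ _ _ m.+1%:R^-1) => //.
Qed.

Let SL (L : nat) : set (n.-tuple R * n.-tuple R) :=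
  [set p | exists l : 'I_L, b1 l p.1 /\ b2 l p.2].

Let measurable_SL L : measurable (SL L).
Proof.
have -> : SL L = \bigcup_(l in [set: 'I_L]) (b1 l `*` b2 l).
  by apply/seteqP; split=> p /=; [move=> [l h]; exists l|move=> [l _ h]; exists l].
apply: fin_bigcup_measurable; first exact: finite_finset.
by move=> l _; apply: measurableX; [exact: (b1P l).1|exact: (b2P l).1].
Qed.

Let SL_sub L : SL L `<=` addpre U.
Proof. by move=> [x y] [l h]; apply/b12U; exists l. Qed.

Let vL L := [set w | forall i, dau i w `&` [set y | SL L (par w i, y)] = set0].

Lemma matern_voidE w : Phi w `&` U = set0 <->
  forall i, dau i w `&` [set y | U (vadd (par w i) y)] = set0.
Proof.
split=> [h i|h]; apply/seteqP; split=> // y.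
  move=> [dy Uy]; have : (Phi w `&` U) (vadd (par w i) y) by split=> //; exists i => //; exists y.
  by rewrite h.
by move=> [[i _ [z dz <-]] Uz]; have := h i; rewrite seteqP => -[/(_ z) []].
Qed.

(** As the finite unions of rectangles increase to all pairs with sum in [U], their void events
    decrease to that of [U], while their exponents converge to [capa]; both sides are limits of one
    sequence. *)
Lemma void_open :
  measurable [set w | Phi w `&` U = set0] /\
  P [set w | Phi w `&` U = set0] = (expR (- (lp * capa ld rd U)))%:E.
Proof.
have hL L := @void_rect R d Omega P n par dau lp ld rd mcp ld0 L b1 b2
  (fun l => (b1P l).1) (fun l => (b2P l).1) (fun l => (b1P l).2) (fun l => (b2P l).2).
have vE : [set w | Phi w `&` U = set0] = \bigcap_L vL L.
  apply/seteqP; split=> w.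
    move=> /matern_voidE h L _ i; apply/seteqP; split=> // y [dy /SL_sub Uy].
    by rewrite -(h i).
  move=> h; apply/matern_voidE => i; apply/seteqP; split=> // y [dy /b12U[l hl]].
  by rewrite -(h l.+1 Logic.I i); split=> //; exists ord_max.
have mv : measurable [set w | Phi w `&` U = set0].
  by rewrite vE; apply: bigcapT_measurable => L; have [] := hL L.
split=> //.
have c1 : (P \o vL) L @[L --> \oo] --> P [set w | Phi w `&` U = set0].
  rewrite vE; apply: nonincreasing_cvg_mu.
  - by rewrite (le_lt_trans (probability_le1 _ _)) ?ltry //; have [] := hL 0%N.
  - by move=> L; have [] := hL L.
  - by rewrite -vE.
  - move=> L L' LL'; apply/subsetPset => w h i; apply/seteqP; split=> // y [dy [l hl]].
    by rewrite -(h i); split=> //; exists (widen_ord LL' l).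
have c2 : (expR (- (lp * relcap ld rd (SL L))))%:E @[L --> \oo] -->
    (expR (- (lp * capa ld rd U)))%:E.
  apply/cvg_EFin; first exact: nearW.
  apply: cvg_expR.
  apply: (@cvgN _ R^o); apply: cvgM; first exact: cvg_cst.
  apply: (@relcap_cvg _ _ _ _ _ _ _ M) => //.
  - exact: measurable_addpre.
  - by move=> L p /SL_sub; apply: addpre_near.
  - exact: addpre_near.
  move=> x; rewrite (_ : _ `&` _ = \bigcup_L ([set y | SL L (x, y)] `&` W)); last first.
    apply/seteqP; split=> y.
      by move=> [/b12U[l hl] Wy]; exists l.+1 => //; split=> //; exists ord_max.
    by move=> [L _ [/SL_sub h Wy]].
  apply: nondecreasing_cvg_mu.
  - by move=> L; exact: measurable_sec.
  - by apply: bigcupT_measurable => L; exact: measurable_sec.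
  - move=> L L' LL'; apply/subsetPset => y [[l hl] Wy]; split=> //.
    by exists (widen_ord LL' l).
move: c1; rewrite (_ : P \o vL = fun L => (expR (- (lp * relcap ld rd (SL L))))%:E).
  by move=> c1; exact: (cvg_unique _ c1 c2).
by apply/funext => L; have [_] := hL L.
Qed.

End VoidOpen.

(** * Almost sure local finiteness of the cluster process *)

Section LocallyFinite.
Context (R : realType) d (Omega : measurableType d) (P : probability Omega R) (n : nat).

(** A count is infinite or a natural number, and the Poisson probabilities of the natural numbers
    already sum to 1. *)
Lemma poisson_cnt_finite (S : Omega -> set (n.-tuple R)) lam W B :
  poisson_pp_on P S lam W -> measurable B -> Defs.bounded_set B ->
  measurable [set w | finite_set (S w `&` B)] /\
  P [set w | finite_set (S w `&` B)] = 1%E.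
Proof.
move=> hS mB bB.
pose E k := [set w | cnt (S w) B = (k%:R)%:E].
have mE k : measurable (E k) by exact: (measurable_cnt_eq hS).
have fE : [set w | finite_set (S w `&` B)] = \bigcup_k E k.
  apply/seteqP; split=> w /=; last by move=> [k _ /cnt_natP].
  by move=> h; exists #|` fset_set (S w `&` B)| => //; rewrite /E /= cnt_fin.
have mF : measurable [set w | finite_set (S w `&` B)].
  by rewrite fE; exact: bigcupT_measurable.
split=> //; apply/eqP; rewrite eq_le probability_le1 //=.
have h T : ((\sum_(j < T) 1 ^+ j * ppmf (lam * fine (vol (B `&` W))) j)%:E
    <= P [set w | finite_set (S w `&` B)])%E.
  rewrite (_ : _%:E = P (\bigcup_(j in [set: 'I_T]) E j)).
    apply: measure_mono => //.
      by apply: fin_bigcup_measurable => //; exact: finite_finset.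
    by rewrite fE => w [j _ Ej]; exists j.
  rewrite measure_finType_bigcup //.
    rewrite -sumEFin; apply: eq_bigr => j _; rewrite expr1n mul1r.
    by apply/esym; exact: (poisson_cnt_eq hS).
  move=> i j _ _ [w []]; rewrite /E /= => -> -[] /eqP; rewrite eqr_nat => /eqP e.
  exact/val_inj.
have c := @cvg_ppmf_gen R 1 (lam * fine (vol (B `&` W))).
have pf : P [set w | finite_set (S w `&` B)] \is a fin_num by exact: fin_num_measure.
rewrite -(fineK pf) lee_fin.
have {c} : (\sum_(j < T) 1 ^+ j * ppmf (lam * fine (vol (B `&` W))) j) @[T --> \oo] --> (1 : R).
  by move: c; rewrite subrr mulr0 oppr0 expR0.
move=> c; apply: (cvgr_to_le c); apply: nearW => T.
by rewrite -lee_fin fineK.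
Qed.

Variables (par : Omega -> nat -> n.-tuple R) (dau : nat -> Omega -> set (n.-tuple R)).
Variables (lp ld rd : R).
Hypothesis mcp : is_matern_cluster P par dau lp ld rd.
Let Phi w := matern (par w) (fun i => dau i w).

Definition locfin : set Omega :=
  (\bigcap_(N in [set: nat]) [set w | finite_set (range (par w) `&` cball (vzero R n) N%:R)])
  `&` (\bigcap_(j in [set: nat]) [set w | finite_set (dau j w `&` cball (vzero R n) rd)]).

Let bounded_cball (M : R) : Defs.bounded_set (cball (vzero R n) M).
Proof. by exists M. Qed.

Let mlp N := poisson_cnt_finite (let: And5 _ _ h _ _ := mcp in h)
  (@measurable_cball R n (vzero R n) N) (bounded_cball N).
Let mld j := poisson_cnt_finite (let: And5 _ _ _ h _ := mcp in h j)
  (@measurable_cball R n (vzero R n) rd) (bounded_cball rd).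

Lemma measurable_locfin : measurable locfin.
Proof.
apply: measurableI; apply: bigcapT_measurable => i; first exact: (mlp _).1.
exact: (mld i).1.
Qed.

Lemma locfin_setC : P (~` locfin) = 0%E.
Proof.
have hC (E : set Omega) : measurable E -> P E = 1%E -> P.-negligible (~` E).
  move=> mE PE; exists (~` E); split=> //; first exact: measurableC.
  by rewrite probability_setC // PE subee.
apply/negligibleP; first by apply: measurableC; exact: measurable_locfin.
rewrite setCI !setC_bigcap; apply: negligibleU; apply: negligible_bigcup => k.
  by apply: hC; [exact: (mlp _).1|exact: (mlp _).2].
by apply: hC; [exact: (mld k).1|exact: (mld k).2].
Qed.

Lemma locfin_prob (E : set Omega) : measurable E -> P (E `&` locfin) = P E.
Proof.
move=> mE; have mO := measurable_locfin.
rewrite [RHS](measureDI P mE mO) [X in _ = (X + _)%E](_ : _ = 0%E) ?add0e //.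
apply/eqP; rewrite eq_le measure_ge0 andbT -locfin_setC.
apply: measure_mono; [exact: measurableD|exact: measurableC|].
by move=> w [].
Qed.

Lemma dau_sub j w : dau j w `<=` cball (vzero R n) rd.
Proof. by case: mcp => _ _ _ h _; case: (h j). Qed.

(** Only parents within [M + rd] have daughters within [M]; by injectivity of [par w] they carry
    finitely many labels, and each has finitely many daughters. *)
Lemma locfin_finite w M : locfin w -> finite_set (Phi w `&` cball (vzero R n) M).
Proof.
move=> [h1 h2]; pose N := (Num.Def.truncn `|M + rd|).+1.
pose I := [set i | cball (vzero R n) N%:R (par w i)].
have fI : finite_set I.
  have -> : I = par w @^-1` (range (par w) `&` cball (vzero R n) N%:R).
    by apply/seteqP; split=> i; [move=> Ii; split=> //; exists i|case].
  apply: finite_preimage; last exact: h1.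
  by move=> i j _ _; case: mcp => h _ _ _ _; exact: h.
apply: (@sub_finite_set _ _ (\bigcup_(i in I) [set vadd (par w i) y | y in dau i w])).
  move=> _ [[i _ [y dy <-]] xM]; exists i; last by exists y.
  suff : enorm (par w i) <= N%:R by rewrite /I /cball /= vsubx0.
  rewrite /cball /= vsubx0 in xM.
  have -> : par w i = vadd (vadd (par w i) y) (vscale (-1) y).
    by apply: vext => k; rewrite !vE; ring.
  rewrite (le_trans (enormD _ _)) // enormZ normrN1 mul1r.
  apply: (@le_trans _ _ (M + rd)).
    by rewrite lerD //; have := @dau_sub i w y dy; rewrite /cball /= vsubx0.
  by rewrite (le_trans (ler_norm _)) // ltW // truncnS_gt.
apply: bigcup_finite => // i _; apply: finite_image.
by apply: sub_finite_set (h2 i Logic.I) => y dy; split=> //; exact: dau_sub dy.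
Qed.

End LocallyFinite.

Section VoidGdelta.
Context (R : realType) d (Omega : measurableType d) (P : probability Omega R) (n : nat).
Variables (par : Omega -> nat -> n.-tuple R) (dau : nat -> Omega -> set (n.-tuple R)).
Variables (lp ld rd : R).
Hypothesis mcp : is_matern_cluster P par dau lp ld rd.
Hypothesis ld0 : 0 < ld.
Let Phi w := matern (par w) (fun i => dau i w).
Let O0 := locfin par dau rd.

(* On the locally finite event, [Phi] avoids [K] only if it already avoids some
   [Uk k]; closed or half-open holes are reached in this way. *)
Lemma void_Gdelta (Uk : nat -> set (n.-tuple R)) M :
  (forall k, vopen (Uk k)) -> (forall k, measurable (Uk k)) ->
  (forall k, Uk k `<=` cball (vzero R n) M) ->
  (forall k l, (k <= l)%N -> Uk l `<=` Uk k) ->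
  let K := \bigcap_k Uk k in
  measurable ([set w | Phi w `&` K = set0] `&` O0) /\
  P ([set w | Phi w `&` K = set0] `&` O0) = (expR (- (lp * capa ld rd K)))%:E.
Proof.
move=> oU mU UM ndU K.
have hV k := void_open mcp ld0 (oU k) (mU k) (UM k).
pose V k := [set w | Phi w `&` Uk k = set0].
have mO : measurable O0 by exact: (measurable_locfin mcp).
have mV k : measurable (V k `&` O0) by apply: measurableI => //; have [] := hV k.
have E : [set w | Phi w `&` K = set0] `&` O0 = \bigcup_k (V k `&` O0).
  apply/seteqP; split=> w; last first.
    move=> [k _ [Vk Ow]]; split=> //; apply/seteqP; split=> // x [px Kx].
    by rewrite -Vk; split=> //; exact: Kx.
  move=> [/= Kw Ow]; suff [k Vk] : exists k, V k w by exists k.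
  have fin : finite_set (Phi w `&` cball (vzero R n) M) by exact: (locfin_finite mcp).
  have : forall x, exists k, (Phi w `&` cball (vzero R n) M) x -> ~ Uk k x.
    move=> x; have [px|npx] := pselect ((Phi w `&` cball (vzero R n) M) x); last by exists 0%N.
    apply: contrapT => /forallNP h; have : (Phi w `&` K) x; last by rewrite Kw.
    split; first by case: px.
    by move=> k _; apply: contrapT => nU; apply: (h k).
  (* Each of the finitely many points of [Phi] in the ball is outside some [Uk k], and outside all
     later ones since the sequence decreases; the largest such index serves them all. *)
  move=> /choice[k hk]; exists (\max_(x <- finmap.enum_fset (fset_set (Phi w `&` cball (vzero R n) M))) k x)%N.
  apply/seteqP; split=> // x [px Ux].
  have xS : (Phi w `&` cball (vzero R n) M) x by split=> //; exact: UM Ux.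
  apply: (hk x xS); apply: ndU Ux; apply: leq_bigmax_seq => //.
  by rewrite in_fset_set //; exact/mem_set.
split; first by rewrite E; exact: bigcupT_measurable.
have c1 : (P \o (fun k => V k `&` O0)) k @[k --> \oo] --> P ([set w | Phi w `&` K = set0] `&` O0).
  rewrite E; apply: nondecreasing_cvg_mu => //; first exact: bigcupT_measurable.
  move=> k l kl; apply/subsetPset => w [Vk Ow]; split=> //.
  by apply/seteqP; split=> // x [px Ux]; rewrite -Vk; split=> //; exact: ndU Ux.
have c2 : (expR (- (lp * capa ld rd (Uk k))))%:E @[k --> \oo] --> (expR (- (lp * capa ld rd K)))%:E.
  apply/cvg_EFin; first exact: nearW.
  apply: cvg_expR; apply: (@cvgN _ R^o); apply: cvgM; first exact: cvg_cst.
  exact: (@capa_nonincreasing_cvg R n ld rd ld0 Uk M mU UM ndU).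
move: c1; rewrite (_ : P \o _ = fun k => (expR (- (lp * capa ld rd (Uk k))))%:E).
  by move=> c1; exact: (cvg_unique _ c1 c2).
apply/funext => k /=; rewrite (locfin_prob mcp); first exact: (hV k).2.
exact: (hV k).1.
Qed.

End VoidGdelta.

(** * Increments of the capacity functional *)

Section RadiusEstimates.
Variable R : realType.
Implicit Types a b r e : R.
Lemma lt_add_double r e : 0 < e -> 0 <= r -> e < r + 2 * e. Proof. by lra. Qed.
Lemma add_lt_double a b r e : 0 < e -> a <= r -> b <= e -> a + b < r + 2 * e.
Proof. by lra. Qed.
Lemma add_le_triple a b r e : a < r + 2 * e -> b <= e -> a + b <= r + 3 * e.
Proof. by lra. Qed.
Lemma add_lt_triple a b r e : a < r + 2 * e -> b <= e -> a + b < r + 3 * e.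
Proof. by lra. Qed.
Lemma add_le_add2 a b r e : a < r + 3 * e -> 3 * e <= 1 -> b <= 1 -> a + b <= r + 2.
Proof. by lra. Qed.
Lemma le1_add2 r : 0 <= r -> 1 <= r + 2.
Proof. by lra. Qed.
(** The inequality [1 - a <= exp (- a)] multiplied by [exp a]. *)
Lemma expR_sub1_le a : expR a - 1 <= a * expR a.
Proof.
have h := expR_ge1Dx (- a); rewrite -subr_ge0.
have -> : a * expR a - (expR a - 1) = expR a * (expR (- a) - (1 - a)).
  by rewrite mulrBr expRxMexpNx_1; ring.
by rewrite mulr_ge0 ?expR_ge0 // subr_ge0.
Qed.
End RadiusEstimates.

Section CapacityEstimates.
Variables (R : realType) (n : nat) (ld rd : R).
Hypotheses (ld0 : 0 < ld).
Let W := cball (vzero R n) rd.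
Let mW : measurable W. Proof. exact: measurable_cball. Qed.
Implicit Types (U q : set (n.-tuple R)).

Definition oball (c : n.-tuple R) (r : R) : set (n.-tuple R) := [set x | enorm (vsub x c) < r].

Lemma measurable_oball c r : measurable (oball c r).
Proof.
apply: (@measurable_comp_set _ _ _ _ (fun x => enorm (vsub x c)) [set z | z < r]).
  apply: (measurableT_comp (@measurable_enorm R n)); exact: measurable_vsub.
rewrite (_ : [set z | z < r] = `]-oo, r[%classic); first exact: measurable_itv.
by apply/seteqP; split=> z /=; rewrite in_itv.
Qed.

Definition lens (r : R) (x : n.-tuple R) : R := fine (vol (cball x r `&` W)).

(** The capacity sees displacements [y] with [x + y] near the origin, the lens those with [y] near
    [x]. The reflection of [y] exchanges them, preserving volume and the daughter ball. *)
Lemma lensE r x : secvol rd (addpre (cball (vzero R n) r)) x = lens r x.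
Proof.
rewrite /secvol /lens; congr fine.
have mB : measurable (cball x r `&` W) by apply: measurableI => //; exact: measurable_cball.
have K : involutive (@vscale R n (-1)) by move=> y; apply: vext => i; rewrite !vE; ring.
rewrite -(vol_isometry (measurable_vscale (-1)) (measurable_vscale (-1)) K K _ _ mB); last 2 first.
- by move=> y z; apply: vext => i; rewrite !vE; ring.
- by move=> y; rewrite enormZ normrN1 mul1r.
have yx y : enorm (vsub (vscale (-1) y) x) = enorm (vadd x y).
  have -> : vsub (vscale (-1) y) x = vscale (-1) (vadd x y) by apply: vext => i; rewrite !vE; ring.
  by rewrite enormZ normrN1 mul1r.
by congr vol; apply/seteqP; split=> y; rewrite /addpre /W /cball /= !vsubx0 enormZ normrN1 mul1r yx.
Qed.

Lemma lens_ge0 r x : 0 <= lens r x.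
Proof. by rewrite -lensE secvol_ge0. Qed.

Lemma measurable_lens r : measurable_fun setT (lens r).
Proof.
rewrite (_ : lens r = secvol rd (addpre (cball (vzero R n) r))); last first.
  by apply/funext => x; rewrite lensE.
by apply: measurable_secvol; apply: measurable_addpre; exact: measurable_cball.
Qed.

Lemma measurable_exp_lens r : measurable_fun setT (fun x => expR (- (ld * lens r x))).
Proof.
apply: (measurableT_comp (@measurable_expR R)).
apply: measurableT_comp => //; apply: measurable_funM => //; exact: measurable_lens.
Qed.

(** The two ingredients of the Palm formula. [capG r] is the exponent of the void probability of a
    ball of radius [r]. [palmJ r] comes from the cluster of the typical point, whose displacement is
    uniform in the daughter ball: the integrand is the probability that its siblings keep farther
    than [r]. *)
Definition capG (r : R) : R := capa ld rd (cball (vzero R n) r).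
Definition palmJ (r : R) : R := fine (\int[@vol R n]_(x in W) (expR (- (ld * lens r x)))%:E)%E.

Lemma exp_lens_le1 r x : expR (- (ld * lens r x)) <= 1.
Proof. by rewrite expR_le1 oppr_le0 mulr_ge0 ?lens_ge0 // ltW. Qed.

Lemma palmJE r : (palmJ r)%:E = (\int[@vol R n]_(x in W) (expR (- (ld * lens r x)))%:E)%E.
Proof.
rewrite fineK // ge0_fin_numE; last by apply: integral_ge0 => x _; rewrite lee_fin expR_ge0.
apply: le_lt_trans (vol_cball_lty n rd).
rewrite -[leRHS]mul1e -integral_cst //; apply: ge0_le_integral => //.
- by apply/measurable_EFinP; apply: measurable_funS (measurable_exp_lens r).
- by move=> x _; rewrite lee_fin exp_lens_le1.
Qed.

Lemma palmJ_ge0 r : 0 <= palmJ r.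
Proof. by rewrite -lee_fin palmJE; apply: integral_ge0 => x _; rewrite lee_fin expR_ge0. Qed.

Lemma vol_lens_fin r x : vol (cball x r `&` W) \is a fin_num.
Proof.
apply: (@vol_fin_sub _ _ _ rd); last by move=> y [].
by apply: measurableI => //; exact: measurable_cball.
Qed.

Lemma lens_vol r x : (lens r x)%:E = vol (cball x r `&` W).
Proof. by rewrite fineK // vol_lens_fin. Qed.

Lemma lens_cvg (e : nat -> R) r x : (forall k l, (k <= l)%N -> e l <= e k) ->
  e k @[k --> \oo] --> r -> (forall k, r <= e k) ->
  lens (e k) x @[k --> \oo] --> lens r x.
Proof.
move=> nd er re; suff : vol (cball x (e k) `&` W) @[k --> \oo] --> (lens r x)%:E by case/fine_cvgP.
rewrite /lens fineK ?vol_lens_fin //.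
have -> : cball x r `&` W = \bigcap_k (cball x (e k) `&` W).
  apply/seteqP; split=> y; first by move=> [h1 h2] k _; split=> //; exact: le_trans h1 (re k).
  move=> h; split; last by have [] := h 0%N Logic.I.
  rewrite /cball /=; apply: (cvgr_to_ge er); apply: nearW => k.
  by have [] := h k Logic.I.
apply: nonincreasing_cvg_mu.
- by have := vol_lens_fin (e 0%N) x; rewrite ge0_fin_numE // vol_ge0.
- by move=> k; apply: measurableI => //; exact: measurable_cball.
- by apply: bigcapT_measurable => k; apply: measurableI => //; exact: measurable_cball.
- by move=> k l kl; apply/subsetPset => y [h1 h2]; split=> //; exact: le_trans h1 (nd _ _ kl).
Qed.

Lemma palmJ_cvg (e : nat -> R) r : (forall k l, (k <= l)%N -> e l <= e k) ->
  e k @[k --> \oo] --> r -> (forall k, r <= e k) ->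
  palmJ (e k) @[k --> \oo] --> palmJ r.
Proof.
move=> nd er re; suff : (palmJ (e k))%:E @[k --> \oo] --> (palmJ r)%:E by case/fine_cvgP.
rewrite [X in _ --> X]palmJE.
rewrite (_ : (fun k => _) = (fun k => \int[@vol R n]_(x in W) (expR (- (ld * lens (e k) x)))%:E)%E);
  last by apply/funext => k; exact: palmJE.
have [] // := @dominated_convergence _ _ _ (@vol R n) W mW
  (fun k x => (expR (- (ld * lens (e k) x)))%:E)
  (fun x => (expR (- (ld * lens r x)))%:E) (cst 1%:E).
- by move=> k; apply/measurable_EFinP; apply: measurable_funS (measurable_exp_lens _).
- by apply/measurable_EFinP; apply: measurable_funS (measurable_exp_lens _).
- apply: aeW => x _; apply/cvg_EFin; first exact: nearW.
  by apply: cvg_expR; apply: (@cvgN _ R^o); apply: cvgM; [exact: cvg_cst|exact: lens_cvg].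
- apply/integrableP; split; first exact: measurable_cst.
  rewrite (eq_integral (cst 1%E)); last by move=> x _; rewrite /= normr1.
  by rewrite integral_cst // mul1e vol_cball_lty.
- by apply: aeW => x k _; rewrite lee_fin ger0_norm ?expR_ge0 // exp_lens_le1.
Qed.

Lemma capG_cvg (e : nat -> R) r : (forall k l, (k <= l)%N -> e l <= e k) ->
  e k @[k --> \oo] --> r -> (forall k, r <= e k) ->
  capG (e k) @[k --> \oo] --> capG r.
Proof.
move=> nd er re; rewrite /capG.
have -> : cball (vzero R n) r = \bigcap_k cball (vzero R n) (e k).
  apply/seteqP; split=> y; first by move=> h1 k _; exact: le_trans h1 (re k).
  move=> h; rewrite /cball /=; apply: (cvgr_to_ge er); apply: nearW => k.
  exact: h k Logic.I.
apply: (@capa_nonincreasing_cvg _ _ _ _ ld0 _ (e 0%N)).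
- by move=> k; exact: measurable_cball.
- by move=> k y h; apply: le_trans h (nd _ _ _).
- by move=> k l kl y h; apply: le_trans h (nd _ _ kl).
Qed.

Lemma secvol_mono (S S' : set (n.-tuple R * n.-tuple R)) x : measurable S -> measurable S' ->
  (forall y, S (x, y) -> S' (x, y)) -> secvol rd S x <= secvol rd S' x.
Proof.
move=> mS mS' h; rewrite -lee_fin !secvolE //; apply: measure_mono.
- exact: measurable_sec.
- exact: measurable_sec.
- by move=> y [/h].
Qed.

Lemma relcap_mono (S S' : set (n.-tuple R * n.-tuple R)) M : measurable S -> measurable S' ->
  S `<=` S' -> S' `<=` near_diag M -> relcap ld rd S <= relcap ld rd S'.
Proof.
move=> mS mS' SS' S'M.
have h1 := integral_relint rd ld0 mS (subset_trans SS' S'M).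
have h2 := integral_relint rd ld0 mS' S'M.
rewrite -lee_fin [leLHS]h1 [leRHS]h2; apply: ge0_le_integral => //.
- by move=> x _; rewrite lee_fin relint_ge0.
- by apply/measurable_EFinP; exact: measurable_relint.
- by apply/measurable_EFinP; exact: measurable_relint.
move=> x _; rewrite lee_fin lerD2l lerN2 ler_expR lerN2 ler_pM2l //.
by apply: secvol_mono => // y; exact: SS'.
Qed.

Lemma capa_mono U U' M : measurable U -> measurable U' -> U `<=` U' ->
  U' `<=` cball (vzero R n) M -> capa ld rd U <= capa ld rd U'.
Proof.
move=> mU mU' UU' U'M; apply: (@relcap_mono _ _ M).
- exact: measurable_addpre.
- exact: measurable_addpre.
- by move=> p; exact: UU'.
- exact: addpre_near.
Qed.

Lemma capa_shift U c : measurable U ->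
  capa ld rd [set x | U (vsub x c)] = capa ld rd U.
Proof.
move=> mU; apply: (congr1 fine).
have mg : measurable_fun setT (fun x => vadd x (vscale (-1) c)) by exact: measurable_vadd.
pose F x := (1 - expR (- (ld * secvol rd (addpre U) x)))%:E.
apply: etrans (@ge0_integral_preserved R n _ F mg _ _ _).
- apply: eq_integral => x _; congr (1 - expR (- (ld * fine (vol _))))%:E.
  apply/seteqP; split=> y [h1 h2]; split=> //; move: h1; rewrite /addpre /=; congr U;
    apply: vext => i; rewrite !vE; ring.
- by move=> B mB; exact: vol_translate.
- by apply/measurable_EFinP; apply: measurable_relint; exact: measurable_addpre.
- by move=> x; rewrite lee_fin relint_ge0.
Qed.

(** Lonely cells are defined with open balls, to which the void probabilities apply directly, while
    [capG] refers to closed ones; monotonicity links the two. *)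
Lemma capa_oball c r e : 0 < e ->
  capG r <= capa ld rd (oball c (r + e)) <= capG (r + e).
Proof.
move=> e0.
have -> : oball c (r + e) = [set x | oball (vzero R n) (r + e) (vsub x c)].
  by apply/seteqP; split=> x; rewrite /oball /= vsubx0.
rewrite capa_shift; last exact: measurable_oball.
apply/andP; split.
  apply: (@capa_mono _ _ (r + e)); [exact: measurable_cball|exact: measurable_oball| |].
    by move=> x; rewrite /cball /oball /= => /le_lt_trans; apply; rewrite ltrDl.
  by move=> x /ltW.
apply: (@capa_mono _ _ (r + e)); [exact: measurable_oball|exact: measurable_cball| |].
  by move=> x /ltW.
by [].
Qed.

Section Increment.
Variables (c : n.-tuple R) (r e : R) (q : set (n.-tuple R)).
Hypotheses (e0 : 0 < e) (mq : measurable q) (r0 : 0 <= r).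
Hypothesis qe : q `<=` cball c e.
Let B := oball c (r + 2 * e).
Let mB : measurable B. Proof. exact: measurable_oball. Qed.
Let v := fine (vol q).
Let b x := secvol rd (addpre B) x.
Let t x := secvol rd (addpre q) x.

Let qB : q `<=` B.
Proof.
have er : e < r + 2 * e by exact: lt_add_double.
by move=> x /qe h; exact: le_lt_trans h er.
Qed.

Let M := r + 2 * e + enorm c.
Let BM : B `<=` cball (vzero R n) M.
Proof.
move=> x xB; rewrite /cball /= vsubx0 /M.
have -> : x = vadd (vsub x c) c by apply: vext => i; rewrite !vE; ring.
by rewrite (le_trans (enormD _ _)) // lerD2r ltW.
Qed.

Let volqE : v%:E = vol q.
Proof.
rewrite fineK //; apply: (@vol_fin_sub _ _ _ M) => //.
exact: subset_trans qB BM.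
Qed.
Let v0 : 0 <= v. Proof. by rewrite fine_ge0 // vol_ge0. Qed.

Let mBq : measurable (B `\` q). Proof. exact: measurableD. Qed.

Let bE x : b x = secvol rd (addpre (B `\` q)) x + t x.
Proof.
apply: EFin_inj; rewrite EFinD !secvolE; [|exact: measurable_addpre..].
rewrite -measureU //; last 3 first.
- by apply: measurable_sec; exact: measurable_addpre.
- by apply: measurable_sec; exact: measurable_addpre.
- by apply/seteqP; split=> // y [[[_ h] _] [h' _]].
congr vol; apply/seteqP; split=> y /=.
  move=> [By Wy]; have [qy|nqy] := pselect (addpre q (x, y)); first by right.
  by left; split.
by move=> [[[] //]|[/qB ?]].
Qed.

Let t_ge0 x : 0 <= t x. Proof. exact: secvol_ge0. Qed.
Let t_le x : t x <= v.
Proof.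
rewrite -lee_fin volqE secvolE; last exact: measurable_addpre.
rewrite -[leRHS](vol_translate x) //; apply: measure_mono.
- by apply: measurable_sec; exact: measurable_addpre.
- by apply: measurable_comp_set => //; exact: measurable_vadd.
- move=> y [h _]; move: h; rewrite /addpre /=; congr q; apply: vext => i.
  by rewrite !vE addrC.
Qed.

Let mexpb : measurable_fun setT (fun x => expR (- (ld * b x))).
Proof.
apply: (measurableT_comp (@measurable_expR R)).
apply: measurableT_comp => //; apply: measurable_funM => //.
by apply: measurable_secvol; exact: measurable_addpre.
Qed.

Let mt : measurable_fun setT t.
Proof. by apply: measurable_secvol; exact: measurable_addpre. Qed.

Let I := (\int[@vol R n]_x (t x * expR (- (ld * b x)))%:E)%E.

(** A point [z] of [q] is within [e] of the center [c], so [B], of radius [r + 2 * e], lies between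
    the balls of radii [r] and [r + 3 * e] around [z]. Shifting by [z - y] turns these into balls
    around [y]. *)
Let b_lens z y : q z -> lens r y <= b (vsub z y) <= lens (r + 3 * e) y.
Proof.
move=> /qe; rewrite /cball /= => zc.
have zyu u : vsub (vadd (vsub z y) u) z = vsub u y by apply: vext => i; rewrite !vE; ring.
have bEv := secvolE rd (vsub z y) (measurable_addpre mB).
have ms := measurable_sec rd (vsub z y) (measurable_addpre mB).
have mc s : measurable (cball y s `&` W) by apply: measurableI => //; exact: measurable_cball.
have e1 := lens_vol r y; have e2 := lens_vol (r + 3 * e) y.
apply/andP; split.
- rewrite -lee_fin [leLHS]e1 [leRHS]bEv; apply: (measure_mono _ (mc _) ms).
  move=> u [uy Wu]; split=> //; rewrite /addpre /B /oball /=.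
  apply: le_lt_trans (enorm_triangle _ z _) _; rewrite zyu.
  exact: add_lt_double.
- rewrite -lee_fin [leRHS]e2 [leLHS]bEv; apply: (measure_mono _ ms (mc _)).
  move=> u [uB Wu]; split=> //; rewrite /cball /= -zyu.
  apply: le_trans (enorm_triangle _ c _) _; rewrite (enorm_vsubC c z).
  exact: add_le_triple.
Qed.

(* Tonelli turns the overlap integral into the average over [z] in [q] of
   [y |-> exp (- ld * b (z - y))] on the daughter ball. *)
Let IE : I = (\int[@vol R n]_(z in q) \int[@vol R n]_(y in W) (expR (- (ld * b (vsub z y))))%:E)%E.
Proof.
pose h (p : n.-tuple R * n.-tuple R) : \bar R :=
  (expR (- (ld * b p.1)) * (\1_W p.2 * \1_q (vadd p.1 p.2)))%:E.
have mh : measurable_fun setT h.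
  apply/measurable_EFinP; apply: measurable_funM.
    exact: (measurableT_comp mexpb measurable_fst).
  apply: measurable_funM.
    by apply: (measurableT_comp (measurable_indic mW)) => //; exact: measurable_snd.
  apply: (measurableT_comp (measurable_indic mq)); exact: measurable_vadd.
have h0 p : (0 <= h p)%E by rewrite lee_fin !mulr_ge0 ?expR_ge0.
transitivity (\int[@vol R n]_x \int[@vol R n]_y h (x, y))%E.
  apply: eq_integral => x _; rewrite /h /=.
  pose g y : R := \1_W y * \1_q (vadd x y).
  have mg : measurable_fun setT (EFin \o g).
    apply/measurable_EFinP; apply: measurable_funM; first exact: measurable_indic.
    by apply: (measurableT_comp (measurable_indic mq)); exact: measurable_vadd.
  have g0 y : (0 <= (EFin \o g) y)%E by rewrite lee_fin mulr_ge0.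
  transitivity ((expR (- (ld * b x)))%:E * \int[@vol R n]_y (EFin \o g) y)%E; last first.
    by rewrite -ge0_integralZl // ?lee_fin ?expR_ge0.
  rewrite mulrC EFinM; congr (_ * _)%E; rewrite secvolE; last exact: measurable_addpre.
  rewrite -[in LHS](setIT (_ `&` _)) -integral_indic //; last first.
    by apply: measurable_sec; exact: measurable_addpre.
  by apply: eq_integral => y _; rewrite indicI /= mulrC !indicE.
rewrite (fubini_tonelli h mh h0).
transitivity (\int[@vol R n]_y \int[@vol R n]_z
    (expR (- (ld * b (vsub z y))) * (\1_W y * \1_q z))%:E)%E.
  apply: eq_integral => y _.
  have mg : measurable_fun setT (fun z => vsub z y) by exact: measurable_vsub.
  apply: etrans (esym (@ge0_integral_preserved R n _ (fun x => h (x, y)) mg _ _ _)) _ => //.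
  - by move=> D mD; rewrite -[RHS](vol_translate (vscale (-1) y)) //; congr vol;
      apply/seteqP; split=> z /=; congr D; apply: vext => i; rewrite !vE; ring.
  - by apply: (measurableT_comp mh); exact: measurable_fun_pair.
  - apply: eq_integral => z _; rewrite /h /=; congr (_ * (_ * \1_q _))%:E.
    by apply: vext => i; rewrite !vE; ring.
rewrite (@fubini_tonelli _ _ _ _ _ (@vol R n) (@vol R n)
   (fun p => (expR (- (ld * b (vsub p.2 p.1))) * (\1_W p.1 * \1_q p.2))%:E)); last 2 first.
- apply/measurable_EFinP; apply: measurable_funM.
    by apply: (measurableT_comp mexpb); exact: measurable_vsub.
  apply: measurable_funM.
    exact: (measurableT_comp (measurable_indic mW) measurable_fst).
  exact: (measurableT_comp (measurable_indic mq) measurable_snd).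
- by move=> p; rewrite lee_fin !mulr_ge0 ?expR_ge0.
rewrite [RHS]integral_mkcond; apply: eq_integral => z _; rewrite patchE /= indicE.
case: ifP => _ /=; last by apply: integral0_eq => y _; rewrite !mulr0.
rewrite [RHS]integral_mkcond; apply: eq_integral => y _; rewrite patchE indicE mulr1.
by case: ifP => _; rewrite ?mulr1 ?mulr0.
Qed.

Let I_bounds : ((v * palmJ (r + 3 * e))%:E <= I <= (v * palmJ r)%:E)%E.
Proof.
have mvs z : measurable_fun W (fun y => expR (- (ld * b (vsub z y)))).
  have mz : measurable_fun setT (fun y : n.-tuple R => vsub z y) by exact: measurable_vsub.
  by apply: measurable_funTS; exact: (measurableT_comp mexpb mz).
have minner : measurable_fun q
    (fun z => \int[@vol R n]_(y in W) (expR (- (ld * b (vsub z y))))%:E)%E.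
  apply: measurable_funTS.
  pose k (p : n.-tuple R * n.-tuple R) : \bar R := (expR (- (ld * b (vsub p.1 p.2))) * \1_W p.2)%:E.
  have mk : measurable_fun setT k.
    apply/measurable_EFinP; apply: measurable_funM.
      have m12 : measurable_fun setT (fun p : n.-tuple R * n.-tuple R => vsub p.1 p.2).
        exact: measurable_vsub.
      exact: (measurableT_comp mexpb m12).
    exact: (measurableT_comp (measurable_indic mW) measurable_snd).
  have k0 p : (0 <= k p)%E by rewrite lee_fin mulr_ge0 ?expR_ge0.
  have := measurable_fun_fubini_tonelli_F (m2 := @vol R n) k mk k0.
  congr measurable_fun; apply/funext => z; rewrite /fubini_F [RHS]integral_mkcond.
  apply: eq_integral => y _; rewrite patchE /k /= indicE.
  by case: ifP => _; rewrite ?mulr1 ?mulr0.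
have lo z : q z -> ((palmJ (r + 3 * e))%:E <= \int[@vol R n]_(y in W) (expR (- (ld * b (vsub z y))))%:E)%E.
  move=> qz; rewrite palmJE; apply: ge0_le_integral => //.
  - by apply/measurable_EFinP; apply: measurable_funTS (measurable_exp_lens _).
  - exact/measurable_EFinP.
  move=> y _; have /andP[_ h] := @b_lens z y qz.
  by rewrite lee_fin ler_expR lerN2 ler_pM2l.
have hi z : q z -> (\int[@vol R n]_(y in W) (expR (- (ld * b (vsub z y))))%:E <= (palmJ r)%:E)%E.
  move=> qz; rewrite palmJE; apply: ge0_le_integral => //.
  - exact/measurable_EFinP.
  - by apply/measurable_EFinP; apply: measurable_funTS (measurable_exp_lens _).
  move=> y _; have /andP[h _] := @b_lens z y qz.
  by rewrite lee_fin ler_expR lerN2 ler_pM2l.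
have cst_int (a : R) : 0 <= a -> ((v * a)%:E = \int[@vol R n]_(z in q) (cst a%:E z))%E.
  move=> a0; rewrite integral_cst //; apply: etrans (congr1 (mule a%:E) volqE).
  by rewrite -EFinM mulrC.
have e1 := cst_int _ (palmJ_ge0 (r + 3 * e)); have e2 := cst_int _ (palmJ_ge0 r).
rewrite [I]IE; apply/andP; split; [rewrite [leLHS]e1|rewrite [leRHS]e2]; apply: ge0_le_integral => //.
- by move=> z _; rewrite lee_fin palmJ_ge0.
- by move=> z _; apply: integral_ge0 => y _; rewrite lee_fin expR_ge0.
Qed.

(** The difference of the integrands of the two capacities, since [b - t] is the section volume of
    [B] without [q]. To first order in [t] it is [ld * t * exp (- ld * b)], whose integral is
    [ld * I]. *)
Let incr x : R := expR (- (ld * b x)) * (expR (ld * t x) - 1).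

Let mincr : measurable_fun setT incr.
Proof.
apply: measurable_funM => //; apply: measurable_funB => //.
by apply: (measurableT_comp (@measurable_expR R)); exact: measurable_funM.
Qed.

Let incr_ge x : ld * (t x * expR (- (ld * b x))) <= incr x.
Proof.
rewrite /incr mulrA mulrC ler_wpM2l ?expR_ge0 // lerBrDl; exact: expR_ge1Dx.
Qed.

Let incr_le x : incr x <= ld * expR (ld * v) * (t x * expR (- (ld * b x))).
Proof.
have -> : ld * expR (ld * v) * (t x * expR (- (ld * b x))) =
  expR (- (ld * b x)) * (ld * t x * expR (ld * v)) by ring.
apply: ler_wpM2l; first exact: expR_ge0.
apply: (@le_trans _ _ (ld * t x * expR (ld * t x))).
  exact: expR_sub1_le.
by rewrite ler_wpM2l ?mulr_ge0 ?(ltW ld0) // ler_expR ler_pM2l.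
Qed.

(** As [e] tends to 0 both bounds become [ld * v * palmJ r] to first order: the capacity drops in
    proportion to the volume of the removed cell, with density [ld * palmJ r]. *)
Lemma capa_increment :
  ld * v * palmJ (r + 3 * e) <= capa ld rd B - capa ld rd (B `\` q)
  /\ capa ld rd B - capa ld rd (B `\` q) <= ld * expR (ld * v) * (v * palmJ r).
Proof.
have BqM : B `\` q `<=` cball (vzero R n) M by move=> x [/BM].
have := integral_relint rd ld0 (measurable_addpre mB) (addpre_near BM).
have := integral_relint rd ld0 (measurable_addpre mBq) (addpre_near BqM).
rewrite -/(capa ld rd B) -/(capa ld rd (B `\` q)).
move: (capa ld rd B) (capa ld rd (B `\` q)) => cB cBq hBq hB.
have incr0 x : 0 <= incr x by apply: le_trans (incr_ge x); rewrite !mulr_ge0 ?(ltW ld0) ?expR_ge0.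
have key : ((cB - cBq)%:E = \int[@vol R n]_x (incr x)%:E)%E.
  suff h : (cB%:E = cBq%:E + \int[@vol R n]_x (incr x)%:E)%E.
    by rewrite EFinB h addeAC subee // add0e.
  rewrite hB hBq -ge0_integralD //; last 4 first.
  - by move=> x _; rewrite lee_fin relint_ge0.
  - by apply/measurable_EFinP; apply: measurable_relint; exact: measurable_addpre.
  - by move=> x _; rewrite lee_fin.
  - exact/measurable_EFinP.
  apply: eq_integral => x _; rewrite -EFinD; congr EFin; rewrite /incr -/(b x).
  have -> : secvol rd (addpre (B `\` q)) x = b x - t x by rewrite bE addrK.
  have -> : - (ld * (b x - t x)) = - (ld * b x) + ld * t x by ring.
  by rewrite expRD; ring.
have If (a : R) : 0 <= a -> (a%:E * I = \int[@vol R n]_x (a * (t x * expR (- (ld * b x))))%:E)%E.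
  move=> a0; rewrite /I -ge0_integralZl //.
  - exact/measurable_EFinP/measurable_funM.
  - by move=> x _; rewrite lee_fin mulr_ge0 ?expR_ge0.
have /andP[I1 I2] := I_bounds.
rewrite -!lee_fin key; split.
- apply: (@le_trans _ _ (ld%:E * I)%E).
    by rewrite -mulrA EFinM lee_pmul2l // lte_fin.
  rewrite (If _ (ltW ld0)); apply: ge0_le_integral => //.
  + by move=> x _; rewrite lee_fin !mulr_ge0 ?(ltW ld0) ?expR_ge0.
  + by apply/measurable_EFinP; apply: measurable_funM => //; exact: measurable_funM.
  + exact/measurable_EFinP.
  + by move=> x _; rewrite lee_fin.
- apply: (@le_trans _ _ ((ld * expR (ld * v))%:E * I)%E); last first.
    by rewrite (EFinM (ld * expR (ld * v))) lee_pmul2l // lte_fin mulr_gt0 ?expR_gt0.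
  rewrite If ?mulr_ge0 ?(ltW ld0) ?expR_ge0 //; apply: ge0_le_integral => //.
  + by move=> x _; rewrite lee_fin.
  + exact/measurable_EFinP.
  + by apply/measurable_EFinP; apply: measurable_funM => //; exact: measurable_funM.
  + by move=> x _; rewrite lee_fin.
Qed.

End Increment.
End CapacityEstimates.

Section OpenSets.
Variables (R : realType) (n : nat).
Implicit Types (U V : set (n.-tuple R)).

Lemma vopenI U V : vopen U -> vopen V -> vopen (U `&` V).
Proof.
move=> oU oV z [Uz Vz]; have [e e0 he] := oU z Uz; have [f f0 hf] := oV z Vz.
exists (Order.min e f); first by rewrite lt_min e0.
move=> z' h; split; [apply: he|apply: hf] => i; have := h i; rewrite lt_min => /andP[] //.
Qed.

Lemma vopenU U V : vopen U -> vopen V -> vopen (U `|` V).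
Proof.
move=> oU oV z [] h; [have [e e0 he] := oU z h|have [e e0 he] := oV z h];
  exists e => // z' h'; [left|right]; exact: he.
Qed.

(** Dividing by [n + 1] rather than [n] makes the final inequality strict and covers dimension 0. *)
Lemma enorm_close (z z' : n.-tuple R) (g : R) : 0 < g ->
  (forall i, `|tnth z' i - tnth z i| < g / n.+1%:R) -> enorm (vsub z' z) < g.
Proof.
move=> g0 h; apply: (@le_lt_trans _ _ (n%:R * (g / n.+1%:R))).
  by apply: enorm_le_sum; [rewrite divr_ge0 // ltW|move=> i; rewrite vE ltW].
by rewrite mulrA ltr_pdivrMr // [ltRHS]mulrC ltr_pM2r // ltr_nat.
Qed.

Lemma vopen_oball (c : n.-tuple R) r : vopen (oball c r).
Proof.
move=> z zc; exists ((r - enorm (vsub z c)) / n.+1%:R); first by rewrite divr_gt0 // subr_gt0.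
move=> z' h; rewrite /oball /=; apply: le_lt_trans (enorm_triangle _ z _) _.
by rewrite -ltrBrDr; apply: enorm_close => //; rewrite subr_gt0.
Qed.

Lemma vopen_setC_cball (c : n.-tuple R) r : vopen (~` cball c r).
Proof.
move=> z /= /negP; rewrite -ltNge => zc.
exists ((enorm (vsub z c) - r) / n.+1%:R); first by rewrite divr_gt0 // subr_gt0.
move=> z' h; apply/negP; rewrite -ltNge.
have h' : enorm (vsub z z') < enorm (vsub z c) - r.
  by rewrite enorm_vsubC; apply: enorm_close => //; rewrite subr_gt0.
have := enorm_triangle z z' c; move: h'; clear; lra.
Qed.

Lemma vopen_setC_box (a b : 'I_n -> R) : vopen (~` box (fun i => `[a i, b i]%classic)).
Proof.
move=> z /= /existsNP[i]; rewrite /= in_itv /= => /negP; rewrite negb_and -!ltNge => /orP[] h.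
  exists (a i - tnth z i); first by rewrite subr_gt0.
  move=> z' /(_ i) h' /(_ i); rewrite /= in_itv /= => /andP[h1 _].
  by move: h'; rewrite ltr_norml => /andP[_]; rewrite ltrD2r ltNge h1.
exists (tnth z i - b i); first by rewrite subr_gt0.
move=> z' /(_ i) h' /(_ i); rewrite /= in_itv /= => /andP[_ h1].
by move: h'; rewrite ltr_norml => /andP[+ _]; rewrite opprB ltrD2r ltNge h1.
Qed.

End OpenSets.

(** * The Palm distribution through small cells *)

Section HalfOpenIntervals.
Variable R : realType.
Implicit Types a e x c : R.
Lemma shift_itv a e x : -1 + a <= x -> x < -1 + a + e -> (a <= x + 1) && (x + 1 < a + e).
Proof. by move=> *; apply/andP; split; lra. Qed.
Lemma unshift_itv a e x : a <= x + 1 -> x + 1 < a + e -> (-1 + a <= x) && (x < -1 + a + e).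
Proof. by move=> *; apply/andP; split; lra. Qed.
Lemma dist_itv c e x : c <= x -> x < c + e -> `|x - c| <= e.
Proof. by move=> *; rewrite ler_norml; apply/andP; split; lra. Qed.
End HalfOpenIntervals.

(** * The grid of half-open cells on the unit ball *)

Section Cells.
Variables (R : realType) (n : nat).
Hypothesis n0 : (0 < n)%N.

Definition mesh (k : nat) : R := k.+1%:R^-1.
(** At mesh [1 / (k + 1)] the interval from -1 to 1 consists of [2 (k + 1)] half-open pieces; the
    additional index catches the end point 1. *)
Definition cellIdx k : finType := {ffun 'I_n -> 'I_(2 * k.+1).+1}.
Definition corner k (j : cellIdx k) : n.-tuple R := [tuple -1 + (j i)%:R * mesh k | i < n].
Definition unitball : set (n.-tuple R) := cball (vzero R n) 1.
Definition gcell k (j : cellIdx k) : set (n.-tuple R) :=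
  box (fun i => `[tnth (corner j) i, (tnth (corner j) i + mesh k)[%classic) `&` unitball.
Definition diam k : R := n%:R * mesh k.

Lemma mesh_gt0 k : 0 < mesh k. Proof. by rewrite invr_gt0. Qed.
Lemma diam_gt0 k : 0 < diam k. Proof. by rewrite mulr_gt0 ?ltr0n ?mesh_gt0. Qed.

Lemma measurable_gcell k (j : cellIdx k) : measurable (gcell j).
Proof. by apply: measurableI; [apply: measurable_box|exact: measurable_cball]. Qed.

Lemma gcell_coord k (j : cellIdx k) x i : gcell j x ->
  (j i)%:R <= (tnth x i + 1) * k.+1%:R < (j i).+1%:R.
Proof.
move=> [/(_ i) + _]; rewrite /= in_itv /= tnth_mktuple /mesh => /andP[h1 h2].
rewrite -ler_pdivrMr // -[X in _ && X]ltr_pdivlMr // -[(j i).+1%:R]natr1.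
rewrite mulrDl mul1r; exact: shift_itv.
Qed.

Lemma gcell_triv k : trivIset setT (@gcell k).
Proof.
move=> j j' _ _ [x [xj xj']]; apply/ffunP => i; apply/val_inj/eqP => /=.
have /andP[a1 a2] := gcell_coord i xj; have /andP[b1 b2] := gcell_coord i xj'.
have := le_lt_trans a1 b2; have := le_lt_trans b1 a2.
by rewrite !ltr_nat !ltnS => h1 h2; rewrite eqn_leq h1 h2.
Qed.

Lemma gcell_cover k : \bigcup_(j in [set: cellIdx k]) gcell j = unitball.
Proof.
apply/seteqP; split=> x; first by move=> [j _ []].
move=> xA; have xi i : 0 <= (tnth x i + 1) * k.+1%:R <= (2 * k.+1)%:R.
  have : enorm x <= 1 by move: xA; rewrite /unitball /cball /= vsubx0.
  have := tnth_le_enorm x i => h1 h2; have := le_trans h1 h2.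
  rewrite ler_norml => /andP[h3 h4]; rewrite natrM ler_pM2r //.
  by rewrite pmulr_lge0 //; apply/andP; split; lra.
have ti i : (Num.Def.truncn ((tnth x i + 1) * k.+1%:R) < (2 * k.+1).+1)%N.
  by have /andP[h1 h2] := xi i; rewrite ltnS -(@ler_nat R) (le_trans _ h2) // truncn_le.
exists [ffun i => Ordinal (ti i)] => //; split=> // i /=.
rewrite in_itv /= tnth_mktuple ffunE /=.
have /andP[h1 _] := xi i; have := truncn_itv h1; rewrite -[(Num.Def.truncn _).+1%:R]natr1.
set t := (Num.Def.truncn _)%:R => /andP[h3 h4].
move: h3 h4; rewrite -ler_pdivrMr // -[X in _ -> is_true X -> _]ltr_pdivlMr // mulrDl mul1r /mesh => h3 h4.
exact: unshift_itv.
Qed.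

Lemma gcell_sub k (j : cellIdx k) : gcell j `<=` cball (corner j) (diam k).
Proof.
move=> x [xj _]; rewrite /cball /=; apply: enorm_le_sum; first by rewrite ltW ?mesh_gt0.
move=> i; have := xj i; rewrite /= in_itv /= vE => /andP[h1 h2].
exact: dist_itv.
Qed.

Lemma gcell_close k (j : cellIdx k) x y : gcell j x -> gcell j y -> enorm (vsub x y) <= 2 * diam k.
Proof.
move=> /gcell_sub h1 /gcell_sub h2; apply: le_trans (enorm_triangle _ (corner j) _) _.
rewrite (enorm_vsubC (corner j)) mulrDl mul1r; exact: lerD.
Qed.

Lemma vol_gcell_fin k (j : cellIdx k) : vol (gcell j) \is a fin_num.
Proof. by apply: (@vol_fin_sub _ _ _ 1); [exact: measurable_gcell|move=> x []]. Qed.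

Lemma vol_gcell_le k (j : cellIdx k) : fine (vol (gcell j)) <= (2 * diam k) ^+ n.
Proof.
rewrite -lee_fin fineK ?vol_gcell_fin // -vol_cube; last exact: ltW (diam_gt0 k).
apply: (@le_trans _ _ (vol (cball (vzero R n) (diam k)))).
  rewrite -(vol_cball_shift (corner j)); apply: measure_mono;
    [exact: measurable_gcell|exact: measurable_cball|exact: gcell_sub].
apply: measure_mono; [exact: measurable_cball|by apply: measurable_box|exact: cball_tnth].
Qed.

Lemma sum_vol_gcell k : \sum_(j : cellIdx k) fine (vol (gcell j)) = vball R n.
Proof.
apply: EFin_inj; rewrite -sumEFin /vball fineK; last first.
  by rewrite ge0_fin_numE ?vol_ge0 // vol_cball_lty.
rewrite -/unitball -(gcell_cover k) measure_finType_bigcup; last 2 first.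
- by move=> j; exact: measurable_gcell.
- exact: gcell_triv.
by apply: eq_bigr => j _; rewrite fineK // vol_gcell_fin.
Qed.

(* Closed sets increasing to [gcell j]: they exhibit the difference of an open
   ball and a cell as a decreasing intersection of open sets. *)
Definition fcell k (j : cellIdx k) (l : nat) : set (n.-tuple R) :=
  box (fun i => `[tnth (corner j) i, tnth (corner j) i + mesh k - l.+1%:R^-1]%classic) `&` unitball.

Lemma fcell_bigcup k (j : cellIdx k) : \bigcup_l fcell j l = gcell j.
Proof.
apply/seteqP; split=> x.
  move=> [l _ [h xA]]; split=> // i; have := h i; rewrite /= !in_itv /= => /andP[-> /=] h2.
  by apply: le_lt_trans h2 _; rewrite ltrBlDr ltrDl invr_gt0.
move=> [h xA].
have /choice[l hl] : forall i, exists l : nat, l.+1%:R^-1 <= tnth (corner j) i + mesh k - tnth x i.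
  move=> i; have := h i; rewrite /= in_itv /= => /andP[_ h2].
  set g := _ + _ - _; have g0 : 0 < g by rewrite subr_gt0.
  exists (Num.Def.truncn g^-1); rewrite -[leRHS]invrK lef_pV2 ?posrE ?invr_gt0 //.
  by rewrite ltW // truncnS_gt.
exists (\max_i l i)%N => //; split=> // i; have := h i; rewrite /= !in_itv /= => /andP[-> h2] /=.
rewrite lerBrDl -lerBrDr; apply: le_trans (hl i).
by rewrite lef_pV2 ?posrE // ler_nat ltnS (@leq_bigmax _ l).
Qed.

Lemma fcell_mono k (j : cellIdx k) l l' : (l <= l')%N -> fcell j l `<=` fcell j l'.
Proof.
move=> ll x [h xA]; split=> // i; have := h i; rewrite /= !in_itv /= => /andP[-> h2] /=.
by apply: le_trans h2 _; rewrite lerD2l lerN2 lef_pV2 ?posrE // ler_nat ltnS.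
Qed.

Lemma measurable_fcell k (j : cellIdx k) l : measurable (fcell j l).
Proof. by apply: measurableI; [apply: measurable_box|exact: measurable_cball]. Qed.

Lemma vopen_fcellC k (j : cellIdx k) l : vopen (~` fcell j l).
Proof.
rewrite /fcell setCI; apply: vopenU; first exact: vopen_setC_box.
exact: vopen_setC_cball.
Qed.

Lemma diam_cvg : diam k @[k --> \oo] --> (0 : R).
Proof.
rewrite -(mulr0 (n%:R : R)); apply: cvgM; first exact: cvg_cst.
exact: cvg_harmonic.
Qed.

Lemma diam_nonincreasing k l : (k <= l)%N -> diam l <= diam k.
Proof. by move=> kl; rewrite ler_pM2l ?ltr0n // lef_pV2 ?posrE // ler_nat ltnS. Qed.

End Cells.

(** * Counting isolated points of a locally finite set by lonely cells *)

Section PointCount.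
Variables (R : realType) (n : nat).
Hypothesis n0 : (0 < n)%N.
Local Notation A := (@unitball R n).
Local Notation de := (@diam R n).

Definition isolated (F : set (n.-tuple R)) (r : R) : set (n.-tuple R) :=
  [set x | F x /\ F `&` cball x r `<=` [set x]].

Definition pball r k (j : cellIdx n k) : set (n.-tuple R) := oball (corner R j) (r + 2 * de k).

(* A difference of two void events.  On a fine mesh the lonely cells are those
   that contain an isolated point. *)
Definition lonely r k (j : cellIdx n k) (F : set (n.-tuple R)) : Prop :=
  F `&` (pball r j `\` gcell j) = set0 /\ F `&` pball r j <> set0.

Variables (F : set (n.-tuple R)) (r : R).
Hypotheses (finF : forall M, finite_set (F `&` cball (vzero R n) M)) (r0 : 0 <= r).

Lemma gcell_pball k (j : cellIdx n k) : gcell j `<=` pball r j.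
Proof.
move=> x /gcell_sub h; rewrite /pball /oball /=; apply: le_lt_trans h _.
by apply: lt_add_double => //; exact: diam_gt0.
Qed.

Lemma lonely_cnt k (j : cellIdx n k) : lonely r j F -> (1 <= cnt F (gcell j))%E.
Proof.
move=> [h1 /eqP/set0P[x [Fx xB]]].
have xc : gcell j x.
  by apply: contrapT => nx; have : (F `&` (pball r j `\` gcell j)) x by []; rewrite h1.
have := @cnt_fset_ge _ _ F (gcell j) [fset x]%fset; rewrite cardfs1; apply => y /=.
by rewrite inE => /eqP ->.
Qed.

Definition lonely_count k : \bar R := (\sum_(j : cellIdx n k) (if `[< lonely r j F >] then 1 else 0))%E.

(** The domination, uniform in the mesh: a lonely cell contains a point and the cells are
    disjoint. *)
Lemma lonely_count_le k : (lonely_count k <= cnt F A)%E.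
Proof.
rewrite -(gcell_cover R n k) (cnt_partition _ (@gcell_triv R n k)).
by apply: lee_sum => j _; case: ifPn => [/asboolP/lonely_cnt //|_]; exact: cnt_ge0.
Qed.

Lemma near_finite (T : choiceType) (D : set T) (Q : T -> nat -> Prop) : finite_set D ->
  (forall x, D x -> \forall k \near \oo, Q x k) -> \forall k \near \oo, forall x, D x -> Q x k.
Proof.
move=> fD h; have : \forall k \near \oo, (\bigcap_(x in [set` fset_set D]) (fun k => Q x k)) k.
  by apply: filter_bigI => x; rewrite in_fset_set // => /set_mem; exact: h.
by apply: filterS => k hk x Dx; apply: hk; rewrite /= in_fset_set //; exact/mem_set.
Qed.

Lemma diam_lt (c e a : R) : 0 < c -> e < a -> \forall k \near \oo, e + c * de k < a.
Proof.
move=> c0 ea; have /cvgr_lt : (fun k => e + c * de k) @ \oo --> e.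
  rewrite -[X in _ --> X]addr0; apply: cvgD; first exact: cvg_cst.
  rewrite -(mulr0 c); apply: cvgM; first exact: cvg_cst.
  exact: diam_cvg.
by apply.
Qed.

(** Only finitely many points matter. Once the mesh is fine, two of them never share a cell, and
    those at distance more than [r] are even farther than [r + 3 * de k]. Then a cell is lonely
    exactly when it contains a point and that point is isolated, so the equality is exact from some
    mesh on. *)
Lemma lonely_count_cvg : \forall k \near \oo, lonely_count k = cnt (isolated F r) A.
Proof.
(* A point within [r + 3 * de k] of a point of the unit ball has norm at most [r + 2] as soon as
   [3 * de k <= 1]. *)
pose S := F `&` cball (vzero R n) (r + 2).
have fS : finite_set S by exact: finF.
have fSS : finite_set (S `*` S) by exact: finite_setX.
have sep : \forall k \near \oo, forall p, (S `*` S) p ->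
    p.1 <> p.2 -> 2 * de k < enorm (vsub p.1 p.2).
  apply: near_finite => // -[x y] _ /=.
  have [->|/eqP xy] := pselect (x = y); first exact: nearW.
  have := @diam_lt 2 0 (enorm (vsub x y)); rewrite ltr0n => /(_ isT) h.
  have : 0 < enorm (vsub x y).
    rewrite lt_neqAle enorm_ge0 andbT eq_sym; apply: contra xy => /eqP e.
    have : dot (vsub x y) (vsub x y) == 0 by rewrite -sqr_enorm e expr0n.
    rewrite dot_eq0 => /eqP v0; apply/eqP; apply: vext => i.
    by have := congr1 (fun u => tnth u i) v0; rewrite !vE => /eqP; rewrite subr_eq0 => /eqP.
  by move=> /h; apply: filterS => k; rewrite add0r.
have gap : \forall k \near \oo, forall p, (S `*` S) p ->
    r < enorm (vsub p.1 p.2) -> r + 3 * de k < enorm (vsub p.1 p.2).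
  apply: near_finite => // -[x y] _ /=.
  have [h|h] := leP (enorm (vsub x y)) r.
    exact: nearW.
  have := @diam_lt 3 r (enorm (vsub x y)); rewrite ltr0n => /(_ isT h).
  by apply: filterS.
have small : \forall k \near \oo, 0 + 3 * de k < 1 by apply: diam_lt.
near=> k.
have hsep : forall p, (S `*` S) p -> p.1 <> p.2 -> 2 * de k < enorm (vsub p.1 p.2) by near: k.
have hgap : forall p, (S `*` S) p -> r < enorm (vsub p.1 p.2) ->
  r + 3 * de k < enorm (vsub p.1 p.2) by near: k.
have hsmall : 3 * de k <= 1 by rewrite ltW // -[ltLHS]add0r; near: k.
have d0 : 0 < de k by exact: diam_gt0.
rewrite /lonely_count -(gcell_cover R n k) (cnt_partition _ (@gcell_triv R n k)).
apply: eq_bigr => j _.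
have AS x : F x -> gcell j x -> S x.
  move=> Fx [_ xA]; split=> //; apply: le_trans xA _; exact: le1_add2.
have [e|/eqP/set0P[x [Fx xj]]] := pselect (F `&` gcell j = set0).
  have -> : cnt (isolated F r) (gcell j) = 0%E.
    apply/cnt_eq0/seteqP; split=> // x [[Fx _] xj]; rewrite -e; split=> //.
  case: ifPn => // /asboolP [h1 h2]; case: h2; apply/seteqP; split=> // x [Fx xB].
  have [xj|xj] := pselect (gcell j x); first by rewrite -e.
  by rewrite -h1.
have Sx := AS x Fx xj.
have uniqx y : F y -> gcell j y -> y = x.
  move=> Fy yj; apply: contrapT => yx.
  have := hsep (y, x) (conj (AS y Fy yj) Sx) yx.
  by rewrite ltNge (gcell_close yj xj).
have xd := gcell_sub xj; rewrite /cball /= in xd.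
have [iso|niso] := pselect (F `&` cball x r `<=` [set x]).
  rewrite asboolT; last first.
    split; last by move=> h; rewrite -[False]/((@set0 (n.-tuple R)) x) -h; split=> //; exact: gcell_pball.
    apply/seteqP; split=> // y [Fy [yB yj]].
    have yx3 : enorm (vsub y x) < r + 3 * de k.
      apply: le_lt_trans (enorm_triangle _ (corner R j) _) _.
      by rewrite (enorm_vsubC (corner R j)); apply: add_lt_triple.
    have xyne : y <> x by move=> e; apply: yj; rewrite e.
    have Sy : S y.
      split=> //; rewrite /cball /= vsubx0.
      have -> : y = vadd (vsub y x) x by apply: vext => i; rewrite !vE; ring.
      apply: le_trans (enormD _ _) _; apply: (add_le_add2 yx3 hsmall).
      by move: xj => [_]; rewrite /unitball /cball /= vsubx0.
    have [yr|yr] := leP (enorm (vsub y x)) r; first by case: xyne; apply: iso.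
    by have := hgap (y, x) (conj Sy Sx) yr; rewrite ltNge (ltW yx3).
  have e : isolated F r `&` gcell j = [set x].
    apply/seteqP; split=> y; first by move=> [[Fy _] yj]; exact: uniqx.
    by move=> ->.
  by rewrite cnt_fin e ?fset_set1 ?cardfs1.
have -> : cnt (isolated F r) (gcell j) = 0%E.
  apply/cnt_eq0/seteqP; split=> // y [[Fy yT] yj]; case: niso.
  by rewrite -(uniqx y Fy yj).
rewrite asboolF // => -[h1 _]; apply: niso => y [Fy yx]; apply: contrapT => nyx.
have yj : ~ gcell j y by move=> yj; apply: nyx; exact: uniqx.
have : (F `&` (pball r j `\` gcell j)) y; last by rewrite h1.
split=> //; split=> //; rewrite /pball /oball /=.
apply: le_lt_trans (enorm_triangle _ x _) _; exact: add_lt_double.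
Unshelve. all: by end_near. Qed.

End PointCount.

Section LonelyBounds.
Variable R : realType.

(** The difference is [exp (- lp * cB)] times [exp (lp * D) - 1] with [D] the drop of the capacity,
    and [exp y - 1] lies between [y] and [y * exp y]. In the error factor [v] is replaced by a
    common bound [w], so that the coefficient of [v] is the same for all cells of a mesh. *)
Lemma lonely_prob_bounds (lp ld v w J J' G G' cB cBq : R) : 0 < lp -> 0 < ld -> 0 <= v ->
  v <= w -> 0 <= J -> 0 <= J' -> G <= cB <= G' ->
  ld * v * J' <= cB - cBq -> cB - cBq <= ld * expR (ld * v) * (v * J) ->
  expR (- (lp * G')) * (lp * ld * J') * v <= expR (- (lp * cBq)) - expR (- (lp * cB))
  /\ expR (- (lp * cBq)) - expR (- (lp * cB)) <=
    expR (- (lp * G)) * (lp * ld * J) *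
      (expR (ld * w) * expR (lp * (ld * expR (ld * w) * (w * J)))) * v.
Proof.
move=> lp0 ld0 v0 vw J0 J'0 /andP[GB BG] D1 D2.
pose D := cB - cBq.
have -> : expR (- (lp * cBq)) - expR (- (lp * cB)) = expR (- (lp * cB)) * (expR (lp * D) - 1).
  rewrite mulrBr -expRD mulr1; congr (expR _ - _); rewrite /D; ring.
have D0 : 0 <= D by apply: le_trans D1; rewrite !mulr_ge0 // ltW.
have ew : expR (ld * v) <= expR (ld * w) by rewrite ler_expR ler_pM2l.
split.
  rewrite -mulrA; apply: ler_pM; rewrite ?expR_ge0 //.
  - by rewrite !mulr_ge0 // ltW.
  - by rewrite ler_expR lerN2 ler_pM2l.
  - apply: (@le_trans _ _ (lp * D)).
      by rewrite -!mulrA ler_pM2l // (mulrC J') mulrA.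
    by rewrite lerBrDl; exact: expR_ge1Dx.
have -> : expR (- (lp * G)) * (lp * ld * J) *
      (expR (ld * w) * expR (lp * (ld * expR (ld * w) * (w * J)))) * v =
   expR (- (lp * G)) * (lp * (ld * expR (ld * w) * (v * J)) *
      expR (lp * (ld * expR (ld * w) * (w * J)))) by ring.
have Dle : D <= ld * expR (ld * w) * (v * J).
  apply: le_trans D2 _; rewrite ler_wpM2r ?mulr_ge0 // ler_pM2l //.
apply: ler_pM; rewrite ?expR_ge0 //.
- by rewrite subr_ge0 -expR0 ler_expR mulr_ge0 // ltW.
- by rewrite ler_expR lerN2 ler_pM2l.
apply: le_trans (expR_sub1_le _) _.
apply: ler_pM; rewrite ?expR_ge0 ?mulr_ge0 ?(ltW lp0) //.
- by rewrite ler_pM2l.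
rewrite ler_expR ler_pM2l //; apply: le_trans Dle _.
rewrite ler_wpM2l ?mulr_ge0 ?(ltW ld0) ?expR_ge0 //.
by rewrite ler_wpM2r.
Qed.

Lemma lonely_bound_cvg (ld lp J a c : R) (w : nat -> R) : w k @[k --> \oo] --> (0 : R) ->
  a * (expR (ld * w k) * expR (lp * (ld * expR (ld * w k) * (w k * J)))) * c @[k --> \oo] --> a * c.
Proof.
move=> w0.
have lw : ld * w k @[k --> \oo] --> (0 : R).
  by rewrite -[X in _ --> X](mulr0 ld); apply: cvgM; first exact: cvg_cst.
have e1 : expR (ld * w k) @[k --> \oo] --> (1 : R).
  by rewrite -[X in _ --> X](@expR0 R); exact: cvg_expR.
have -> : a * c = a * (1 * 1) * c by rewrite !mulr1.
apply: cvgM; last exact: cvg_cst.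
apply: cvgM; first exact: cvg_cst.
apply: cvgM => //.
rewrite -[X in _ --> X](@expR0 R); apply: cvg_expR.
have -> : (0 : R) = lp * (ld * 1 * (0 * J)) by ring.
apply: cvgM; first exact: cvg_cst.
apply: cvgM; first by apply: cvgM => //; exact: cvg_cst.
by apply: cvgM => //; exact: cvg_cst.
Qed.

End LonelyBounds.

(** * The mean number of isolated points and the Palm quotient *)

Section Palm.
Context (R : realType) d (Omega : measurableType d) (P : probability Omega R) (n : nat).
Variables (par : Omega -> nat -> n.-tuple R) (dau : nat -> Omega -> set (n.-tuple R)).
Variables (lp ld rd : R).
Hypotheses (n0 : (0 < n)%N) (lp0 : 0 < lp) (ld0 : 0 < ld).
Hypothesis mcp : is_matern_cluster P par dau lp ld rd.
Let Phi w := matern (par w) (fun i => dau i w).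
Let O0 := locfin par dau rd.
Let mO : measurable O0. Proof. exact: (measurable_locfin mcp). Qed.
Local Notation A := (@unitball R n).
Local Notation de := (@diam R n).

(* The mean number of points of [Phi] in the unit ball without another point of
   [Phi] within distance [r]. *)
Definition kappa (r : R) : R :=
  expR (- (lp * capG n ld rd r)) * (lp * ld * palmJ n ld rd r) * vball R n.

Section FixedRadius.
Variable r : R.
Hypothesis r0 : 0 <= r.

Let okset k (j : cellIdx n k) := [set w | lonely r j (Phi w)] `&` O0.

Let pb_sub k (j : cellIdx n k) :
  pball r j `<=` cball (vzero R n) (r + 2 * de k + enorm (corner R j)).
Proof.
move=> x xB; rewrite /cball /= vsubx0.
have -> : x = vadd (vsub x (corner R j)) (corner R j) by apply: vext => i; rewrite !vE; ring.
by rewrite (le_trans (enormD _ _)) // lerD2r ltW.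
Qed.

Let void_pball k (j : cellIdx n k) :
  measurable ([set w | Phi w `&` pball r j = set0] `&` O0) /\
  P ([set w | Phi w `&` pball r j = set0] `&` O0) =
   (expR (- (lp * capa ld rd (pball r j))))%:E.
Proof.
have := @void_Gdelta R d Omega P n par dau lp ld rd mcp ld0 (fun=> pball r j)
  (r + 2 * de k + enorm (corner R j)).
rewrite /= bigcap_const; last by exists 0%N.
apply=> [_|_|_|k' l _ x xB]; [exact: vopen_oball|exact: measurable_oball|exact: pb_sub|exact: xB].
Qed.

Let void_pballD k (j : cellIdx n k) :
  measurable ([set w | Phi w `&` (pball r j `\` gcell j) = set0] `&` O0) /\
  P ([set w | Phi w `&` (pball r j `\` gcell j) = set0] `&` O0) =
   (expR (- (lp * capa ld rd (pball r j `\` gcell j))))%:E.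
Proof.
have := @void_Gdelta R d Omega P n par dau lp ld rd mcp ld0
  (fun l => pball r j `&` ~` fcell j l) (r + 2 * de k + enorm (corner R j)).
have -> : \bigcap_l (pball r j `&` ~` fcell j l) = pball r j `\` gcell j.
  rewrite -fcell_bigcup; apply/seteqP; split=> x.
    move=> h; split; first by have [] := h 0%N Logic.I.
    by move=> [l _ xl]; have [_ ] := h l Logic.I; apply.
  by move=> [h1 h2] l _; split=> // xl; apply: h2; exists l.
apply.
- by move=> l; apply: vopenI; [exact: vopen_oball|exact: vopen_fcellC].
- move=> l; apply: measurableI; first exact: measurable_oball.
  by apply: measurableC; exact: measurable_fcell.
- by move=> l x [] /pb_sub.
- by move=> l l' ll x [h1 h2]; split=> // h3; apply: h2; apply: (fcell_mono ll).
Qed.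

Let okE k (j : cellIdx n k) : okset j =
  ([set w | Phi w `&` (pball r j `\` gcell j) = set0] `&` O0) `\`
  ([set w | Phi w `&` pball r j = set0] `&` O0).
Proof.
apply/seteqP; split=> w; first by move=> [[h1 h2] Ow]; split=> // -[].
by move=> [[h1 Ow] h2]; split=> //; split=> // h3; apply: h2.
Qed.

Let measurable_ok k (j : cellIdx n k) : measurable (okset j).
Proof. by rewrite okE; apply: measurableD; [exact: (void_pballD j).1|exact: (void_pball j).1]. Qed.

Let ok_prob k (j : cellIdx n k) : P (okset j) =
  (expR (- (lp * capa ld rd (pball r j `\` gcell j))) - expR (- (lp * capa ld rd (pball r j))))%:E.
Proof.
rewrite okE measureD; last 3 first.
- exact: (void_pballD j).1.
- exact: (void_pball j).1.
- by apply: le_lt_trans (ltry 1); apply: probability_le1; exact: (void_pballD j).1.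
rewrite EFinB; congr (_ - _)%E; first exact: (void_pballD j).2.
apply: etrans (void_pball j).2; congr (P _).
apply/seteqP; split=> w; first by move=> [].
move=> [h Ow]; split=> //; split=> //; apply/seteqP; split=> // x [px [xB _]].
by rewrite -h.
Qed.

Let Sk k := \sum_(j : cellIdx n k) fine (P (okset j)).

Let ok_bounds k (j : cellIdx n k) :
  let v := fine (vol (gcell j)) in
  expR (- (lp * capG n ld rd (r + 2 * de k))) * (lp * ld * palmJ n ld rd (r + 3 * de k)) * v
    <= fine (P (okset j)) /\ fine (P (okset j)) <=
  expR (- (lp * capG n ld rd r)) * (lp * ld * palmJ n ld rd r) *
   (expR (ld * (2 * de k) ^+ n) *
      expR (lp * (ld * expR (ld * (2 * de k) ^+ n) * ((2 * de k) ^+ n * palmJ n ld rd r)))) * v.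
Proof.
move=> v; rewrite ok_prob /=.
have d0 : 0 < de k by exact: diam_gt0.
have [h1 h2] := @capa_increment R n ld rd ld0 (corner R j) r (de k) (gcell j) d0
  (measurable_gcell j) r0 (@gcell_sub R n k j).
apply: lonely_prob_bounds => //.
- by rewrite fine_ge0 // vol_ge0.
- exact: vol_gcell_le.
- exact: palmJ_ge0.
- exact: palmJ_ge0.
- by apply: capa_oball => //; rewrite mulr_gt0.
Qed.

(** The bounds of [ok_bounds] are the volume of the cell times coefficients that do not depend on
    the cell; the volumes add up to [vball], and both coefficients converge to that of [kappa r]. *)
Let Sk_cvg : Sk k @[k --> \oo] --> kappa r.
Proof.
have rc (c : R) : 0 <= c -> (fun k => r + c * de k) @ \oo --> r.
  move=> _; rewrite -[X in _ --> X]addr0; apply: cvgD; first exact: cvg_cst.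
  rewrite -(mulr0 c); apply: cvgM; first exact: cvg_cst.
  exact: diam_cvg.
have rnd (c : R) : 0 <= c -> forall k l, (k <= l)%N -> r + c * de l <= r + c * de k.
  by move=> c0 k l kl; rewrite lerD2l ler_wpM2l // diam_nonincreasing.
have rge (c : R) : 0 <= c -> forall k, r <= r + c * de k.
  by move=> c0 k; rewrite lerDl mulr_ge0 // ltW // diam_gt0.
apply: (@squeeze_cvgr _ _ _ _
  (fun k => expR (- (lp * capG n ld rd (r + 2 * de k))) * (lp * ld * palmJ n ld rd (r + 3 * de k)) * vball R n)
  (fun k => expR (- (lp * capG n ld rd r)) * (lp * ld * palmJ n ld rd r) *
   (expR (ld * (2 * de k) ^+ n) *
      expR (lp * (ld * expR (ld * (2 * de k) ^+ n) * ((2 * de k) ^+ n * palmJ n ld rd r)))) * vball R n)).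
- apply: nearW => k; rewrite -(sum_vol_gcell R n k) !mulr_sumr; apply/andP; split;
    apply: ler_sum => j _; by have [] := ok_bounds j.
- apply: cvgM; last exact: cvg_cst; apply: cvgM.
    apply: cvg_expR; apply: (@cvgN _ R^o); apply: cvgM; first exact: cvg_cst.
    by apply: capG_cvg => //; [exact: rnd|exact: rc|exact: rge].
  apply: cvgM; first exact: cvg_cst.
  by apply: palmJ_cvg => //; [exact: rnd|exact: rc|exact: rge].
- rewrite /kappa; apply: (@lonely_bound_cvg R ld lp (palmJ n ld rd r) (expR (- (lp * capG n ld rd r)) * (lp * ld * palmJ n ld rd r)) (vball R n) (fun k => (2 * de k) ^+ n)).
  have -> : (0 : R) = (2 * 0) ^+ n by rewrite mulr0 expr0n gtn_eqF.
  apply: (@cvg_comp _ _ _ (fun k => 2 * de k) (fun x => x ^+ n)); last exact: exprn_continuous.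
  by apply: cvgM; [exact: cvg_cst|exact: diam_cvg].
Qed.

Let g k w : \bar R := (\sum_(j : cellIdx n k) (\1_(okset j) w)%:E)%E.

Let mg k : measurable_fun setT (g k).
Proof.
apply: emeasurable_sum => j; apply/measurable_EFinP; apply: measurable_indic.
exact: measurable_ok.
Qed.

Let g_ge0 k w : (0 <= g k w)%E.
Proof. by apply: sume_ge0 => j _; rewrite lee_fin. Qed.

Let gE k w : O0 w -> g k w = lonely_count (Phi w) r k.
Proof.
move=> Ow; apply: eq_bigr => j _; rewrite indicE.
case: ifPn => [/asboolP h|/asboolP h]; first by rewrite mem_set.
by rewrite memNset // => -[].
Qed.

Let finPhi w : O0 w -> forall M, finite_set (Phi w `&` cball (vzero R n) M).
Proof. by move=> Ow M; exact: (locfin_finite mcp). Qed.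

Let g_int k : (\int[P]_(w in O0) g k w = (Sk k)%:E)%E.
Proof.
rewrite ge0_integral_sum //; last first.
  by move=> j; apply: measurable_funTS; apply/measurable_EFinP; apply: measurable_indic; exact: measurable_ok.
rewrite -sumEFin; apply: eq_bigr => j _; rewrite integral_indic //.
by rewrite setIidl ?fineK ?fin_num_measure // => w [].
Qed.

Let f w := cnt (isolated (Phi w) r) A.

Let g_cvg w : O0 w -> g k w @[k --> \oo] --> f w.
Proof.
move=> Ow; apply: cvg_near_cst.
have := lonely_count_cvg n0 (finPhi Ow) r0; apply: filterS => k h.
by rewrite gE // h.
Qed.

Lemma measurable_isolated_cnt : measurable_fun O0 f.
Proof.
apply: (emeasurable_fun_cvg g); last exact: g_cvg.
by move=> k; apply: measurable_funTS.
Qed.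

Lemma isolated_integral_le : (\int[P]_(w in O0) f w <= (kappa r)%:E)%E.
Proof.
have h := fatou P mO (fun k => measurable_funTS (mg k) : measurable_fun O0 (g k)) (fun k w _ => g_ge0 k w).
have e1 : (\int[P]_(w in O0) f w = \int[P]_(w in O0) limn_einf (g^~ w))%E.
  apply: eq_integral => w /set_mem Ow; apply/esym.
  by have [] := cvg_limn_einf_sup (g_cvg Ow).
rewrite e1; apply: le_trans h _.
have c : (\int[P]_(w in O0) g k w)%E @[k --> \oo] --> (kappa r)%:E.
  under eq_fun do rewrite g_int.
  by apply/cvg_EFin; [exact: nearW|exact: Sk_cvg].
by have [-> _] := cvg_limn_einf_sup c.
Qed.

Lemma isolated_integral : P.-integrable O0 (fun w => cnt (Phi w) A) ->
  (\int[P]_(w in O0) f w = (kappa r)%:E)%E.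
Proof.
move=> iPhi.
have [] := @dominated_convergence _ _ _ P O0 mO g f (fun w => cnt (Phi w) A).
- by move=> k; apply: measurable_funTS.
- exact: measurable_isolated_cnt.
- by apply: aeW => w Ow; exact: g_cvg.
- exact: iPhi.
- apply: aeW => w k Ow; rewrite gee0_abs // gE //.
  exact: lonely_count_le.
move=> _ _ c.
have c' : (\int[P]_(w in O0) g k w)%E @[k --> \oo] --> (kappa r)%:E.
  under eq_fun do rewrite g_int.
  by apply/cvg_EFin; [exact: nearW|exact: Sk_cvg].
exact: (cvg_unique _ c c').
Qed.

End FixedRadius.

Lemma isolated0 F : isolated F 0 = F :> set (n.-tuple R).
Proof.
apply/seteqP; split=> x; first by case.
move=> Fx; split=> // y [_]; rewrite /cball /= => h.
have : dot (vsub y x) (vsub y x) == 0.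
  by rewrite -sqr_enorm (_ : enorm _ = 0) ?expr0n //; apply/eqP; rewrite eq_le h enorm_ge0.
rewrite dot_eq0 => /eqP v0; apply: vext => i.
by have := congr1 (fun u => tnth u i) v0; rewrite !vE => /eqP; rewrite subr_eq0 => /eqP.
Qed.

Let integrable_cnt : P.-integrable O0 (fun w => cnt (Phi w) A).
Proof.
apply/integrableP; split.
  by have := measurable_isolated_cnt (lexx 0); congr measurable_fun; apply/funext => w; rewrite isolated0.
apply: le_lt_trans (ltry (kappa 0)).
have := isolated_integral_le (lexx 0); apply: le_trans; rewrite le_eqVlt; apply/orP; left; apply/eqP.
by apply: eq_integral => w _; rewrite isolated0 gee0_abs // cnt_ge0.
Qed.

Lemma palm_integral r : 0 <= r ->
  (\int[P]_(w in O0) cnt (isolated (Phi w) r) A = (kappa r)%:E)%E.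
Proof. by move=> r0; exact: isolated_integral. Qed.

(* Off the locally finite event the integrand need not be measurable, so its
   integral is squeezed between those of two measurable functions. *)
Lemma ge0_integral_full (f : Omega -> \bar R) (D : set Omega) :
  measurable D -> P (~` D) = 0%E -> (forall w, 0 <= f w)%E -> measurable_fun D f ->
  (\int[P]_w f w = \int[P]_(w in D) f w)%E.
Proof.
move=> mD PD f0 mf.
have mono (f1 f2 : Omega -> \bar R) : (forall w, 0 <= f1 w)%E -> (forall w, f1 w <= f2 w)%E ->
    (\int[P]_w f1 w <= \int[P]_w f2 w)%E.
  move=> h1 h2; rewrite !ge0_integralTE //; last by move=> w; exact: le_trans (h2 w).
  apply: le_ereal_sup => _ [h hf <-]; exists h => // w.
  exact: le_trans (hf w) (h2 w).
apply/eqP; rewrite eq_le; apply/andP; split.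
  pose g w := if w \in D then f w else +oo%E.
  have mDC : measurable (~` D) by exact: measurableC.
  have mg1 : measurable_fun D g.
    by apply: eq_measurable_fun mf => w wD; rewrite /g wD.
  have mg2 : measurable_fun (~` D) g.
    apply: (@eq_measurable_fun _ _ _ _ _ (cst +oo%E)); last exact: measurable_cst.
    by move=> w /set_mem wD; rewrite /g memNset.
  apply: (@le_trans _ _ (\int[P]_w g w)%E).
    by apply: mono => // w; rewrite /g; case: ifP => // _; rewrite leey.
  rewrite -(setUv D) ge0_integral_setU //; last 3 first.
  - by apply/measurable_funU.
  - by move=> w _; rewrite /g; case: ifP.
  - by rewrite disj_set2E setICr.
  have -> : (\int[P]_(w in ~` D) g w = 0)%E.
    rewrite (eq_integral (cst +oo%E)); last by move=> w /set_mem wD; rewrite /g memNset.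
    by rewrite integral_cst //; apply: etrans (congr1 (mule +oo) PD) _; rewrite mule0.
  by rewrite adde0 (eq_integral f) // => w wD; rewrite /g wD.
rewrite integral_mkcond; apply: mono => w; rewrite patchE; by case: ifP.
Qed.

(** At radius 0 every point is isolated, so the denominator of the Palm quotient is its numerator at
    radius 0. *)
Lemma nn_cdfE r : 0 <= r -> nn_cdf P Phi r = 1 - kappa r / kappa 0.
Proof.
move=> r0; rewrite /nn_cdf.
have full s : 0 <= s -> (\int[P]_w cnt (isolated (Phi w) s) A = (kappa s)%:E)%E.
  move=> s0; rewrite -(palm_integral s0); apply: ge0_integral_full => //.
  - exact: (locfin_setC mcp).
  - by move=> w; exact: cnt_ge0.
  - exact: measurable_isolated_cnt.
have -> : (\int[P]_w cnt (Phi w) (cball (vzero R n) 1) = (kappa 0)%:E)%E.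
  by rewrite -(full 0) //; apply: eq_integral => w _; rewrite isolated0.
by rewrite -/unitball (full r r0).
Qed.

End Palm.

(** * Volume of the lens and radial integration *)

Section ShellArithmetic.
Variable R : realType.
Implicit Types r rd s t : R.

Lemma min_ge0 r rd : 0 <= r -> 0 <= rd -> 0 <= Order.min r rd.
Proof. by move=> r0 rd0; rewrite le_min r0. Qed.

(** On the line through the origin and a point at distance [s], the lens is the segment from [s - r]
    to [rd]. Its midpoint is [(s - r + rd) / 2] and its half-length [(r + rd - s) / 2]; the ball
    with these data touches both spheres from inside. *)
Lemma shell_midpoint r rd s : `|r - rd| <= s -> s <= r + rd ->
  [/\ 0 <= (s - r + rd) / 2, 0 <= s - (s - r + rd) / 2,
      (s - r + rd) / 2 + (r + rd - s) / 2 = rd &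
      s - (s - r + rd) / 2 + (r + rd - s) / 2 = r].
Proof. by rewrite ler_norml => /andP[h1 h2] h3; split; lra. Qed.

Lemma le_opp_eq0 r : 0 <= r -> r <= - r -> r = 0.
Proof. by move=> h1 h2; apply/eqP; rewrite eq_le h1 andbT; lra. Qed.

Lemma ler_sub_addl r rd s : s <= r + rd -> s - r <= rd.
Proof. by lra. Qed.

Lemma shell_thickness r rd s : rd - (s - r) = r + rd - s.
Proof. by lra. Qed.

Lemma ler_sub_of_opp r s t : - r <= t - s -> s - r <= t.
Proof. by lra. Qed.

Lemma norm_min r rd : `|r - rd| = (if r <= rd then rd - r else r - rd).
Proof. by case: leP => h; [rewrite ler0_norm ?subr_le0 // opprB|rewrite gtr0_norm // subr_gt0]. Qed.

End ShellArithmetic.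

Section RealDerivatives.
Variable R : realType.
Implicit Types (f h : R -> R) (x df dh c : R).

Lemma is_derive_pow x n : is_derive x 1 (fun z : R => z ^+ n) (n%:R * x ^+ n.-1).
Proof.
rewrite (_ : (fun z : R => z ^+ n) = (id : R -> R) ^+ n); last first.
  by apply/funext => z; elim: n => [|n IH]; rewrite ?expr0 // !exprS IH.
by apply: is_derive_eq; rewrite /GRing.scale /= mulr1.
Qed.

Lemma is_derive_mull c f x df : is_derive x 1 f df -> is_derive x 1 (fun z => c * f z) (c * df).
Proof.
move=> h; rewrite (_ : (fun z => c * f z) = (c \*: f)); last by apply/funext.
exact: is_deriveZ.
Qed.

Lemma is_derive_mul f h x df dh : is_derive x 1 f df -> is_derive x 1 h dh ->
  is_derive x 1 (fun z => f z * h z) (f x * dh + h x * df).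
Proof. by move=> d1 d2; exact: is_deriveM. Qed.

Lemma is_derive_sub f h x df dh : is_derive x 1 f df -> is_derive x 1 h dh ->
  is_derive x 1 (fun z => f z - h z) (df - dh).
Proof. by move=> d1 d2; exact: is_deriveB. Qed.

Lemma is_derive_bigsum n (f : 'I_n -> R -> R) x (df : 'I_n -> R) :
  (forall i, is_derive x 1 (f i) (df i)) ->
  is_derive x 1 (fun z => \sum_i f i z) (\sum_i df i).
Proof.
move=> h; rewrite (_ : (fun z => \sum_i f i z) = \sum_i f i); first exact: is_derive_sum.
by apply/funext => z; rewrite fct_sumE.
Qed.

End RealDerivatives.

Section Lens.
Variables (R : realType) (n : nat) (rd r : R).
Hypotheses (n0 : (0 < n)%N) (rd0 : 0 < rd) (r0 : 0 < r).
Let W := cball (vzero R n) rd.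
Let vn := vball R n.
Let beta := Order.min r rd.
Local Notation lens := (@lens R n rd r).
Implicit Type x : n.-tuple R.

Lemma lens_inner x : enorm x <= `|r - rd| -> lens x = vn * beta ^+ n.
Proof.
move=> xs; rewrite /lens -/W /beta.
have [rrd|rrd] := leP r rd.
  rewrite setIidl.
    by rewrite vol_cball ?ltW.
  move=> y; rewrite /W /cball /= vsubx0 => yx; move: xs; rewrite norm_min rrd => xs.
  have -> : y = vadd (vsub y x) x by apply: vext => i; rewrite !vE; ring.
  by apply: le_trans (enormD _ _) _; rewrite -(subrKC r rd) lerD.
rewrite setIidr; first by rewrite /W vol_cball ?ltW.
move=> y; rewrite /W /cball /= vsubx0 => yr; move: xs; rewrite norm_min (lt_geF rrd) => xs.
have -> : vsub y x = vadd y (vscale (-1) x) by apply: vext => i; rewrite !vE; ring.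
by apply: le_trans (enormD _ _) _; rewrite enormZ normrN1 mul1r -(subrKC rd r) lerD.
Qed.

(* The lens contains a ball whose diameter is its thickness. *)
Lemma lens_ge x : `|r - rd| <= enorm x -> enorm x <= r + rd ->
  vn * ((r + rd - enorm x) / 2) ^+ n <= lens x.
Proof.
move=> h1 h2; have [t0 st0 e1 e2] := shell_midpoint h1 h2.
set s := enorm x in h1 h2 t0 st0 e1 e2 *; set t := (s - r + rd) / 2 in t0 st0 e1 e2.
have u0 : 0 <= (r + rd - s) / 2 by rewrite divr_ge0 // subr_ge0.
pose c := vscale (t / s) x.
have sc : enorm c = t.
  rewrite enormZ -/s normrM ger0_norm // normfV ger0_norm ?enorm_ge0 //.
  (* At [s = 0] the quotient [t / s] is 0 by convention, and [t] between 0 and [s] is 0 as well, so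
     the center still has norm [t]. *)
  have [s0|s0] := eqVneq s 0; last by rewrite divfK.
  by rewrite s0 mulr0; move: st0 t0; rewrite s0 sub0r oppr_ge0 => a b; apply/eqP; rewrite eq_le a b.
have xc : enorm (vsub x c) = s - t.
  have -> : vsub x c = vscale (1 - t / s) x by apply: vext => i; rewrite !vE; ring.
  rewrite enormZ -/s; have [s0|s0] := eqVneq s 0.
    by rewrite s0 mulr0; move: st0 t0; rewrite s0 sub0r oppr_ge0 => a b; apply/eqP; rewrite eq_sym oppr_eq0 eq_le a b.
  have sp : 0 < s by rewrite lt_neqAle eq_sym s0 enorm_ge0.
  rewrite ger0_norm; first by rewrite mulrBl mul1r divfK.
  by rewrite subr_ge0 ler_pdivrMr // mul1r -subr_ge0.
rewrite -lee_fin /lens lens_vol -/W -(vol_cball c n0 u0); apply: measure_mono.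
- exact: measurable_cball.
- by apply: measurableI; exact: measurable_cball.
move=> y; rewrite /cball /= => yc; split; rewrite /W /cball /=.
  apply: le_trans (enorm_triangle _ c _) _; rewrite -[leRHS]e2 addrC; apply: lerD => //.
  by rewrite enorm_vsubC xc.
rewrite vsubx0; have -> : y = vadd c (vsub y c) by apply: vext => i; rewrite !vE; ring.
by apply: le_trans (enormD _ _) _; rewrite -[leRHS]e1 sc lerD2l.
Qed.

(* After an isometry moving [x] to a coordinate axis, the lens lies in a box. *)
Lemma lens_le x : enorm x <= r + rd ->
  lens x <= (2 * beta) ^+ n.-1 * (r + rd - enorm x).
Proof.
move=> h; pose i0 := Ordinal n0.
have [f [mf fK fD fN fx]] := householder i0 x.
pose s := enorm x.
pose B := cball (f x) r `&` W.
have mB : measurable B by apply: measurableI; exact: measurable_cball.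
have fB y z : f (vsub y z) = vsub (f y) (f z).
  have := fD (vsub y z) z; have -> : vadd (vsub y z) z = y by apply: vext => i; rewrite !vE; ring.
  by move=> ->; apply: vext => i; rewrite !vE; ring.
have be0 : 0 <= beta by rewrite min_ge0 // ltW.
(* Along the axis of [f x] the lens spans [s - r] to [rd]. In the other directions both centers have
   coordinate 0, so the smaller radius bounds the coordinate. *)
pose I (j : 'I_n) : set R := if j == i0 then `[(s - r), rd]%classic else `[(- beta), beta]%classic.
have mI j : measurable (I j) by rewrite /I; case: ifP.
have volI : vol (box I) = ((2 * beta) ^+ n.-1 * (r + rd - s))%:E.
  rewrite vol_box // (bigD1 i0) //= {1}/I eqxx lebesgue_measure_itv /= lte_fin.
  rewrite (eq_bigr (fun=> (2 * beta)%:E)); last first.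
    move=> j /negbTE ji; rewrite /I ji lebesgue_measure_itv /= lte_fin.
    case: ltP => hb; first by rewrite -EFinB; congr EFin; ring.
    have -> : beta = 0 by exact: le_opp_eq0.
    by rewrite mulr0.
  rewrite prodEFin prodr_const cardC1 card_ord.
  case: ltP => hs; first by rewrite -EFinB -EFinM shell_thickness mulrC.
  have e : r + rd - s = 0 by rewrite -shell_thickness; apply/eqP; rewrite eq_le subr_le0 hs subr_ge0 ler_sub_addl.
  by rewrite e mulr0 mul0e.
rewrite -lee_fin -/s -volI /lens lens_vol -/W.
have -> : cball x r `&` W = [set y | B (f y)].
  by apply/seteqP; split=> y; rewrite /B /W /cball /= !vsubx0 -fB !fN.
rewrite (vol_isometry mf mf fK fK fD fN mB); apply: measure_mono => //.
  exact: measurable_box.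
move=> y [yx yW] j; rewrite /I; rewrite /cball /= in yx; rewrite /W /cball /= vsubx0 in yW.
have := le_trans (tnth_le_enorm _ j) yx; have := le_trans (tnth_le_enorm _ j) yW.
rewrite !ler_norml => /andP[a1 a2]; rewrite vE fx tnth_mktuple => /andP[b1 b2].
case: ifPn b1 b2 => [ji|ji] b1 b2; rewrite /= in_itv /=.
  by rewrite a2 andbT ler_sub_of_opp.
by rewrite subr0 in b1 b2; rewrite -ler_norml le_min !ler_norml a1 a2 b1 b2.
Qed.

Lemma lens_outer x : r + rd < enorm x -> lens x = 0.
Proof.
move=> h; rewrite /lens (_ : _ `&` _ = set0) ?vol_set0 //.
apply/seteqP; split=> // y; rewrite /cball /= vsubx0 => -[h1 h2].
have : enorm x <= r + rd; last by rewrite leNgt h.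
have -> : x = vadd (vsub x y) y by apply: vext => i; rewrite !vE; ring.
by apply: le_trans (enormD _ _) _; rewrite enorm_vsubC lerD.
Qed.

End Lens.

(** * Integration of monotone radial functions over annuli *)

Section Radial.
Variables (R : realType) (n : nat).
Hypothesis n0 : (0 < n)%N.
Let vn := vball R n.

(* Summed over a uniform partition into [N] pieces, the bound is [O(1/N)]. *)
Lemma telescoping_const (T g : R -> R) (c D L : R) : c <= D -> 0 <= L ->
  (forall s t, c <= s -> s <= t -> t <= D -> `|T t - T s| <= (g t - g s) * (L * (t - s))) ->
  T D = T c.
Proof.
move=> cD L0 h; apply/eqP; rewrite -subr_eq0 -normr_eq0 eq_le normr_ge0 andbT.
have key N : `|T D - T c| <= (g D - g c) * (L * (D - c)) * N.+1%:R^-1.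
  pose s i := c + (D - c) * (i%:R / N.+1%:R).
  have s0 : s 0%N = c by rewrite /s mul0r mulr0 addr0.
  have sN : s N.+1 = D by rewrite /s divff // mulr1 addrC subrK.
  have smono i : s i <= s i.+1.
    by rewrite lerD2l ler_wpM2l ?subr_ge0 // ler_pM2r ?invr_gt0 // ler_nat.
  have cs i : c <= s i by rewrite lerDl mulr_ge0 ?subr_ge0 // divr_ge0.
  have sD i : (i <= N)%N -> s i.+1 <= D.
    move=> iN; rewrite -[leRHS]sN lerD2l ler_wpM2l ?subr_ge0 //.
    by rewrite ler_pM2r ?invr_gt0 // ler_nat ltnS.
  have step i : s i.+1 - s i = (D - c) * N.+1%:R^-1.
    by rewrite /s -natr1; ring.
  have -> : T D - T c = \sum_(0 <= i < N.+1) (T (s i.+1) - T (s i)).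
    by rewrite telescope_sumr // sN s0.
  rewrite big_nat; apply: le_trans (ler_norm_sum _ _ _) _.
  apply: (@le_trans _ _ (\sum_(0 <= i < N.+1 | (0 <= i < N.+1)%N) (g (s i.+1) - g (s i)) * (L * ((D - c) * N.+1%:R^-1)))).
    apply: ler_sum => i /andP[_ iN]; rewrite -(step i); apply: h => //.
    by apply: sD; rewrite -ltnS.
  by rewrite -big_nat -mulr_suml telescope_sumr // sN s0 !mulrA.
have : (g D - g c) * (L * (D - c)) * k.+1%:R^-1 @[k --> \oo] --> (0 : R).
  rewrite -[X in _ --> X](mulr0 ((g D - g c) * (L * (D - c)))).
  by apply: cvgM; [exact: cvg_cst|exact: cvg_harmonic].
by move/cvgr_to_ge; apply; apply: nearW.
Qed.

Definition annulus (c D : R) : set (n.-tuple R) := [set x | c < enorm x <= D].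

Lemma measurable_annulus c D : measurable (annulus c D).
Proof.
apply: (@measurable_comp_set _ _ _ _ (@enorm R n) `]c, D]%classic); first exact: measurable_enorm.
exact: measurable_itv.
Qed.

Lemma annulusE c D : annulus c D = cball (vzero R n) D `\` cball (vzero R n) c.
Proof.
apply/seteqP; split=> x; rewrite /annulus /cball /= vsubx0.
  by move=> /andP[h ->]; split=> //; apply/negP; rewrite -ltNge.
by move=> [-> /negP]; rewrite -ltNge => ->.
Qed.

Lemma vol_annulus c D : 0 <= c -> c <= D ->
  vol (annulus c D) = (vn * (D ^+ n - c ^+ n))%:E.
Proof.
move=> c0 cD; rewrite annulusE measureD; last 3 first.
- exact: measurable_cball.
- exact: measurable_cball.
- exact: vol_cball_lty.
rewrite setIidr; last by move=> x; rewrite /cball /= => h; exact: le_trans h cD.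
have e1 := vol_cball (vzero R n) n0 (le_trans c0 cD).
have e2 := vol_cball (vzero R n) n0 c0.
by rewrite [X in (X - _)%E]e1 [X in (_ - X)%E]e2 -EFinB mulrBr.
Qed.

Variables (g K : R -> R) (c D : R).
Hypotheses (c0 : 0 <= c) (cD : c <= D).
Hypotheses (g0 : forall s, 0 <= g s) (mg : measurable_fun setT g).
Hypothesis gmono : forall s t, c <= s -> s <= t -> t <= D -> g s <= g t.
Hypothesis cK : {within `[c, D], continuous K}.
Hypothesis dK : forall s : R, s \in `]c, D[ -> is_derive s 1 K (n%:R * s ^+ n.-1 * g s).

Let mgn (E : set (n.-tuple R)) : measurable_fun E (fun x : n.-tuple R => (g (enorm x))%:E).
Proof.
apply: measurable_funTS; apply/measurable_EFinP.
exact: (measurableT_comp mg (@measurable_enorm R n)).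
Qed.

Let Psi s : R := fine (\int[@vol R n]_(x in annulus c s) (g (enorm x))%:E)%E.

Let int_bounds s t : c <= s -> s <= t -> t <= D ->
  ((g s * (vn * (t ^+ n - s ^+ n)))%:E <= \int[@vol R n]_(x in annulus s t) (g (enorm x))%:E <=
   (g t * (vn * (t ^+ n - s ^+ n)))%:E)%E.
Proof.
move=> cs st tD; have s0 := le_trans c0 cs.
have mA := measurable_annulus s t.
have e (a : R) : ((a * (vn * (t ^+ n - s ^+ n)))%:E = \int[@vol R n]_(x in annulus s t) (cst a%:E x))%E.
  rewrite integral_cst //; apply: etrans (congr1 (mule a%:E) (esym (vol_annulus s0 st))).
  by rewrite EFinM.
rewrite !e; apply/andP; split; apply: ge0_le_integral => //.
- by move=> x _; rewrite lee_fin.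
- by move=> x /andP[sx xt]; rewrite lee_fin gmono // ?(le_trans xt) // ltW.
- by move=> x _; rewrite lee_fin.
- by move=> x /andP[sx xt]; rewrite lee_fin gmono // (le_trans cs) // ltW.
Qed.

Let int_fin s t : c <= s -> s <= t -> t <= D ->
  (\int[@vol R n]_(x in annulus s t) (g (enorm x))%:E)%E \is a fin_num.
Proof.
move=> cs st tD; have /andP[_ h] := int_bounds cs st tD.
rewrite ge0_fin_numE; last by apply: integral_ge0 => x _; rewrite lee_fin.
exact: le_lt_trans h (ltry _).
Qed.

Let PsiD s t : c <= s -> s <= t -> t <= D ->
  g s * (vn * (t ^+ n - s ^+ n)) <= Psi t - Psi s <= g t * (vn * (t ^+ n - s ^+ n)).
Proof.
move=> cs st tD; have f1 := int_fin (lexx c) cs (le_trans st tD).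
have f2 := int_fin (lexx c) (le_trans cs st) tD.
rewrite -!lee_fin EFinB !fineK //.
have -> : annulus c t = annulus c s `|` annulus s t.
  apply/seteqP; split=> x; rewrite /annulus /=.
    move=> /andP[h1 h2]; have [xs|xs] := leP (enorm x) s; first by left; rewrite h1.
    by right.
  case=> /andP[h1 h2]; first by rewrite h1 (le_trans h2).
  by rewrite h2 (le_lt_trans cs).
rewrite ge0_integral_setU;
  [|exact: measurable_annulus|exact: measurable_annulus|exact: mgn|by move=> x _; rewrite lee_fin|]; last first.
  rewrite disj_set2E; apply/eqP/seteqP; split=> // x [/andP[_ h1] /andP[h2 _]].
  by have := lt_le_trans h2 h1; rewrite ltxx.
by rewrite addeAC subee // add0e; exact: int_bounds.
Qed.

(** The mean value theorem for [K z - a * z ^+ n], with [a] the value of [g] at either end; the sign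
    [sgn] treats the two inequalities at once. *)
Let KD s t : c <= s -> s <= t -> t <= D ->
  g s * (t ^+ n - s ^+ n) <= K t - K s <= g t * (t ^+ n - s ^+ n).
Proof.
move=> cs st tD.
have [->|stn] := eqVneq s t; first by rewrite !subrr !mulr0 lexx.
have slt : s < t by rewrite lt_neqAle stn.
have key (a : R) (sgn : R) :
  (forall z, z \in `]s, t[ -> 0 <= sgn * (g z - a)) ->
  0 <= sgn * (K t - K s - a * (t ^+ n - s ^+ n)).
  move=> hz; pose H z := K z - a * z ^+ n.
  have dH z : z \in `]s, t[ -> is_derive z 1 H (n%:R * z ^+ n.-1 * g z - a * (n%:R * z ^+ n.-1)).
    move=> zst; have zcD : z \in `]c, D[.
      move: zst; rewrite !in_itv /= => /andP[h1 h2].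
      by rewrite (le_lt_trans cs h1) (lt_le_trans h2 tD).
    have d1 := dK zcD.
    have d2 := is_derive_mull a (is_derive_pow z n).
    exact: is_derive_sub.
  have cH : {within `[s, t], continuous H}.
    have cK' : {within `[s, t], continuous K}.
      apply: continuous_subspaceW cK => z /=; rewrite !in_itv /= => /andP[h1 h2].
      by rewrite (le_trans cs h1) (le_trans h2 tD).
    have c2 : {within `[s, t], continuous (fun z : R => a * z ^+ n)}.
      apply: continuous_subspaceT => z; apply: cvgM; [exact: cvg_cst|exact: exprn_continuous].
    by move=> z; apply: cvgB; [exact: cK'|exact: c2].
  have [z zst e] := MVT slt dH cH.
  have -> : K t - K s - a * (t ^+ n - s ^+ n) = H t - H s by rewrite /H; ring.
  rewrite e; have -> : n%:R * z ^+ n.-1 * g z - a * (n%:R * z ^+ n.-1) =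
    n%:R * z ^+ n.-1 * (g z - a) by ring.
  have z0 : 0 <= z by move: zst; rewrite in_itv /= => /andP[h _]; rewrite ltW // (le_lt_trans _ h) // (le_trans c0).
  have -> : sgn * (n%:R * z ^+ n.-1 * (g z - a) * (t - s)) = n%:R * z ^+ n.-1 * (t - s) * (sgn * (g z - a)) by ring.
  by apply: mulr_ge0; [rewrite !mulr_ge0 ?subr_ge0 ?exprn_ge0|exact: hz].
have h1 := key (g s) 1; have h2 := key (g t) (-1).
apply/andP; split.
  rewrite -subr_ge0 -[leRHS]mul1r; apply: h1 => z; rewrite in_itv /= => /andP[a1 a2].
  by rewrite mul1r subr_ge0 gmono // ?ltW // (lt_le_trans a2).
rewrite -subr_le0 -oppr_ge0 -mulN1r; apply: h2 => z; rewrite in_itv /= => /andP[a1 a2].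
by rewrite mulN1r oppr_ge0 subr_le0 gmono // ?ltW // (le_lt_trans cs).
Qed.

(** This stands in for polar coordinates. On each subinterval both [Psi] and [vn * K] grow by an
    amount between [g s] and [g t] times the volume of the annulus, so their difference satisfies
    [telescoping_const]. The derivative of [K] is asked only inside the interval because [Klo] is
    differentiated only for [s < D]. *)
Lemma radial_integral :
  (\int[@vol R n]_(x in annulus c D) (g (enorm x))%:E = (vn * (K D - K c))%:E)%E.
Proof.
have vn0 : 0 < vn by exact: vball_gt0.
rewrite -[LHS]fineK ?int_fin //; congr EFin; rewrite -/(Psi D).
have Psi0 : Psi c = 0.
  rewrite /Psi (_ : annulus c c = set0) ?integral_set0 //.
  by apply/seteqP; split=> // x /andP[h1 h2]; have := lt_le_trans h1 h2; rewrite ltxx.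
have D0 := le_trans c0 cD.
have := @telescoping_const (fun s => Psi s - vn * (K s - K c)) g c D (vn * (n%:R * D ^+ n.-1)) cD.
rewrite Psi0 !subrr mulr0 subrr => h; apply/eqP; rewrite -subr_eq0; apply/eqP; apply: h.
  by rewrite !mulr_ge0 ?(ltW vn0) ?exprn_ge0.
move=> s t cs st tD.
have -> : Psi t - vn * (K t - K c) - (Psi s - vn * (K s - K c)) =
  (Psi t - Psi s) - vn * (K t - K s) by ring.
have /andP[p1 p2] := PsiD cs st tD; have /andP[k1 k2] := KD cs st tD.
have s0 := le_trans c0 cs; have t0 := le_trans s0 st.
have dn : t ^+ n - s ^+ n <= n%:R * D ^+ n.-1 * (t - s).
  rewrite subrXX mulrC; apply: ler_wpM2r; first by rewrite subr_ge0.
  have -> : n%:R * D ^+ n.-1 = \sum_(i < n) D ^+ n.-1 by rewrite sumr_const card_ord mulr_natl.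
  apply: ler_sum => i _.
  have -> : D ^+ n.-1 = D ^+ (n.-1 - i) * D ^+ i by rewrite -exprD subnK // -ltnS prednK.
  have sD := le_trans st tD.
  by apply: ler_pM; rewrite ?exprn_ge0 //; apply: lerXn2r; rewrite ?nnegrE.
have k1' : vn * (g s * (t ^+ n - s ^+ n)) <= vn * (K t - K s) by rewrite ler_pM2l.
have k2' : vn * (K t - K s) <= vn * (g t * (t ^+ n - s ^+ n)) by rewrite ler_pM2l.
apply: (@le_trans _ _ ((g t - g s) * (vn * (t ^+ n - s ^+ n)))).
  rewrite ler_norml; apply/andP; split.
    rewrite lerBrDr; apply: le_trans p1; apply: le_trans (lerD (lexx _) k2') _.
    by rewrite le_eqVlt; apply/orP; left; apply/eqP; ring.
  rewrite lerBlDr; apply: le_trans p2 _; apply: le_trans (lerD (lexx _) k1').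
  by rewrite le_eqVlt; apply/orP; left; apply/eqP; ring.
rewrite ler_wpM2l ?subr_ge0 ?gmono // -mulrA; apply: ler_wpM2l; first exact: ltW.
exact: dn.
Qed.

End Radial.

(** * Closed forms *)

Section LowerGamma.
Variable R : realType.
Local Notation leb := (@lebesgue_measure R).
Implicit Types s x t : R.

Let phi s t : R := t `^ (s - 1) * expR (- t).

Lemma phi_ge0 s t : 0 <= phi s t.
Proof. by rewrite mulr_ge0 ?powR_ge0 ?expR_ge0. Qed.

Lemma measurable_phi s : measurable_fun setT (phi s).
Proof.
apply: measurable_funM; first exact: (@measurable_powR R (s - 1)).
by apply: (measurableT_comp (@measurable_expR R)).
Qed.

Lemma continuous_powR_gt0 s t : 0 < t -> {for t, continuous (fun u : R => u `^ s)}.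
Proof.
move=> t0; apply: differentiable_continuous; apply/derivable1_diffP.
by have [] := is_derive1_powR s t0.
Qed.

Lemma integral_powR_le s e x : 0 < s -> 0 < e -> e < x ->
  (\int[leb]_(t in `[e, x]) (t `^ (s - 1))%:E <= (x `^ s / s)%:E)%E.
Proof.
move=> s0 e0 ex; have x0 := lt_trans e0 ex.
have dF t : 0 < t -> is_derive t 1 (fun u : R => s^-1 * u `^ s) (t `^ (s - 1)).
  move=> t0; have := is_derive_mull s^-1 (is_derive1_powR s t0).
  by rewrite mulKf // gt_eqF.
have cF t : 0 < t -> {for t, continuous (fun u : R => s^-1 * u `^ s)}.
  by move=> t0; apply: differentiable_continuous; apply/derivable1_diffP; have [] := dF t t0.
rewrite (@continuous_FTC2 R _ (fun t => s^-1 * t `^ s)) //.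
- rewrite -EFinB lee_fin -mulrBr mulrC ler_pM2r ?invr_gt0 // lerBlDr lerDl; exact: powR_ge0.
- apply: continuous_in_subspaceT => t /set_mem; rewrite /= in_itv /= => /andP[et _].
  apply: continuous_powR_gt0; exact: lt_le_trans et.
- split.
  + by move=> t; rewrite in_itv /= => /andP[et _]; have [] := dF t (lt_trans e0 et).
  + exact: cvg_at_right_filter (cF e e0).
  + exact: cvg_at_left_filter (cF x x0).
- move=> t; rewrite in_itv /= => /andP[et _]; rewrite derive1E.
  by have [_] := dF t (lt_trans e0 et).
Qed.

(** For [s < 1] the integrand is unbounded at 0, so the comparison with the power is made away from
    0 and passed to the limit through the increasing intervals [F k]. *)
Lemma integral_phi_le s x : 0 < s -> 0 < x ->
  (\int[leb]_(t in `[0%R, x]) (phi s t)%:E <= (x `^ s / s)%:E)%E.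
Proof.
move=> s0 x0.
rewrite -integral_itv_obnd_cbnd; last by apply/measurable_EFinP; apply: measurable_funTS; exact: measurable_phi.
pose e (k : nat) : R := x / k.+2%:R.
have e0 k : 0 < e k by rewrite divr_gt0.
have ex k : e k < x by rewrite /e ltr_pdivrMr // ltr_pMr // ltr1n.
pose F k : set R := `[e k, x]%classic.
have FE : `]0%R, x]%classic = \bigcup_k F k.
  apply/seteqP; split=> t; rewrite /F /= ?in_itv /=.
    move=> /andP[t0 tx]; exists (Num.Def.truncn (x / t)) => //=; rewrite in_itv /= tx andbT.
    rewrite /e ler_pdivrMr // mulrC -ler_pdivrMr // (le_trans (ltW (truncnS_gt _))) // ler_nat.
    by rewrite leqnSn.
  by move=> [k _ /=]; rewrite !in_itv /= => /andP[h1 ->]; rewrite (lt_le_trans (e0 k) h1).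
have mphi D : measurable_fun D (fun t => (phi s t)%:E).
  by apply/measurable_EFinP; apply: measurable_funTS; exact: measurable_phi.
have c : (\int[leb]_(t in F k) (phi s t)%:E)%E @[k --> \oo] --> (\int[leb]_(t in `]0%R, x]) (phi s t)%:E)%E.
  rewrite FE; apply: ge0_nondecreasing_set_cvg_integral => //.
  - move=> k l kl; apply/subsetPset => t; rewrite /F /= !in_itv /= => /andP[h1 ->].
    rewrite andbT; apply: le_trans h1; rewrite /e ler_pM2l // lef_pV2 ?posrE //.
    by rewrite ler_nat !ltnS.
  - by move=> k; rewrite /F.
  - by move=> k; exact: mphi.
  - by move=> k t _; rewrite lee_fin phi_ge0.
apply: (cvge_to_le c); apply: nearW => k.
apply: le_trans (integral_powR_le s0 (e0 k) (ex k)); apply: ge0_le_integral.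
- by rewrite /F.
- by move=> t _; rewrite lee_fin phi_ge0.
- exact: mphi.
- by apply/measurable_EFinP; apply: measurable_funTS; exact: (@measurable_powR R (s - 1)).
- move=> t; rewrite /F /= in_itv /= => /andP[h1 _]; rewrite lee_fin ler_piMr ?powR_ge0 //.
  by rewrite expR_le1 oppr_le0 ltW // (lt_le_trans (e0 k)).
Qed.

Lemma lgamma_le s x : 0 < s -> 0 < x -> 0 <= lgamma s x <= x `^ s / s.
Proof.
move=> s0 x0; have h := integral_phi_le s0 x0.
have i0 : (0 <= \int[leb]_(t in `[0%R, x]) (phi s t)%:E)%E.
  by apply: integral_ge0 => t _; rewrite lee_fin phi_ge0.
rewrite /lgamma fine_ge0 //= -lee_fin fineK // ge0_fin_numE //.
exact: le_lt_trans h (ltry _).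
Qed.

Lemma lgamma_le0 s x : x <= 0 -> lgamma s x = 0.
Proof.
rewrite le_eqVlt => /predU1P[->|x0].
  by rewrite /lgamma set_itv1 integral_set1.
by rewrite /lgamma set_itv_ge ?integral_set0 // bnd_simp -ltNge.
Qed.

Lemma is_derive_lgamma s x : 0 < s -> 0 < x -> is_derive x 1 (lgamma s) (phi s x).
Proof.
move=> s0 x0.
have x1 : x < x + 1 by rewrite ltrDl.
have int : leb.-integrable `[0%R, x + 1] (EFin \o phi s).
  apply/integrableP; split.
    by apply/measurable_EFinP; apply: measurable_funTS; exact: measurable_phi.
  have := integral_phi_le s0 (lt_trans x0 x1) => /le_lt_trans -/(_ _ (ltry _)).
  by apply: le_lt_trans; rewrite le_eqVlt; apply/orP; left; apply/eqP;
    apply: eq_integral => t _; rewrite /= ger0_norm ?phi_ge0.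
have cphi : {for x, continuous (phi s)}.
  apply: cvgM; first exact: continuous_powR_gt0.
  apply: (@continuous_comp R R R -%R expR); first exact: opp_continuous.
  exact: continuous_expR.
have [d1 d2] := continuous_FTC1_closed x1 int x0 cphi.
split; first exact: d1.
by rewrite -derive1E; exact: d2.
Qed.

(** At 0, where the derivative may blow up, continuity comes from the bound [y ^ s / s] on the
    right; at arguments up to 0 the function vanishes, its domain of integration being null or
    empty. *)
Lemma continuous_lgamma s : 0 < s -> continuous (lgamma s).
Proof.
move=> s0 x; have [x0|x0|->] := ltgtP x 0.
- apply: (@near_cst_continuous _ _ 0); near=> y; rewrite lgamma_le0 // ltW //.
  near: y; exact: lt_nbhsl.
- by apply: differentiable_continuous; apply/derivable1_diffP; have [] := is_derive_lgamma s0 x0.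
apply/left_right_continuousP; split; rewrite lgamma_le0 //.
  apply: cvg_near_cst; near=> y; rewrite lgamma_le0 //; near: y; exact: nbhs_left_le.
have c : (y `^ s / s) @[y --> (0:R)^'+] --> (0 : R).
  rewrite -[X in _ --> X](mul0r s^-1); apply: cvgM; last exact: cvg_cst.
  exact: powR_cvg0.
apply: (@squeeze_cvgr _ _ _ _ (fun=> 0) (fun y => y `^ s / s)) => //; last exact: cvg_cst.
near=> y; apply: lgamma_le => //; near: y; exact: nbhs_right_gt.
Unshelve. all: by end_near. Qed.

End LowerGamma.

Section Antiderivatives.
Variables (R : realType) (n : nat).
Hypothesis n0 : (0 < n)%N.
Implicit Types a b D s : R.

(* Iterated integration by parts. *)
Definition Kup a D s : R := \sum_(k < n) (-1) ^+ (n - 1 - k) * (n`!%:R / k`!%:R) * a ^- (n - k) *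
  (expR (- (a * (D - s))) * s ^+ k).

Lemma is_derive_Kup a D s : 0 < a ->
  is_derive s 1 (Kup a D) (n%:R * s ^+ n.-1 * expR (- (a * (D - s)))).
Proof.
move=> a0.
have de : is_derive s 1 (fun z => expR (- (a * (D - z)))) (a * expR (- (a * (D - s)))).
  have -> : (fun z => expR (- (a * (D - z)))) = expR \o (fun z => a * z - a * D).
    by apply/funext => z /=; congr expR; ring.
  have -> : - (a * (D - s)) = a * s - a * D by ring.
  rewrite [a * expR _]mulrC; apply: is_derive1_comp.
  have := is_derive_sub (is_derive_mull a (is_derive_id s (1 : R))) (is_derive_cst (a * D) s (1 : R)).
  by rewrite mulr1 subr0.
pose coef k : R := (-1) ^+ (n - 1 - k) * (n`!%:R / k`!%:R) * a ^- (n - k).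
have dt (k : 'I_n) := is_derive_mull (coef k) (is_derive_mul de (is_derive_pow s k)).
have ds := is_derive_bigsum dt.
apply: (is_derive_eq (f := Kup a D) ds).
clear ds dt.
set E := expR _.
(* In the product rule [v k] comes from differentiating the exponential and [u k] from the power.
   The alternating factorial coefficients make [u k.+1] cancel [v k]; [u 0] is 0, and the last [v],
   equal to [n * s ^ (n - 1)], survives. *)
pose v k : R := coef k * a * s ^+ k.
pose u k : R := coef k * (k%:R * s ^+ k.-1).
transitivity ((\sum_(k < n) (u k + v k)) * E).
  by rewrite mulr_suml; apply: eq_bigr => k _; rewrite /u /v; ring.
congr (_ * _); rewrite big_split /=; case: n n0 @coef @v @u => [|m] // _ coef v u.
rewrite big_ord_recl /= {1}/u mul0r mulr0 add0r [X in _ + X]big_ord_recr /= addrA.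
rewrite -big_split big1 /=; last first.
  move=> k _; rewrite /u /v /coef /bump /= add1n.
  have km := ltn_ord k.
  have -> : (m.+1 - 1 - k = (m.+1 - 1 - k.+1).+1)%N by rewrite subn1 /= -subSn // subSS.
  have -> : (m.+1 - k = (m.+1 - k.+1).+1)%N by rewrite -subSn // ltnW.
  rewrite (factS k) natrM [(-1) ^+ _.+1]exprS [a ^+ _.+1]exprS.
  have h1 : k.+1%:R != 0 :> R by rewrite pnatr_eq0.
  have h2 : k`!%:R != 0 :> R by rewrite pnatr_eq0 -lt0n fact_gt0.
  have h3 : a != 0 by rewrite gt_eqF.
  have h4 : a ^+ (m.+1 - k.+1) != 0 by rewrite expf_neq0.
  move: h1 h2 h3 h4; move: (k.+1%:R) (k`!%:R) (a ^+ (_ - _)) => k1 k2 a1 h1 h2 h3 h4.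
  by field; rewrite h1 h2 h3 h4.
rewrite add0r /v /coef subn1 subnn expr0 mul1r subSnn expr1 factS natrM.
have h2 : m`!%:R != 0 :> R by rewrite pnatr_eq0 -lt0n fact_gt0.
have h3 : a != 0 by rewrite gt_eqF.
move: h2 h3; move: (m.+1%:R) (m`!%:R) => k1 k2 h2 h3; field; by rewrite h2 h3.
Qed.

(* Binomial expansion of [s ^+ n.-1] around [D], then the substitution
   [t = b * (D - s) ^+ n]. *)
Definition Klo b D s : R := - \sum_(i < n) ('C(n - 1, i)%:R * (-1) ^+ i * D ^+ (n - 1 - i) *
  (b^-1) `^ (i.+1%:R / n%:R)) * lgamma (i.+1%:R / n%:R) (b * (D - s) ^+ n).

Lemma continuous_bigsum (I : finType) (F : I -> R -> R) :
  (forall i, continuous (F i)) -> continuous (fun z => \sum_i F i z).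
Proof.
move=> h; have := @continuous_big R^o I +%R 0 predT (@add_continuous R^o) R (index_enum I) F; apply => i _; exact: h.
Qed.

Lemma succ_ratio_gt0 (i : nat) : 0 < i.+1%:R / n%:R :> R.
Proof. by rewrite divr_gt0 // ltr0n. Qed.

Lemma continuous_Klo b D : continuous (Klo b D).
Proof.
move=> s; apply: (@cvgN _ R^o); 
have : forall i : 'I_n, continuous (fun z => ('C(n - 1, i)%:R * (-1) ^+ i * D ^+ (n - 1 - i) *
  (b^-1) `^ (i.+1%:R / n%:R)) * lgamma (i.+1%:R / n%:R) (b * (D - z) ^+ n)); last first.
  by move/continuous_bigsum; exact.
move=> i {}s.
apply: cvgM; first exact: cvg_cst.
apply: (@continuous_comp R R R (fun z => b * (D - z) ^+ n) (lgamma _)); last exact: continuous_lgamma (succ_ratio_gt0 i) _.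
apply: cvgM; first exact: cvg_cst.
apply: (@continuous_comp R R R (fun z => D - z) (fun z => z ^+ n)); last exact: exprn_continuous.
by apply: cvgB; [exact: cvg_cst|exact: cvg_id].
Qed.

Lemma is_derive_Klo b D s : 0 < b -> s < D ->
  is_derive s 1 (Klo b D) (n%:R * s ^+ n.-1 * expR (- (b * (D - s) ^+ n))).
Proof.
move=> b0 sD; have ds : 0 < D - s by rewrite subr_gt0.
have X0 : 0 < b * (D - s) ^+ n by rewrite mulr_gt0 // exprn_gt0.
have dX : is_derive s 1 (fun z => b * (D - z) ^+ n) (- (b * (n%:R * (D - s) ^+ n.-1))).
  have dD : is_derive s 1 (fun z => D - z) (-1).
    have := is_derive_sub (is_derive_cst D s (1 : R)) (is_derive_id s (1 : R)).
    by rewrite sub0r.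
  have h : is_derive s 1 ((fun z => z ^+ n) \o (fun z => D - z)) (n%:R * (D - s) ^+ n.-1 * (-1)).
    by apply: is_derive1_comp; exact: is_derive_pow.
  by apply: (is_derive_eq (is_derive_mull b h)); ring.
have dg (i : 'I_n) : is_derive s 1 (fun z => lgamma (i.+1%:R / n%:R) (b * (D - z) ^+ n))
    ((b * (D - s) ^+ n) `^ (i.+1%:R / n%:R - 1) * expR (- (b * (D - s) ^+ n)) * - (b * (n%:R * (D - s) ^+ n.-1))).
  exact: (@is_derive1_comp _ (lgamma (i.+1%:R / n%:R)) (fun z => b * (D - z) ^+ n) s _ _ (is_derive_lgamma (succ_ratio_gt0 i) X0) dX).
pose co (i : 'I_n) : R := 'C(n - 1, i)%:R * (-1) ^+ i * D ^+ (n - 1 - i) * (b^-1) `^ (i.+1%:R / n%:R).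
have := is_derive_mull (-1) (is_derive_bigsum (fun i => is_derive_mull (co i) (dg i))).
rewrite (_ : (fun z => -1 * _) = Klo b D); last by apply/funext => z; rewrite mulN1r.
move=> dk; apply: (is_derive_eq dk); rewrite mulN1r -sumrN.
(* The chain rule gives the exponents [(i + 1) / n - 1]; together with the inner derivative each
   term reduces to the integer power [(D - s) ^ i]. The sum is then the binomial expansion of
   [(D - (D - s)) ^ (n - 1)]. *)
transitivity (\sum_(i < n) n%:R * expR (- (b * (D - s) ^+ n)) *
   (('C(n - 1, i)%:R * D ^+ (n - 1 - i) * (- (D - s)) ^+ i))).
  apply: eq_bigr => i _; rewrite /co.
  have e : (b * (D - s) ^+ n) `^ (i.+1%:R / n%:R - 1) * (b * (D - s) ^+ n.-1) *
      (b^-1) `^ (i.+1%:R / n%:R) = (D - s) ^+ i.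
    have -> : b * (D - s) ^+ n.-1 = (b * (D - s) ^+ n) / (D - s).
      by rewrite -[in RHS](prednK n0) exprS /=; field; rewrite gt_eqF.
    set X := b * (D - s) ^+ n in X0 *.
    have -> : X `^ (i.+1%:R / n%:R - 1) * (X / (D - s)) = X `^ (i.+1%:R / n%:R) / (D - s).
      by rewrite mulrA; congr (_ / _); rewrite [LHS]mulrC mulr_powRB1 ?succ_ratio_gt0 ?(ltW X0).
    rewrite mulrAC -powRM ?invr_ge0 ?(ltW b0) ?(ltW X0) //.
    have -> : X / b = (D - s) ^+ n by rewrite /X mulrAC divff ?mul1r // gt_eqF.
    rewrite -(powR_mulrn n (ltW ds)) -powRrM [n%:R * _]mulrC divfK; last by rewrite pnatr_eq0 -lt0n.
    by rewrite (powR_mulrn _ (ltW ds)) exprS mulrAC divff ?mul1r // gt_eqF.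
  rewrite [(- (D - s)) ^+ _]exprNn -e; ring.
rewrite -mulr_sumr.
have -> : \sum_(i < n) 'C(n - 1, i)%:R * D ^+ (n - 1 - i) * (- (D - s)) ^+ i = s ^+ n.-1.
  rewrite -[X in _ = X ^+ _](subKr D) exprDn -subn1; case: n n0 => // m _; rewrite subn1 /=.
  by apply: eq_bigr => i _; rewrite -[RHS]mulr_natl mulrA.
ring.
Qed.

End Antiderivatives.

Section ShellBounds.
Variable R : realType.
Implicit Types r rd c D u v w x y e k : R.

Lemma shell_width r rd : r + rd - `|r - rd| = 2 * Order.min r rd.
Proof. by rewrite norm_min; case: (leP r rd) => h; lra. Qed.

Lemma shell_le r rd : 0 <= r -> 0 <= rd -> `|r - rd| <= r + rd.
Proof. by move=> r0 rd0; rewrite ler_norml; apply/andP; split; lra. Qed.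

Lemma shell_le_rd r rd : 0 <= r -> r <= 2 * rd -> `|r - rd| <= rd.
Proof. by move=> r0 rd0; rewrite ler_norml; apply/andP; split; lra. Qed.

Lemma shell_far r rd : 0 < rd -> 2 * rd < r -> rd <= `|r - rd| /\ Order.min r rd = rd.
Proof.
move=> rd0 h; have h1 : rd < r by lra.
split; first by rewrite gtr0_norm ?subr_gt0 //; lra.
by rewrite min_r // ltW.
Qed.

End ShellBounds.

(** * Bounds on the integral of [exp (- ld * lens)] over centered balls *)

Section BallIntegral.
Variables (R : realType) (n : nat) (ld rd r : R).
Hypotheses (n0 : (0 < n)%N) (ld0 : 0 < ld) (rd0 : 0 < rd) (r0 : 0 < r).
Let vn := vball R n.
Let vn0 : 0 < vn. Proof. exact: vball_gt0. Qed.
Let beta := Order.min r rd.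
Let be0 : 0 < beta. Proof. by rewrite lt_min r0. Qed.
Let c := `|r - rd|.
Let D := r + rd.
Let c0 : 0 <= c. Proof. exact: normr_ge0. Qed.
Let D0 : 0 <= D. Proof. by rewrite addr_ge0 // ltW. Qed.
(** The rates of the two comparison exponentials: at distance [s] from the origin, between [c] and
    [D], [ld * lens] is at most [a * (D - s)] and at least [b * (D - s) ^ n]. *)
Let a := ld * 2 ^+ (n - 1) * beta ^+ (n - 1).
Let a0 : 0 < a. Proof. by rewrite !mulr_gt0 // exprn_gt0. Qed.
Let b := ld * vn * (2 ^+ n)^-1.
Let b0 : 0 < b. Proof. by rewrite !mulr_gt0 // invr_gt0 exprn_gt0. Qed.
Let h (x : n.-tuple R) := expR (- (ld * @lens R n rd r x)).
Let ball t := cball (vzero R n) t.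

(** One function serves both factors of the Palm formula: [t = r + rd] gives the capacity, through
    [capG_ball_exp], and [t = rd] gives [palmJ]. *)
Definition ball_exp (t : R) : R := fine (\int[@vol R n]_(x in ball t) (h x)%:E)%E.

Let mh A : measurable_fun A (fun x => (h x)%:E).
Proof. by apply: measurable_funTS; apply/measurable_EFinP; exact: measurable_exp_lens. Qed.

Let h0 x : (0 <= (h x)%:E)%E. Proof. by rewrite lee_fin expR_ge0. Qed.
Let h1 x : h x <= 1. Proof. exact: exp_lens_le1. Qed.

Lemma ball_expE t : (ball_exp t)%:E = (\int[@vol R n]_(x in ball t) (h x)%:E)%E.
Proof.
rewrite fineK // ge0_fin_numE; last exact: integral_ge0.
apply: le_lt_trans (vol_cball_lty n t).
rewrite -[leRHS]mul1e -integral_cst; last exact: measurable_cball.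
apply: ge0_le_integral => //; first exact: measurable_cball.
by move=> x _; rewrite lee_fin.
Qed.

Lemma capG_ball_exp : capG n ld rd r = vn * D ^+ n - ball_exp D.
Proof.
apply/eqP; rewrite eq_sym subr_eq -eqe EFinD ball_expE.
have e1 : (capG n ld rd r)%:E = (\int[@vol R n]_(x in ball D) (1 - h x)%:E)%E.
  rewrite /capG /capa (@integral_relint _ _ _ rd ld0 _ r).
  - rewrite [RHS]integral_mkcond; apply: eq_integral => x _; rewrite patchE lensE.
    case: ifPn => // /negP xD; rewrite lens_outer // ?mulr0 ?oppr0 ?expR0 ?subrr //.
    by rewrite ltNge; apply/negP => xr; apply: xD; apply/mem_set; rewrite /ball /cball /= vsubx0.
  - by apply: measurable_addpre; exact: measurable_cball.
  - exact: addpre_near.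
have mB : measurable (ball D) by exact: measurable_cball.
have m1 : measurable_fun (ball D) (fun x => (1 - h x)%:E).
  apply/measurable_EFinP; apply: measurable_funB; first exact: measurable_cst.
  by apply/measurable_EFinP; exact: mh.
rewrite e1 -ge0_integralD //; last by move=> x _; rewrite lee_fin subr_ge0.
rewrite (eq_integral (cst 1%:E)); last by move=> x _; rewrite -EFinD subrK.
rewrite integral_cst // mul1e; apply/eqP; exact/esym/(vol_cball (vzero R n) n0 D0).
Qed.

Let ball_split t : c <= t -> t <= D ->
  (ball_exp t)%:E =
  ((expR (- (ld * vn * beta ^+ n)) * (vn * c ^+ n))%:E + \int[@vol R n]_(x in @annulus R n c t) (h x)%:E)%E.
Proof.
move=> ct tD; rewrite ball_expE.
have -> : ball t = ball c `|` @annulus R n c t.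
  apply/seteqP; split=> x; rewrite /ball /annulus /cball /= vsubx0.
    by move=> xt; have [xc|xc] := leP (enorm x) c; [left|right].
  by case=> [/le_trans|/andP[]//]; exact.
rewrite ge0_integral_setU //;
  [|exact: measurable_cball|exact: measurable_annulus|]; last first.
  rewrite disj_set2E; apply/eqP/seteqP; split=> // x [].
  by rewrite /ball /cball /annulus /= vsubx0 => h2 /andP[h3 _]; have := lt_le_trans h3 h2; rewrite ltxx.
congr (_ + _)%E.
rewrite (eq_integral (cst (expR (- (ld * vn * beta ^+ n)))%:E)).
  rewrite integral_cst; last exact: measurable_cball.
  by apply: etrans (congr1 (mule _) (vol_cball (vzero R n) n0 c0)) _; rewrite -EFinM.
move=> x /set_mem; rewrite /ball /cball /= vsubx0 => xc.
by rewrite /h lens_inner // mulrA.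
Qed.

Let mcomp (f : R -> R) : continuous f -> measurable_fun setT f.
Proof. exact: continuous_measurable_fun. Qed.

Let gup s := expR (- (a * (D - s))).
Let glo s := expR (- (b * (D - s) ^+ n)).

Let cgup : continuous gup.
Proof.
move=> s; apply: (@continuous_comp R R R (fun s => - (a * (D - s))) expR); last exact: continuous_expR.
apply: (@cvgN _ R^o); apply: cvgM; first exact: cvg_cst.
by apply: cvgB; [exact: cvg_cst|exact: cvg_id].
Qed.

Let cglo : continuous glo.
Proof.
move=> s; apply: (@continuous_comp R R R (fun s => - (b * (D - s) ^+ n)) expR); last exact: continuous_expR.
apply: (@cvgN _ R^o); apply: cvgM; first exact: cvg_cst.
apply: (@continuous_comp R R R (fun z => D - z) (fun z => z ^+ n)); last exact: exprn_continuous.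
by apply: cvgB; [exact: cvg_cst|exact: cvg_id].
Qed.

Let annulus_up t : c <= t -> t <= D ->
  ((vn * (Kup n a D t - Kup n a D c))%:E <= \int[@vol R n]_(x in @annulus R n c t) (h x)%:E)%E.
Proof.
move=> ct tD.
have <- : (\int[@vol R n]_(x in @annulus R n c t) (gup (enorm x))%:E = (vn * (Kup n a D t - Kup n a D c))%:E)%E; last first.
  apply: ge0_le_integral => //.
  + exact: measurable_annulus.
  + by move=> x _; rewrite lee_fin expR_ge0.
  + apply: measurable_funTS; apply/measurable_EFinP.
    by apply: measurableT_comp; [exact: mcomp|exact: measurable_enorm].
  + move=> x /andP[cx xt]; rewrite lee_fin ler_expR lerN2.
    apply: le_trans (ler_wpM2l (ltW ld0) (lens_le n0 rd0 r0 (le_trans xt tD))) _.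
    by rewrite /a subn1 exprMn !mulrA.
apply: radial_integral => //.
- by move=> s; exact: expR_ge0.
- exact: mcomp.
- by move=> s u _ su _; rewrite ler_expR lerN2 ler_pM2l // lerD2l lerN2.
- apply: continuous_subspaceT => s; apply: differentiable_continuous; apply/derivable1_diffP.
  by have [] := is_derive_Kup n0 D s a0.
- by move=> s _; exact: is_derive_Kup.
Qed.

Let annulus_lo t : c <= t -> t <= D ->
  (\int[@vol R n]_(x in @annulus R n c t) (h x)%:E <= (vn * (Klo n b D t - Klo n b D c))%:E)%E.
Proof.
move=> ct tD.
have <- : (\int[@vol R n]_(x in @annulus R n c t) (glo (enorm x))%:E = (vn * (Klo n b D t - Klo n b D c))%:E)%E; last first.
  apply: ge0_le_integral => //.
  + exact: measurable_annulus.
  + apply: measurable_funTS; apply/measurable_EFinP.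
    by apply: measurableT_comp; [exact: mcomp|exact: measurable_enorm].
  + move=> x /andP[cx xt]; rewrite lee_fin ler_expR lerN2.
    apply: le_trans (ler_wpM2l (ltW ld0) (lens_ge n0 (ltW cx) (le_trans xt tD))).
    by rewrite /b exprMn exprVn -/vn -/D le_eqVlt; apply/orP; left; apply/eqP; ring.
apply: radial_integral => //.
- by move=> s; exact: expR_ge0.
- exact: mcomp.
- move=> s u _ su ut; rewrite ler_expR lerN2 ler_pM2l // lerXn2r ?nnegrE ?subr_ge0 //.
  + exact: le_trans ut tD.
  + exact: le_trans su (le_trans ut tD).
  + by rewrite lerD2l lerN2.
- apply: continuous_subspaceT; exact: continuous_Klo.
- move=> s; rewrite in_itv /= => /andP[_ st]; apply: is_derive_Klo => //.
  exact: lt_le_trans tD.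
Qed.

(** The ball of radius [c] contributes exactly, the lens volume being constant there; on the annulus
    the upper bound on the lens gives the lower bound here, and conversely. *)
Lemma ball_exp_bounds t : c <= t -> t <= D ->
  vn * (expR (- (ld * vn * beta ^+ n)) * c ^+ n + (Kup n a D t - Kup n a D c)) <= ball_exp t <=
  vn * (expR (- (ld * vn * beta ^+ n)) * c ^+ n + (Klo n b D t - Klo n b D c)).
Proof.
move=> ct tD; rewrite -!lee_fin (ball_split ct tD) !mulrDr !EFinD.
have -> : vn * (expR (- (ld * vn * beta ^+ n)) * c ^+ n) = expR (- (ld * vn * beta ^+ n)) * (vn * c ^+ n) by ring.
have hu := annulus_up ct tD; have hl := annulus_lo ct tD.
by apply/andP; split; rewrite leeD2l // -?EFinD -?mulrDr.
Qed.

(** When [r] exceeds the diameter of the daughter ball, the ball of radius [r] around any of its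
    points contains it entirely, so the integrand is constant. *)
Lemma palmJ_far : 2 * rd < r -> palmJ n ld rd r = expR (- (ld * vn * rd ^+ n)) * (vn * rd ^+ n).
Proof.
move=> rrd; have [rdc brd] := shell_far rd0 rrd.
apply: EFin_inj; rewrite palmJE // (eq_integral (cst (expR (- (ld * vn * rd ^+ n)))%:E)).
  rewrite integral_cst; last exact: measurable_cball.
  by apply: etrans (congr1 (mule _) (vol_cball (vzero R n) n0 (ltW rd0))) _; rewrite -EFinM.
move=> x /set_mem; rewrite /cball /= vsubx0 => xc.
by rewrite lens_inner ?(le_trans xc) // brd mulrA.
Qed.

End BallIntegral.

Section AtZero.
Variables (R : realType) (n : nat) (ld rd : R).
Hypotheses (n0 : (0 < n)%N) (ld0 : 0 < ld) (rd0 : 0 < rd).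

Lemma lens_0 (x : n.-tuple R) : @lens R n rd 0 x = 0.
Proof.
apply/eqP; rewrite eq_le lens_ge0 andbT -lee_fin lens_vol.
have -> : 0%:E = vol (cball x (0 : R)) by rewrite vol_cball // expr0n gtn_eqF // mulr0.
apply: measure_mono; last exact: subIsetl.
- by apply: measurableI; exact: measurable_cball.
- exact: measurable_cball.
Qed.

Lemma capG_0 : capG n ld rd 0 = 0.
Proof.
rewrite /capG /capa /relcap; apply: etrans (_ : fine 0%E = 0) => //; congr fine.
by apply: integral0_eq => x _; rewrite lensE lens_0 mulr0 oppr0 expR0 subrr.
Qed.

Lemma palmJ_0 : palmJ n ld rd 0 = vball R n * rd ^+ n.
Proof.
apply: EFin_inj; rewrite palmJE // (eq_integral (cst 1%:E)).
  rewrite integral_cst; last exact: measurable_cball.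
  rewrite mul1e; exact: (vol_cball (vzero R n) n0 (ltW rd0)).
by move=> x _; rewrite lens_0 mulr0 oppr0 expR0.
Qed.

End AtZero.

Section ClosedForms.
Variables (R : realType) (n : nat) (lp ld rd r : R).
Hypotheses (n0 : (0 < n)%N) (ld0 : 0 < ld) (rd0 : 0 < rd) (r0 : 0 < r).
Let vn := vball R n.
Let vn0 : 0 < vn. Proof. exact: vball_gt0. Qed.
Let beta := Order.min r rd.
Let c := `|r - rd|.
Let D := r + rd.
Let D0 : 0 < D. Proof. by rewrite addr_gt0. Qed.
Let a := ld * 2 ^+ (n - 1) * beta ^+ (n - 1).
Let b := ld * vn * (2 ^+ n)^-1.
(** The shell has width [2 * beta]; hence at its inner edge the two exponents become
    [2 ^ n * ld * beta ^ n] and [ld * vn * beta ^ n], the values in the closed forms. *)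
Let Dc : D - c = 2 * beta. Proof. exact: shell_width. Qed.

Let aDc : a * (D - c) = 2 ^+ n * ld * beta ^+ n.
Proof. by rewrite Dc /a; case: n n0 => // m _; rewrite subn1 /= !exprS; ring. Qed.

Let bDc : b * (D - c) ^+ n = ld * vn * beta ^+ n.
Proof. by rewrite Dc /b exprMn; field; rewrite expf_neq0. Qed.

Let b1 : b^-1 = (ld * vn)^-1 * 2 ^+ n.
Proof. by rewrite /b; field; rewrite expf_neq0 ?pnatr_eq0 // !gt_eqF. Qed.

Lemma Kup_shell : Kup n a D D - Kup n a D c =
  n`!%:R * \sum_(k < n) ((-1) ^+ (n - k - 1) / k`!%:R * a ^- (n - k)
          * (D ^+ k - c ^+ k * expR (- (2 ^+ n * ld * beta ^+ n)))).
Proof.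
rewrite /Kup aDc subrr mulr0 oppr0 expR0 -sumrB mulr_sumr; apply: eq_bigr => k _.
by rewrite subnAC; ring.
Qed.

Lemma Kup_rd : Kup n a D rd - Kup n a D c =
  \sum_(k < n) ((-1) ^+ (n - 1 - k) * (n`!%:R / k`!%:R) * a ^- (n - k)
     * (expR (- (a * r)) * rd ^+ k - expR (- (ld * 2 ^+ n * beta ^+ n)) * c ^+ k)).
Proof.
rewrite /Kup aDc; have -> : D - rd = r by rewrite /D addrK.
rewrite [2 ^+ n * ld]mulrC -sumrB; apply: eq_bigr => k _; ring.
Qed.

Lemma Klo_shell : Klo n b D D - Klo n b D c =
  D ^+ n * \sum_(i < n) ('C(n - 1, i)%:R * (-1) ^+ i * 2 ^+ i.+1
          * powR (ld * vn * D ^+ n) (- (i.+1%:R / n%:R))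
          * lgamma (i.+1%:R / n%:R) (ld * vn * beta ^+ n)).
Proof.
rewrite /Klo bDc subrr expr0n gtn_eqF // mulr0 opprK addrC -sumrB mulr_sumr.
apply: eq_bigr => i _; rewrite (@lgamma_le0 _ _ 0) // mulr0 subr0.
set s := i.+1%:R / n%:R.
(* This relation turns the real powers of [2 ^ n] and [D ^ n] with exponent [s] into integer
   powers. *)
have ns : n%:R * s = i.+1%:R by rewrite /s mulrC divfK // pnatr_eq0 -lt0n.
have q0 : 0 < ld * vn by exact: mulr_gt0.
have e1 : b^-1 `^ s = (ld * vn) `^ (- s) * 2 ^+ i.+1.
  have h1 : (2 ^+ n : R) `^ s = 2 ^+ i.+1 by rewrite -powR_mulrn // -powRrM ns powR_mulrn.
  have h2 : (ld * vn)^-1 `^ s = (ld * vn) `^ (- s) by rewrite -powR_inv1 ?(ltW q0) // -powRrM mulN1r.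
  rewrite -h2 -h1 -powRM ?exprn_ge0 ?invr_ge0 ?(ltW q0) //. by congr (_ `^ s).
have e2 : (ld * vn * D ^+ n) `^ (- s) = (ld * vn) `^ (- s) * (D ^+ i.+1)^-1.
  rewrite powRM ?exprn_ge0 ?(ltW q0) ?(ltW D0) //.
  rewrite -(powR_mulrn n (ltW D0)) -powRrM mulrN ns.
  by rewrite powR_invn // ltW.
have e3 : D ^+ n = D ^+ (n - 1 - i) * D ^+ i.+1.
  by rewrite -exprD -subnDA add1n subnK.
by rewrite e1 e2 e3; field; rewrite expf_neq0 // gt_eqF.
Qed.

Lemma Klo_rd : Klo n b D rd - Klo n b D c =
  \sum_(i < n) ('C(n - 1, i)%:R * (-1) ^+ i * D ^+ (n - 1 - i)
          * powR ((ld * vn)^-1 * 2 ^+ n) (i.+1%:R / n%:R)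
          * (lgamma (i.+1%:R / n%:R) (ld * vn * beta ^+ n)
             - lgamma (i.+1%:R / n%:R) (ld * vn * (2 ^+ n)^-1 * r ^+ n))).
Proof.
rewrite /Klo bDc b1 opprK addrC; have -> : D - rd = r by rewrite /D addrK.
by rewrite -sumrB; apply: eq_bigr => i _; rewrite -mulrBr.
Qed.

End ClosedForms.

(** * Assembly of the bounds *)

Lemma shell_exponent_le (R : realType) (l v X C e S B : R) : 0 < l ->
  v * (e * C + S) <= B -> l * (v * X - B) <= v * l * (X - C * e - S).
Proof.
move=> l0 h; have -> : v * l * (X - C * e - S) = l * (v * X - v * (e * C + S)) by ring.
by rewrite ler_pM2l // lerD2l lerN2.
Qed.

Lemma shell_exponent_ge (R : realType) (l v X C e S B : R) : 0 < l ->
  B <= v * (e * C + S) -> v * l * (X - C * e - S) <= l * (v * X - B).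
Proof.
move=> l0 h; have -> : v * l * (X - C * e - S) = l * (v * X - v * (e * C + S)) by ring.
by rewrite ler_pM2l // lerD2l lerN2.
Qed.

Theorem theorem5 (R : realType) (d : measure_display) (Omega : measurableType d)
    (P : probability Omega R) (n : nat)
    (par : Omega -> nat -> n.-tuple R) (dau : nat -> Omega -> set (n.-tuple R))
    (lp ld rd : R) :
  (0 < n)%N -> 0 < lp -> 0 < ld -> 0 < rd ->
  is_matern_cluster P par dau lp ld rd ->
  forall r : R, 0 < r ->
    FRN_lo n lp ld rd r <= nn_cdf P (fun w => matern (par w) (fun i => dau i w)) r
    /\ nn_cdf P (fun w => matern (par w) (fun i => dau i w)) r <= FRN_up n lp ld rd r.
Proof.
move=> n0 lp0 ld0 rd0 mcp r r0.
rewrite (nn_cdfE n0 lp0 ld0 mcp (ltW r0)).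
have vn0 : 0 < vball R n by exact: vball_gt0.
set vn := vball R n in vn0.
have rdn : 0 < rd ^+ n by exact: exprn_gt0.
(* At radius 0 the exponential is 1 and [palmJ] is the volume of the daughter ball; the intensities
   cancel. *)
have -> : kappa n lp ld rd r / kappa n lp ld rd 0 =
    expR (- (lp * capG n ld rd r)) * (rd ^- n * (palmJ n ld rd r / vn)).
  rewrite /kappa capG_0 // palmJ_0 // mulr0 oppr0 expR0 -/vn.
  by field; rewrite !gt_eqF.
set e0 := expR (- (ld * vn * Order.min r rd ^+ n)).
have [cr Dr] : `|r - rd| <= r + rd /\ rd <= r + rd.
  by split; [exact: shell_le (ltW r0) (ltW rd0)|rewrite lerDr ltW].
have /andP[bu bl] := ball_exp_bounds n0 ld0 rd0 r0 cr (lexx _).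
rewrite -/vn -/e0 Kup_shell // in bu; rewrite -/vn -/e0 Klo_shell // in bl.
(* A lower bound on the ball integral bounds the capacity from above, hence the void probability
   from below. *)
have cup : 1 - FRC_up n lp ld rd r <= expR (- (lp * capG n ld rd r)).
  rewrite /FRC_up opprB addrCA subrr addr0 ler_expR lerN2 capG_ball_exp // -/vn -/e0.
  exact: shell_exponent_le.
have clo : expR (- (lp * capG n ld rd r)) <= 1 - FRC_lo n lp ld rd r.
  rewrite /FRC_lo opprB addrCA subrr addr0 ler_expR lerN2 capG_ball_exp // -/vn -/e0.
  exact: shell_exponent_ge.
have pJ0 : 0 <= rd ^- n * (palmJ n ld rd r / vn).
  by rewrite mulr_ge0 ?invr_ge0 ?(ltW rdn) // divr_ge0 ?palmJ_ge0 ?ltW.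
have up0 : 0 <= 1 - FRC_up n lp ld rd r.
  by rewrite /FRC_up opprB addrCA subrr addr0 expR_ge0.
have final x y : x <= palmJ n ld rd r / vn -> palmJ n ld rd r / vn <= y ->
  1 - (1 - FRC_lo n lp ld rd r) * rd ^- n * y <=
  1 - expR (- (lp * capG n ld rd r)) * (rd ^- n * (palmJ n ld rd r / vn)) /\
  1 - expR (- (lp * capG n ld rd r)) * (rd ^- n * (palmJ n ld rd r / vn)) <=
  1 - (1 - FRC_up n lp ld rd r) * rd ^- n * x.
  move=> xJ Jy; rewrite !lerD2l !lerN2 -!mulrA; split.
    apply: ler_pM => //.
    by rewrite ler_pM2l // invr_gt0.
  (* The sign of [x] is not known, so the two factors are exchanged one at a time, each against a
     nonnegative partner. *)
  apply: (@le_trans _ _ ((1 - FRC_up n lp ld rd r) * (rd ^- n * (palmJ n ld rd r / vn)))).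
    by apply: ler_wpM2l => //; rewrite ler_pM2l // invr_gt0.
  exact: ler_wpM2r.
rewrite /FRN_lo /FRN_up; case: ifPn => [rrd|]; last first.
  rewrite -ltNge => rrd; have [_ brd] := shell_far rd0 rrd.
  have e : palmJ n ld rd r / vn = expR (- (ld * vn * rd ^+ n)) * rd ^+ n.
    by rewrite palmJ_far // -/vn; field; rewrite gt_eqF.
  (* Beyond [2 * rd] the cluster factor is known exactly and serves as both bounds. *)
  have := final _ _ (lexx _) (lexx _).
  suff h x : x * rd ^- n * (palmJ n ld rd r / vn) = x * expR (- (ld * vn * rd ^+ n)) by rewrite !h.
  by rewrite e; field; rewrite gt_eqF.
have crd := shell_le_rd (ltW r0) rrd.
(* The same bounds at [t = rd], where the ball integral is [palmJ]; the condition [r <= 2 * rd] puts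
   [rd] beyond the inner edge of the shell. *)
have /andP[pu pl] := ball_exp_bounds n0 ld0 rd0 r0 crd Dr.
rewrite -/vn -/e0 Kup_rd // in pu; rewrite -/vn -/e0 Klo_rd // in pl.
by apply: final; rewrite ?ler_pdivlMr ?ler_pdivrMr // mulrC.
Qed.
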